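(* Korenblum's constant satisfies $c_2 \geq 0.4263$. Equivalently, if $f, g \in A^2(\mathbb{D})$ and $|f(z)| \leq |g(z)|$ for all $z$ with $0.4263 < |z| < 1$, then $\|f\|_{A^2} \leq \|g\|_{A^2}$.
   Context: $\mathbb{D}$ is the open unit disk in $\mathbb{C}$, and $dA(z) = \pi^{-1}\,dx\,dy$ is normalized area measure. The Bergman space $A^2(\mathbb{D})$ consists of all holomorphic functions $f$ on $\mathbb{D}$ such that $\|f\|_{A^2}^2 = \int_{\mathbb{D}} |f(z)|^2\,dA(z) < \infty$. A constant $c \in (0,1)$ is called admissible (in Korenblum's maximum principle) if for all $f, g \in A^2(\mathbb{D})$ with $|f(z)| \leq |g(z)|$ for $c < |z| < 1$, one has $\|f\|_{A^2} \leq \|g\|_{A^2}$. Korenblum's constant $c_2$ is the supremum of the admissible constants $c$. *)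

(* Defs.v *)
From HB Require Import structures.
From mathcomp Require Import all_boot all_order all_algebra.
From mathcomp Require Import complex.
From mathcomp Require Import all_classical all_reals all_analysis.

Set Implicit Arguments.
Unset Strict Implicit.
Unset Printing Implicit Defensive.

Import Order.TTheory GRing.Theory Num.Theory.
Import numFieldNormedType.Exports.

Local Open Scope classical_set_scope.
Local Open Scope complex_scope.
Local Open Scope ring_scope.

(* R[i] seen as a bare numFieldType: the library attaches the norm topology and
   the normed-module structure to [Num.NumField.sort], not to [R[i]] itself. *)
Definition Cplx (R : realType) : numFieldType := R[i].

Definition unit_disk (R : realType) : set (Cplx R) := [set z | `|z| < 1].

(* [derivable f z 1] is the existence of the limit of h^-1 (f (z + h) - f z) as
   the complex scalar h tends to 0, i.e. complex differentiability at z. *)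
Definition holomorphic_on (R : realType) (D : set (Cplx R))
    (f : Cplx R -> Cplx R) : Prop :=
  forall z, D z -> derivable f z 1.

(* dA = dx dy / pi, with the plane identified with R * R. *)
Definition bergman_sqnorm (R : realType) (f : Cplx R -> Cplx R) : \bar R :=
  ((pi^-1)%:E *
   \int[(@lebesgue_measure R \x @lebesgue_measure R)]_(p in
          [set p : R * R | unit_disk (p.1 +i* p.2)])
     ((ComplexField.Normc.normc (f (p.1 +i* p.2))) ^+ 2)%:E)%E.

Definition bergman (R : realType) : set (Cplx R -> Cplx R) :=
  [set f | holomorphic_on (@unit_disk R) f /\ (bergman_sqnorm f < +oo)%E].

Definition bergman_norm (R : realType) (f : Cplx R -> Cplx R) : R :=
  Num.sqrt (fine (bergman_sqnorm f)).

Definition korenblum_admissible (R : realType) (c : R) : Prop :=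
  0 < c < 1 /\
  forall f g : Cplx R -> Cplx R, bergman f -> bergman g ->
    (forall z : Cplx R, c%:C < `|z| < 1 -> `|f z| <= `|g z|) ->
    bergman_norm f <= bergman_norm g.

(* [sup] is 0 on an empty set; here the set is bounded above by 1. *)
Definition korenblum_constant (R : realType) : R :=
  sup [set c : R | korenblum_admissible c].

(* Main.v *)
(** Let [|f| <= |g|] for [c < |z| < 1] and [0 < t < 1].  Put [F = g + t f],
    [H = g - t f] and [u = F / H]: on the annulus [u] is bounded with
    [Re u >= 0], and it is holomorphic off finitely many zeros of [g], so its
    Fourier coefficients on circles scale like powers of the radius.  Since
    [F = u H], the number [sum_n (|g_n|^2 - t^2 |f_n|^2) r^(2n) / (n+1)] is, up
    to truncation, a Hermitian form in the weighted coefficients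
    [x_n = H_n r^n / (n+1)] whose kernel is linear in the coefficients of [u].
    Each coefficient of [u] may be read either on the circle of radius [r] or on
    the circle of radius [3 r / 7]; splitting the kernel accordingly gives the
    mean of [Re u] times the real symmetric form [kerA] on the first circle plus
    the mean of [Re u] times [kerB] on the second.  Both forms are positive
    semidefinite: up to a diagonally dominant Toeplitz remainder each is an
    explicit Gram matrix.  The constant 3/7 exceeds 0.4263, so the inner
    circle lies in the annulus once [r] is close to 1. *)
Require Import Defs.
From mathcomp Require Import all_boot all_order all_algebra.
From mathcomp Require Import complex.
From mathcomp Require Import ring lra ssrZ zify.
From Stdlib Require ZArith.
From mathcomp Require Import all_classical all_reals all_analysis.
From mathcomp Require Import measurable_realfun.

Set Implicit Arguments.
Unset Strict Implicit.
Unset Printing Implicit Defensive.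

Import Order.TTheory GRing.Theory Num.Theory.
Import numFieldNormedType.Exports.

Local Open Scope ring_scope.

(** * Quadratic forms and the two positivity certificates *)

Section QuadraticForms.
Variable R : realFieldType.
Implicit Types (K : nat -> nat -> R) (y : nat -> R) (N : nat).

(** Why two circles: the coefficients satisfy F_n = sum_m H_m r^(m-n) u_(n-m), and in the unknowns
    x_n the series becomes a form with kernel m+1. This kernel is not symmetric, so Im u, of which
    nothing is known, would enter. For a real symmetric kernel the form is real at every angle and
    only Re u >= 0 counts. With rho = 3/7, passing to the inner circle multiplies the entry (n, m)
    by rho^(n-m). The equations A + B rho^(n-m) = m+1 and A + B rho^(m-n) = n+1 then fix every
    off-diagonal entry of the symmetric kernels A and B; only the splitting of the diagonal is free,
    and one splitting has to make both kernels positive. The factor t < 1 gives |H| >= (1-t)|g|,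
    which bounds u and confines its singularities to zeros of g. Since u stays bounded, these are
    crossed by a limit of circle means, without removing them and without factoring g. *)

Definition qform K N y : R := \sum_(n < N) \sum_(m < N) K n m * (y n * y m).

Definition distn_nat (n m : nat) : nat := (n - m + (m - n))%N.

Lemma distn_natC n m : distn_nat n m = distn_nat m n.
Proof. by rewrite /distn_nat addnC. Qed.

Lemma qform_ext K K' N y : (forall n m, K n m = K' n m) -> qform K N y = qform K' N y.
Proof. by move=> h; apply: eq_bigr => n _; apply: eq_bigr => m _; rewrite h. Qed.

Lemma qformD K K' N y : qform (fun n m => K n m + K' n m) N y = qform K N y + qform K' N y.
Proof.
rewrite /qform -big_split; apply: eq_bigr => n _.
by rewrite -big_split; apply: eq_bigr => m _; rewrite mulrDl.
Qed.

Lemma qform_gram_ge0 (I : Type) (s : seq I) (v : I -> nat -> R) N y :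
  0 <= qform (fun n m => \sum_(i <- s) v i n * v i m) N y.
Proof.
have -> : qform (fun n m => \sum_(i <- s) v i n * v i m) N y =
    \sum_(i <- s) (\sum_(n < N) v i n * y n) ^+ 2.
  rewrite /qform.
  under eq_bigr => n _ do under eq_bigr => m _ do rewrite mulr_suml.
  under eq_bigr => n _ do rewrite exchange_big.
  rewrite exchange_big; apply: eq_bigr => i _.
  rewrite expr2 mulr_suml; apply: eq_bigr => n _.
  by rewrite mulr_sumr; apply: eq_bigr => m _; rewrite mulrACA.
by apply: sumr_ge0 => i _; exact: sqr_ge0.
Qed.

Lemma qform_rank1_ge0 (c : R) (v : nat -> R) N y : 0 <= c ->
  0 <= qform (fun n m => c * (v n * v m)) N y.
Proof.
move=> c0; have -> : qform (fun n m => c * (v n * v m)) N y =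
    c * (\sum_(n < N) v n * y n) ^+ 2.
  rewrite expr2 mulr_suml mulr_sumr; apply: eq_bigr => n _.
  rewrite !mulr_sumr; apply: eq_bigr => m _; ring.
by rewrite mulr_ge0 ?sqr_ge0.
Qed.

Lemma qform_corner_ge0 (c : R) N y : 0 <= c ->
  0 <= qform (fun n m => c *+ ((n == 0%N) && (m == 0%N))) N y.
Proof.
move=> c0; apply: sumr_ge0 => n _; apply: sumr_ge0 => m _.
case: eqP => [->|_] /=; last by rewrite mul0r.
case: eqP => [->|_] /=; last by rewrite mul0r.
by rewrite mulr_ge0 // -expr2 sqr_ge0.
Qed.

(** Every distance k >= 1 from [n] occurs at most once to its left and once to its right, hence the
    doubled bound. *)
Lemma sum_dist_le (r : nat -> R) (E : R) (n N : nat) : (n < N)%N ->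
  (forall M, \sum_(1 <= k < M) `|r k| <= E) ->
  \sum_(m < N | m != n :> nat) `|r (distn_nat n m)| <= E + E.
Proof.
move=> nN hE.
rewrite -(big_mkord (fun m => m != n) (fun m => `|r (distn_nat n m)|)).
rewrite (big_cat_nat (n := n)) //=; last exact: ltnW.
apply: lerD.
  apply: le_trans (hE n.+1).
  rewrite big_nat_cond big_mkcond /= -big_mkcond /=.
  rewrite -big_nat_cond big_nat_rev /= add0n [leRHS]big_add1 /=.
  rewrite big_mkcond /= !big_nat ler_sum // => i /andP[_ i_lt].
  case: ifP => // _.
  by rewrite /distn_nat (_ : _ + _ = i.+1)%N//; lia.
rewrite big_ltn_cond // eqxx /=.
apply: le_trans (hE (N - n)%N).
rewrite -[n.+1]add1n big_addn.
rewrite big_mkcond /= !big_nat ler_sum // => i /andP[i0 i_lt].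
case: ifP => // _.
by rewrite /distn_nat (_ : _ + _ = i)%N//; lia.
Qed.

(* Gershgorin's diagonal dominance. *)
Lemma qform_toeplitz_ge0 (r : nat -> R) (E : R) N y :
  (forall M, \sum_(1 <= k < M) `|r k| <= E) -> E + E <= r 0%N ->
  0 <= qform (fun n m => r (distn_nat n m)) N y.
Proof.
move=> hE hr.
pose a n m := `|r (distn_nat n m)|.
have aC n m : a n m = a m n by rewrite /a distn_natC.
have h (n : 'I_N) : r 0%N * y n ^+ 2
    - \sum_(m < N | m != n :> nat) a n m * ((y n ^+ 2 + y m ^+ 2) / 2)
    <= \sum_(m < N) r (distn_nat n m) * (y n * y m).
  rewrite [leRHS](bigD1 n) //= {1}/distn_nat subnn addn0 -expr2 lerD2l -sumrN.
  apply: ler_sum => m _; rewrite lerNl.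
  apply: le_trans (ler_norm _) _; rewrite normrN normrM ler_wpM2l //.
  have : 0 <= (`|y n| - `|y m|) ^+ 2 by exact: sqr_ge0.
  rewrite normrM sqrrB !real_normK ?num_real // -mulr_natr; lra.
apply: le_trans (ler_sum _ (fun n _ => h n)).
rewrite sumrB subr_ge0.
have -> : \sum_(n < N) \sum_(m < N | m != n :> nat) a n m * ((y n ^+ 2 + y m ^+ 2) / 2)
   = \sum_(n < N) (\sum_(m < N | m != n :> nat) a n m) * y n ^+ 2.
  under eq_bigr => n _ do under eq_bigr => m _ do
    rewrite [_ / 2]mulrDl mulrDr.
  under eq_bigr => n _ do rewrite big_split /=.
  rewrite big_split /= [X in _ + X](exchange_big_dep predT) //=.
  rewrite -big_split /=; apply: eq_bigr => n _.
  rewrite mulr_suml.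
  under [X in _ + X]eq_bigl => m do rewrite eq_sym.
  rewrite -big_split /=; apply: eq_bigr => m _.
  by rewrite (aC m n) -mulrDr -splitr.
apply: ler_sum => n _; apply: ler_wpM2r; first exact: sqr_ge0.
by apply: le_trans hr; apply: sum_dist_le.
Qed.

(** Column [n] carries [d] from row [n] downwards, so nothing is cut off at row 0 and, once [M] is
    past the support, the Gram matrix is exactly Toeplitz, without boundary correction. *)
Lemma gram_shift (d : nat -> R) (p M n m : nat) : (forall j, (p <= j)%N -> d j = 0) ->
  (n <= m)%N -> (m + p <= M)%N ->
  \sum_(0 <= i < M) (d (i - n)%N *+ (n <= i)%N) * (d (i - m)%N *+ (m <= i)%N) =
  \sum_(j < p) d j * d (j + (m - n))%N.
Proof.
move=> hd nm mM; have mM' : (m <= M)%N by lia.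
rewrite (big_cat_nat (n := m)) //= big_nat big1 ?add0r; last first.
  by move=> i /andP[_ im]; rewrite [(m <= i)%N]leqNgt im mulr0.
rewrite -{1}[m]add0n big_addn.
rewrite (big_cat_nat (n := p)) //=; last by lia.
rewrite [X in _ + X]big_nat [X in _ + X]big1 ?addr0; last first.
  by move=> i /andP[pi _]; rewrite addnK (hd i pi) mul0rn mulr0.
rewrite big_mkord; apply: eq_bigr => i _.
rewrite addnK leq_addl mulr1n (_ : (n <= i + m)%N) ?mulr1n; last by lia.
by rewrite mulrC; congr (_ * d _); lia.
Qed.

Definition autocorr (d : nat -> R) p k := \sum_(j < p) d j * d (j + k)%N.

Lemma sum_halving (b : nat -> R) (K M : nat) : (forall k, (K <= k)%N -> 0 <= b k) ->
  (forall k, (K <= k)%N -> b k.+1 <= b k / 2) ->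
  \sum_(K <= k < M) b k <= b K + b K.
Proof.
move=> b0 bh; case: (leqP K M) => KM; last first.
  by rewrite big_geq ?addr_ge0 ?b0 // ltnW.
(* The subtracted term makes the induction close: its step is exactly [2 * b k.+1 <= b k]. *)
suff h n : \sum_(K <= k < K + n) b k <= b K + b K - 2 * b (K + n)%N.
  rewrite -(subnKC KM); apply: le_trans (h _) _.
  by rewrite gerBl mulr_ge0 ?b0 // leq_addr.
elim: n => [|n IH]; first by rewrite addn0 big_geq //; lra.
rewrite addnS big_nat_recr ?leq_addr //=.
have := bh (K + n)%N (leq_addr _ _); have := b0 (K + n)%N (leq_addr _ _); lra.
Qed.

End QuadraticForms.

(** * Positivity of [kerB], certified by integer arithmetic *)

Section CertificateB.
Import ZArith.
Delimit Scope nat_scope with N.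
Variable R : realFieldType.

(* Locked: unification must never evaluate the unary integer behind [zr z]. *)
Definition zr : Z -> R := locked (fun z => (int_of_Z z)%:~R).

Lemma zrE z : zr z = (int_of_Z z)%:~R.
Proof. by rewrite /zr -lock. Qed.
Lemma zr0 : zr 0 = 0. Proof. by rewrite zrE. Qed.

Lemma zrD a b : zr (a + b)%Z = zr a + zr b.
Proof. by rewrite !zrE -rmorphD /= -rmorphD. Qed.
Lemma zrM a b : zr (a * b)%Z = zr a * zr b.
Proof. by rewrite !zrE -rmorphM /= -rmorphM. Qed.
Lemma zrN a : zr (- a)%Z = - zr a.
Proof. by rewrite !zrE -rmorphN /= -rmorphN. Qed.
Lemma zrB a b : zr (a - b)%Z = zr a - zr b.
Proof. by rewrite /Z.sub zrD zrN. Qed.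
Lemma zr_le a b : (a <=? b)%Z = true -> zr a <= zr b.
Proof. move=> h; rewrite !zrE ler_int; lia. Qed.
Lemma zr_lt a b : (a <? b)%Z = true -> zr a < zr b.
Proof. move=> h; rewrite !zrE ltr_int; lia. Qed.
Lemma zr_nat n : zr (Z.of_nat n) = n%:R.
Proof. by rewrite zrE; have -> : int_of_Z (Z.of_nat n) = Posz n by lia. Qed.
Lemma zrX a n : zr (a ^ Z.of_nat n)%Z = zr a ^+ n.
Proof.
elim: n => [|n IH]; first by rewrite expr0 zrE.
by rewrite Nat2Z.inj_succ Z.pow_succ_r ?zrM ?IH ?exprS //; lia.
Qed.
Lemma zr_norm a : `|zr a| = zr (Z.abs a).
Proof.
rewrite !zrE -intr_norm; congr (_%:~R); lia.
Qed.

(** A plain fold over integers, which [vm_compute] can run; [zr_sum] links it to the sum in [R]. *)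
Definition sumZ (f : nat -> Z) n : Z := foldr (fun i s => (f i + s)%Z) 0%Z (iota 0 n).

Lemma zr_sum f n : zr (sumZ f n) = \sum_(i < n) zr (f i).
Proof.
rewrite -(big_mkord xpredT (fun i => zr (f i))) /index_iota subn0 /sumZ.
by elim: (iota 0 n) => [|i s IH] /=; rewrite ?big_nil ?zr0 // zrD IH big_cons.
Qed.

(* Each |P k / Q k| is rounded up to a multiple of 10^-9, so that the sum is
   evaluated on integers. *)
Lemma zr_sum_abs_le (P Q : nat -> Z) (E : Z) n :
  (forall k, (0 < k)%N -> (0 < Q k)%Z) ->
  (sumZ (fun i => Z.abs (P i.+1) * 10 ^ 9 / Q i.+1 + 1)%Z n <=? E)%Z = true ->
  \sum_(1 <= k < n.+1) `|zr (P k) / zr (Q k)| <= zr E / zr (10 ^ 9)%Z.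
Proof.
move=> Q0 hE; rewrite big_add1 /= big_mkord.
apply: le_trans (_ : zr (sumZ (fun i => Z.abs (P i.+1) * 10 ^ 9 / Q i.+1 + 1)%Z n)
    / zr (10 ^ 9)%Z <= _); last first.
  by rewrite ler_pM2r ?zr_le // invr_gt0 -zr0; exact: zr_lt.
rewrite zr_sum mulr_suml; apply: ler_sum => i _.
have q0 : 0 < zr (Q i.+1).
  by rewrite -zr0; apply: zr_lt; apply/Z.ltb_lt; exact: Q0.
have t0 : 0 < zr (10 ^ 9)%Z by rewrite -zr0; exact: zr_lt.
rewrite normrM normfV (gtr0_norm q0) zr_norm ler_pdivlMr // mulrAC ler_pdivrMr //.
rewrite -!zrM; apply: zr_le; apply/Z.leb_le.
have /(Z.mul_succ_div_gt (Z.abs (P i.+1) * 10 ^ 9)%Z) := Q0 i.+1 isT.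
lia.
Qed.

(** Solution of the kernel equations at (n, m) and (m, n), with k = |n - m| and rho = 3/7:
    subtracting them gives B (rho^(-k) - rho^k) = k, hence [beta_coef k]; substituting back leaves A
    = 1 + min(n, m) - [t_coef k]. *)
Definition beta_coef k : R := k%:R * (3 / 7) ^+ k / (1 - (9 / 49) ^+ k).
Definition t_coef k : R := k%:R * (9 / 49) ^+ k / (1 - (9 / 49) ^+ k).
Definition split_diag n : R := zr 59011 / zr 100000 - (zr 3260 / zr 100000) *+ (n == 0%N).

(* 3/7 is the ratio of the two radii and 9/49 its square; the diagonal of the
   kernel is shared between the two circles by [split_diag], whose decimals are
   chosen so that both certificates leave some slack. *)
Definition kerA n m : R := if n == m then n.+1%:R - split_diag n
  else 1 + (minn n m)%:R - t_coef (distn_nat n m).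
Definition kerB n m : R := if n == m then split_diag n else beta_coef (distn_nat n m).

Lemma zr49 : zr 49 = 49. Proof. exact: (zr_nat 49). Qed.
Lemma zr9 : zr 9 = 9. Proof. exact: (zr_nat 9). Qed.
Lemma zr21 : zr 21 = 21. Proof. exact: (zr_nat 21). Qed.

(** The factor 1 - (9/49)^k with its denominator cleared, so that [beta_coef] and [t_coef] become
    quotients of integers. *)
Definition Qden k : Z := (49 ^ Z.of_nat k - 9 ^ Z.of_nat k)%Z.

Lemma Qden_gt0 k : (0 < k)%N -> (0 < Qden k)%Z.
Proof. by move=> k0; apply/Z.lt_0_sub/Z.pow_lt_mono_l; lia. Qed.

Lemma zrQden_neq0 k : (0 < k)%N -> zr (Qden k) != 0.
Proof.
by move=> /Qden_gt0/Z.ltb_lt/zr_lt; rewrite zr0 => h; rewrite gt_eqF.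
Qed.

Lemma q_coefE (a : R) k : (0 < k)%N ->
  k%:R * (a / 49) ^+ k / (1 - (9 / 49) ^+ k) = k%:R * a ^+ k / zr (Qden k).
Proof.
move=> k0; have := zrQden_neq0 k0.
rewrite /Qden zrB !zrX zr49 zr9 !expr_div_n.
have : (49 : R) ^+ k != 0 by rewrite expf_neq0 // pnatr_eq0.
set u := 49 ^+ k; set v := 9 ^+ k; set w := a ^+ k => u0 uv0.
have uv : 1 - v / u != 0 by rewrite -[X in X - _](divff u0) -mulrBl mulf_neq0 ?invr_eq0.
by field; rewrite u0 uv0.
Qed.

Lemma beta_coefE k : (0 < k)%N ->
  beta_coef k = zr (Z.of_nat k * 21 ^ Z.of_nat k) / zr (Qden k).
Proof.
move=> k0; rewrite /beta_coef (_ : 3 / 7 = 21 / 49 :> R); last by field.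
by rewrite q_coefE // zrM zrX zr_nat zr21.
Qed.

Lemma t_coefE k : (0 < k)%N ->
  t_coef k = zr (Z.of_nat k * 9 ^ Z.of_nat k) / zr (Qden k).
Proof. by move=> k0; rewrite /t_coef q_coefE // zrM zrX zr_nat zr9. Qed.

Lemma geometric_coef_ge0 (a : R) k : 0 <= a ->
  0 <= k%:R * a ^+ k / (1 - (9 / 49) ^+ k).
Proof.
move=> a0; rewrite divr_ge0 ?mulr_ge0 ?exprn_ge0 // subr_ge0 exprn_ile1 //; lra.
Qed.

(** Consecutive numerators have ratio a (k+1)/k, which for a = 3/7 drops to 1/2 exactly at k = 6;
    the denominators only increase with k. *)
Lemma geometric_coef_halving (a : R) k : 0 <= a -> a <= 3 / 7 -> (6 <= k)%N ->
  k.+1%:R * a ^+ k.+1 / (1 - (9 / 49) ^+ k.+1) <=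
  k%:R * a ^+ k / (1 - (9 / 49) ^+ k) / 2.
Proof.
move=> a0 a1 k6.
have p1 : 0 <= (9 / 49 : R) ^+ k by rewrite exprn_ge0 //; lra.
have p2 : (9 / 49 : R) ^+ k < 1 by rewrite exprn_ilt1; first (by lia); lra.
rewrite [X in _ <= X]mulrAC.
apply: ler_pM.
- by rewrite mulr_ge0 // exprn_ge0.
- by rewrite invr_ge0 subr_ge0 exprn_ile1 //; lra.
- have x6 : (6 : R) <= k%:R by rewrite ler_nat.
  have -> : k.+1%:R * a ^+ k.+1 = (k%:R + 1) * a * a ^+ k :> R by rewrite natr1 exprS mulrA.
  have -> : k%:R * a ^+ k / 2 = k%:R / 2 * a ^+ k :> R by rewrite mulrAC.
  apply: ler_wpM2r; first exact: exprn_ge0.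
  nra.
- by rewrite lef_pV2 ?posrE ?subr_gt0 // exprS; nra.
Qed.

(* Numerical spectral factor, in units of 10^-5: the Toeplitz part of [kerB] is
   its autocorrelation up to the small remainder [residB]. *)
Definition lowerB : seq Z := [:: 18077; 41573; 44940; 34044; 21444; 12194; 6521;
  3350; 1674; 820; 395; 188; 89; 41; 19; 9; 4; 2]%Z.
Definition dB k : R := zr (nth 0%Z lowerB k) / zr 100000.
Definition residB k : R := if k == 0%N then zr 59011 / zr 100000 - autocorr dB 18 0
  else beta_coef k - autocorr dB 18 k.

Lemma dB_out j : (18 <= j)%N -> dB j = 0.
Proof. by move=> h; rewrite /dB nth_default // zr0 mul0r. Qed.

Definition acZ (s : seq Z) p k := sumZ (fun j => nth 0 s j * nth 0 s (j + k))%Z p.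

Lemma autocorr_zr (s : seq Z) p k :
  autocorr (fun j => zr (nth 0%Z s j) / zr 100000) p k = zr (acZ s p k) / zr 100000 ^+ 2.
Proof.
rewrite /autocorr /acZ zr_sum mulr_suml; apply: eq_bigr => i _.
by rewrite zrM expr2 invfM mulrACA.
Qed.

(* Only the first [p] coefficients see the autocorrelation; beyond them the
   coefficients are halved at each step. *)
Lemma sum_norm_split (r b : nat -> R) p e M :
  (0 < p)%N -> \sum_(1 <= k < p) `|r k| <= e ->
  (forall k, (p <= k)%N -> `|r k| = b k) ->
  (forall k, (p <= k)%N -> 0 <= b k) ->
  (forall k, (p <= k)%N -> b k.+1 <= b k / 2) ->
  \sum_(1 <= k < M) `|r k| <= e + (b p + b p).
Proof.
move=> p0 he rb b0 bh.
have bp : 0 <= b p + b p by rewrite addr_ge0 ?b0.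
case: (leqP M p) => Mp.
  apply: le_trans (le_trans he _); last by rewrite lerDl.
  have [M1|M1] := leqP M 1; first by rewrite big_geq // sumr_ge0.
  by rewrite [leRHS](big_cat_nat (n := M)) //= ?lerDl ?sumr_ge0 // ltnW.
rewrite (big_cat_nat (n := p)) //=; last exact: ltnW.
apply: lerD => //.
rewrite (eq_big_nat _ _ (F2 := b)) ?sum_halving // => k /andP[pk _]; exact: rb.
Qed.

(** Below 18 the coefficients are evaluated over the integers; from 18 on the autocorrelation is
    zero and [beta_coef] is at least halved at each step, so twice its first value bounds the tail.
    The diagonal slack [residB 0] has to cover this total twice. *)
Lemma residB_sum_le M : \sum_(1 <= k < M) `|residB k| <= zr 46000 / zr (10 ^ 9)%Z.
Proof.
have zS : zr 100000 != 0 by rewrite gt_eqF // -zr0 zr_lt.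
apply: le_trans (_ : zr 37100 / zr (10 ^ 9)%Z + (beta_coef 18 + beta_coef 18) <= _).
  apply: sum_norm_split => //.
  - rewrite (eq_big_nat _ _ (F2 := fun k =>
      `|zr (Z.of_nat k * 21 ^ Z.of_nat k * 100000 ^ 2 - acZ lowerB 18 k * Qden k)%Z /
       zr (Qden k * 100000 ^ 2)|)).
      apply: (@zr_sum_abs_le (fun k => (Z.of_nat k * 21 ^ Z.of_nat k * 100000 ^ 2 - acZ lowerB 18 k * Qden k)%Z) (fun k => Qden k * 100000 ^ 2)%Z).
        by move=> k k0; have := Qden_gt0 k0; lia.
      by vm_compute.
    move=> k /andP[k0 _]; have q0 := zrQden_neq0 k0.
    rewrite /residB gtn_eqF // beta_coefE // autocorr_zr; congr (`| _ |).
    rewrite zrB [zr (_ * 100000 ^ 2)]zrM (zrM (acZ _ _ _)) (zrM (Qden k)) (zrX 100000 2).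
    by field; rewrite zS q0.
  - move=> k k18; rewrite /residB gtn_eqF; last by lia.
    rewrite {1}/autocorr big1 => [|j _]; last by rewrite (@dB_out (j + k)) ?mulr0 //; lia.
    by rewrite subr0 ger0_norm //; apply: geometric_coef_ge0; lra.
  - by move=> k _; apply: geometric_coef_ge0; lra.
  - by move=> k k18; apply: geometric_coef_halving; [lra|lra|lia].
have q0 := zrQden_neq0 (isT : (0 < 18)%N).
have q1 : 0 < zr (Qden 18) by rewrite -zr0; apply: zr_lt; vm_compute.
have t1 : 0 < zr (10 ^ 9)%Z by rewrite -zr0; apply: zr_lt; vm_compute.
rewrite beta_coefE // -lerBrDl -mulrBl -mulrDl ler_pdivrMr // mulrAC ler_pdivlMr //.
rewrite -zrB -zrD -!zrM; apply: zr_le; by vm_compute.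
Qed.

(** The factor produces a constant diagonal, whereas [kerB] is lower by 0.0326 at (0, 0). Row 0 of
    the factor meets column 0 only, so leaving it out lowers exactly that corner, by [dB 0 ^+ 2]. A
    nonnegative corner remains, and diagonal dominance absorbs the rounding remainder. *)
Lemma kerB_qform_ge0 N y : 0 <= qform kerB N y.
Proof.
pose M := (N + 18)%N.
pose row i n : R := dB (i - n) *+ (n <= i)%N.
(* Row 0 is left out here. The length [n + m + 18] is symmetric and past the support of both
   columns, so by [GmE] any larger common length gives the same entry. *)
pose Gm n m := \sum_(i <- index_iota 1 (n + m + 18)) row i n * row i m.
have rowout i n : (n + 18 <= i)%N -> row i n = 0.
  by move=> h; rewrite /row dB_out ?mul0rn //; lia.
have GmE n m L : (n + m + 18 <= L)%N ->
    Gm n m = \sum_(1 <= i < L) row i n * row i m.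
  move=> h; rewrite [RHS](big_cat_nat (n := (n + m + 18)%N)) //=; last by lia.
  rewrite [X in _ + X]big_nat [X in _ + X]big1 ?addr0 // => i /andP[hi _].
  by rewrite rowout ?mul0r //; lia.
(* Row 0 weighs 0.18077^2, about 0.03268: just enough to pay for the deduction 0.0326. *)
have d0 : 0 <= dB 0 ^+ 2 - zr 3260 / zr 100000.
  rewrite subr_ge0 /dB expr_div_n ler_pdivrMr; last by rewrite -zr0 zr_lt.
  rewrite mulrAC ler_pdivlMr; last by rewrite exprn_gt0 // -zr0 zr_lt.
  by rewrite -!(zrX _ 2) -!zrM; apply: zr_le; vm_compute.
have sE n m : row 0%N n * row 0%N m = dB 0 ^+ 2 *+ ((n == 0%N) && (m == 0%N)).
  rewrite /row !sub0n !leqn0.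
  by case: (n == _); case: (m == _); rewrite ?mul0r ?mulr0 //= expr2.
have GmT n m : Gm n m + row 0%N n * row 0%N m = autocorr dB 18 (distn_nat n m).
  have -> : Gm n m + row 0%N n * row 0%N m =
      \sum_(0 <= i < n + m + 18) row i n * row i m.
    by rewrite [RHS]big_ltn ?addn_gt0 ?orbT // addrC.
  wlog nm : n m / (n <= m)%N => [wl|].
    case/orP: (leq_total n m) => h; first exact: wl.
    rewrite distn_natC -wl // (addnC m); apply: eq_bigr => i _; exact: mulrC.
  rewrite (@gram_shift _ dB 18) //; [|exact: dB_out|by lia].
  by rewrite -/(autocorr dB 18 _); congr (autocorr _ _ _); rewrite /distn_nat; lia.
rewrite (@qform_ext _ _ (fun n m => (Gm n m +
  (dB 0 ^+ 2 - zr 3260 / zr 100000) *+ ((n == 0%N) && (m == 0%N))) +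
  residB (distn_nat n m))); last first.
  move=> n m; rewrite mulrnBl -sE addrA GmT /kerB /residB.
  case: eqP => [->|/eqP nm].
    by rewrite /distn_nat subnn andbb eqxx /split_diag addn0 [RHS]addrC addrA subrK.
  have -> : (distn_nat n m == 0)%N = false by rewrite /distn_nat; lia.
  have -> : (n == 0)%N && (m == 0)%N = false by lia.
  by rewrite mulr0n subr0 addrC subrK.
rewrite qformD; apply: addr_ge0; last first.
  apply: (@qform_toeplitz_ge0 _ _ _ _ _ residB_sum_le).
  rewrite /residB eqxx autocorr_zr -mulrDl -zrD.
  have t1 : 0 < zr (10 ^ 9)%Z by rewrite -zr0; apply: zr_lt; vm_compute.
  have t2 : 0 < zr 100000 by rewrite -zr0; apply: zr_lt; vm_compute.
  have -> : zr 59011 / zr 100000 - zr (acZ lowerB 18 0) / zr 100000 ^+ 2 =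
     zr (59011 * 100000 - acZ lowerB 18 0)%Z / zr 100000 ^+ 2.
    by rewrite zrB zrM; field; rewrite gt_eqF.
  rewrite ler_pdivrMr // mulrAC ler_pdivlMr ?exprn_gt0 //.
  by rewrite -(zrX _ 2) -!zrM; apply: zr_le; vm_compute.
rewrite qformD; apply: addr_ge0; last exact: qform_corner_ge0.
have -> : qform Gm N y = qform (fun n m => \sum_(i <- index_iota 1 (N + N + 18)) row i n * row i m) N y.
  apply: eq_bigr => n _; apply: eq_bigr => m _; congr (_ * _); apply: GmE.
  have := ltn_ord n; have := ltn_ord m; lia.
exact: qform_gram_ge0.
Qed.

End CertificateB.

(** * Positivity of [kerA], certified by integer arithmetic *)

Section CertificateA.
Import ZArith.
Delimit Scope nat_scope with N.
Variable R : realFieldType.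
Local Notation zr := (zr R).

(* Numerical spectral factor, in units of 10^-5: [kerA] is the Gram matrix of the
   sequences [r |-> gA (r - n)], where truncated subtraction gives [gA 0 = 1] for
   [r <= n], up to a rank one term, a corner and the remainder [residA]. *)
Definition stepA : seq Z :=
  [:: 100000; 77629; 39658; 14402; 4193; 1071; 253; 57; 12; 3]%Z.
Definition gA k : R := zr (nth 0%Z stepA k) / zr 100000.
Definition step_sum k : R := \sum_(j < k) gA j.+1.
Definition step_corr k : R := step_sum k + \sum_(j < 9) gA j.+1 * gA (j.+1 + k)%N.
(** [step_sum 9] is the value of [step_corr k] for all large [k], a constant excess of the Gram
    matrix over the kernel. It is subtracted here and accounted for by the rank one term and the
    omitted rows. *)
Definition residA k : R := if k == 0%N then step_sum 9 - step_corr 0 - zr 59011 / zr 100000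
  else step_sum 9 - step_corr k - t_coef R k.

Lemma zr_gt0 z : (0 <? z)%Z = true -> 0 < zr z.
Proof. by move=> h; rewrite -(zr0 R); exact: zr_lt. Qed.

Lemma gA0 : gA 0 = 1.
Proof. by rewrite /gA divff // gt_eqF // zr_gt0. Qed.

Lemma gA_out j : (10 <= j)%N -> gA j = 0.
Proof. by move=> h; rewrite /gA nth_default // zr0 mul0r. Qed.

Lemma step_sum_out k : (9 <= k)%N -> step_sum k = step_sum 9.
Proof.
move=> k9; rewrite /step_sum -!(big_mkord xpredT (fun j => gA j.+1)).
rewrite (big_cat_nat (n := 9)) //= [X in _ + X]big_nat [X in _ + X]big1 ?addr0 //.
by move=> i /andP[hi _]; rewrite gA_out.
Qed.

(** The rows split into r <= n, where both columns are 1; n < r <= m, where only the later column is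
    still 1; and r > m, where both follow the tail of [gA]. The first range produces the growth with
    min(n, m) of [kerA], the others depend on m - n only. *)
Lemma step_gram n m L : (n <= m)%N -> (m + 10 <= L)%N ->
  \sum_(0 <= r < L) gA (r - n) * gA (r - m) = n.+1%:R + step_corr (m - n).
Proof.
move=> nm mL.
rewrite (big_cat_nat (n := n.+1)) //=; last by lia.
rewrite (big_cat_nat (n := m.+1) (m := n.+1)) //=; last by lia.
congr (_ + (_ + _)).
- rewrite big_nat (eq_bigr (fun=> 1)) -?big_nat; last first.
    move=> i /andP[_ hi].
    have -> : (i - n = 0)%N by lia.
    have -> : (i - m = 0)%N by lia.
    by rewrite gA0 mulr1.
  by rewrite sumr_const_nat subn0.
- rewrite -[n.+1]add1n big_addn big_add1 /= /step_sum -(big_mkord xpredT (fun j => gA j.+1)).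
  rewrite (_ : (m.+1 - n).-1 = m - n)%N; last by lia.
  rewrite !big_nat; apply: eq_bigr => i hi.
  have -> : (i.+1 + n - m = 0)%N by lia.
  by rewrite gA0 mulr1 addnK.
- rewrite -[m.+1]add1n big_addn big_add1 /= -(big_mkord xpredT (fun j => gA j.+1 * gA (j.+1 + _))).
  rewrite (big_cat_nat (n := 9)) //=; last by lia.
  rewrite [X in _ + X]big_nat [X in _ + X]big1 ?addr0; last first.
    by move=> i /andP[hi _]; rewrite (_ : (i.+1 + m - m)%N = i.+1) ?(gA_out (j := i.+1)) ?mulr0 //; lia.
  apply: eq_bigr => i _; rewrite mulrC addnK; congr (_ * gA _); lia.
Qed.

Definition step_sumZ k := sumZ (fun j => nth 0 stepA j.+1)%Z k.
Definition step_corrZ k := (100000 * step_sumZ k +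
  sumZ (fun j => nth 0 stepA j.+1 * nth 0 stepA (j.+1 + k)) 9)%Z.

Lemma step_sum_zr k : step_sum k = zr (step_sumZ k) / zr 100000.
Proof. by rewrite /step_sum /step_sumZ zr_sum mulr_suml. Qed.

Lemma step_corr_zr k : step_corr k = zr (step_corrZ k) / zr 100000 ^+ 2.
Proof.
have z0 : zr 100000 != 0 by rewrite gt_eqF // zr_gt0.
rewrite /step_corr /step_corrZ step_sum_zr zrD zrM zr_sum mulrDl; congr (_ + _).
  by field.
rewrite mulr_suml; apply: eq_bigr => i _.
by rewrite zrM expr2 invfM mulrACA.
Qed.

Lemma residA_sum_le M : \sum_(1 <= k < M) `|residA k| <= zr 60000 / zr (10 ^ 9)%Z.
Proof.
have zS : zr 100000 != 0 by rewrite gt_eqF // zr_gt0.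
apply: le_trans (_ : zr 59000 / zr (10 ^ 9)%Z + (t_coef R 10 + t_coef R 10) <= _).
  apply: sum_norm_split => //.
  - rewrite (eq_big_nat _ _ (F2 := fun k =>
      `|zr ((100000 * step_sumZ 9 - step_corrZ k) * Qden k - Z.of_nat k * 9 ^ Z.of_nat k * 100000 ^ 2)%Z /
       zr (Qden k * 100000 ^ 2)|)).
      apply: (@zr_sum_abs_le R (fun k => (100000 * step_sumZ 9 - step_corrZ k) * Qden k - Z.of_nat k * 9 ^ Z.of_nat k * 100000 ^ 2)%Z (fun k => Qden k * 100000 ^ 2)%Z).
        by move=> k k0; have := Qden_gt0 k0; lia.
      by vm_compute.
    move=> k /andP[k0 _]; have q0 := zrQden_neq0 R k0.
    rewrite /residA gtn_eqF // t_coefE // step_sum_zr step_corr_zr; congr (`| _ |).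
    rewrite zrB [zr (_ * 100000 ^ 2)]zrM (zrM _ (_ - _)%Z) zrB (zrM _ 100000) (zrM _ (Qden k)) (zrX _ 100000 2).
    by field; rewrite zS q0.
  - move=> k k10; rewrite /residA gtn_eqF; last by lia.
    rewrite /step_corr step_sum_out; last by lia.
    have -> : \sum_(j < 9) gA j.+1 * gA (j.+1 + k)%N = 0.
      by apply: big1 => j _; rewrite (@gA_out (j.+1 + k)%N) ?mulr0 //; lia.
    rewrite addr0 subrr sub0r normrN ger0_norm // geometric_coef_ge0 //; lra.
  - by move=> k _; apply: geometric_coef_ge0; lra.
  - by move=> k k18; apply: geometric_coef_halving; [lra|lra|lia].
have q0 := zrQden_neq0 R (isT : (0 < 10)%N).
have q1 : 0 < zr (Qden 10) by apply: zr_gt0; vm_compute.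
have t1 : 0 < zr (10 ^ 9)%Z by apply: zr_gt0; vm_compute.
rewrite t_coefE // -lerBrDl -mulrBl -mulrDl ler_pdivrMr // mulrAC ler_pdivlMr //.
rewrite -zrB -zrD -!zrM; apply: zr_le; by vm_compute.
Qed.

(** Profile of the rank one term, of weight [2 - step_sum 9]. Omitting rows 0 and 1 removes 2
    between positive indices, but only [1 + gA 1] between index 0 and a positive one; the value at 0
    compensates for this. *)
Definition cornerA n : R :=
  if n == 0%N then (1 + gA 1 - step_sum 9) / (2 - step_sum 9) else 1.

(** The full Gram matrix exceeds the kernel by about 1.373, the value of [step_sum 9]. Omitting rows
    0 and 1, which equal 1 on all columns of positive index, removes 2 there, and a rank one term of
    positive weight 0.627 gives the difference back. Only the corner (0, 0) needs a separate
    check. *)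
Lemma kerA_qform_ge0 N y : 0 <= qform (kerA R) N y.
Proof.
pose Gm n m := \sum_(2 <= r < n + m + 12) gA (r - n) * gA (r - m).
pose b := 2 - step_sum 9.
(* What is left at (0, 0). It is nonnegative only thanks to the shift 0.0326 of [split_diag]: at
   least about 0.0298 is needed here, and the certificate of [kerB] can give up about 0.0327. *)
pose s := 1 + zr 3260 / zr 100000 + gA 1 ^+ 2 - step_sum 9 - (1 + gA 1 - step_sum 9) ^+ 2 / b.
have z1 : 0 < zr 100000 by exact: zr_gt0.
have bE : b = zr (2 * 100000 - step_sumZ 9)%Z / zr 100000.
  by rewrite /b step_sum_zr zrB zrM (zr_nat R 2); field; rewrite gt_eqF.
have b0 : 0 < b by rewrite bE divr_gt0 // zr_gt0.
have s0 : 0 <= s.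
  have -> : s = (b * (zr 100000 + zr 3260 - zr (step_sumZ 9)) * zr 100000 + b * zr 77629 ^+ 2 -
      (zr 100000 + zr 77629 - zr (step_sumZ 9)) ^+ 2) / (b * zr 100000 ^+ 2).
    by rewrite /s step_sum_zr /gA /=; field; rewrite !gt_eqF.
  rewrite divr_ge0 //; last by rewrite mulr_ge0 ?exprn_ge0 // ltW.
  have -> : b * (zr 100000 + zr 3260 - zr (step_sumZ 9)) * zr 100000 + b * zr 77629 ^+ 2 -
      (zr 100000 + zr 77629 - zr (step_sumZ 9)) ^+ 2 =
      zr ((2 * 100000 - step_sumZ 9) * (100000 + 3260 - step_sumZ 9) * 100000 +
       (2 * 100000 - step_sumZ 9) * (77629 * 77629) - 100000 * ((100000 + 77629 - step_sumZ 9) * (100000 + 77629 - step_sumZ 9)))%Z / zr 100000.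
    by rewrite bE !(zrB, zrD, zrM); field; rewrite gt_eqF.
  by rewrite divr_ge0 ?(ltW z1) // -(zr0 R); apply: zr_le; vm_compute.
have GmE n m : Gm n m + gA (1 - n) * gA (1 - m) =
    n.+1%:R * (n <= m)%:R + m.+1%:R * (m < n)%:R - 1 + step_corr (distn_nat n m).
  have -> : Gm n m + gA (1 - n) * gA (1 - m) =
      \sum_(0 <= r < n + m + 12) gA (r - n) * gA (r - m) - 1.
    rewrite [in RHS]big_ltn; last by lia.
    rewrite [in RHS]big_ltn; last by lia.
    by rewrite !sub0n !gA0 mulr1 [RHS]addrAC subrr add0r addrC.
  wlog nm : n m / (n <= m)%N => [wl|].
    case: (leqP n m) => h; first by rewrite wl // h ltnNge h.
    have := wl m n (ltnW h); rewrite (ltnW h) [(n < m)%N]ltnNge (ltnW h) /= !mulr0 !mulr1.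
    rewrite distn_natC addr0 add0r (addnC m) => <-; congr (_ - 1).
    by apply: eq_bigr => i _; exact: mulrC.
  rewrite step_gram //; last by lia.
  rewrite nm ltnNge nm /= mulr1 mulr0 addr0 addrAC; congr (_ + step_corr _).
  by rewrite /distn_nat; lia.
rewrite (@qform_ext _ _ (fun n m => ((Gm n m + b * (cornerA n * cornerA m)) +
    s *+ ((n == 0%N) && (m == 0%N))) + residA (distn_nat n m))); last first.
  move=> n m; have -> : Gm n m = n.+1%:R * (n <= m)%:R + m.+1%:R * (m < n)%:R - 1 +
      step_corr (distn_nat n m) - gA (1 - n) * gA (1 - m) by rewrite -GmE addrK.
  have b1 : b * ((1 + gA 1 - step_sum 9) / b) = 1 + gA 1 - step_sum 9.
    by rewrite mulrC divfK // gt_eqF.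
  rewrite /kerA /residA /cornerA -/b.
  case: eqP => [<-|/eqP nm].
    have -> : distn_nat n n = 0%N by rewrite /distn_nat subnn.
    rewrite leqnn ltnn mulr1 mulr0 addr0 andbb eqxx /split_diag.
    case: n => [|n] /=.
      by rewrite subn0 /s !mulr1n; field; rewrite !gt_eqF.
    have eq1 (a c d e : R) :
      a - (e - 0) = a - 1 + c - 1 * 1 + (2 - d) * (1 * 1) + 0 + (d - c - e) by lra.
    by rewrite subSS sub0n gA0 !mulr0n; exact: eq1.
  have -> : (distn_nat n m == 0)%N = false by rewrite /distn_nat; lia.
  have -> : (n == 0)%N && (m == 0)%N = false by lia.
  have minE : n.+1%:R * (n <= m)%:R + m.+1%:R * (m < n)%:R = 1 + (minn n m)%:R :> R.
    by rewrite nat1r; case: leqP => _; rewrite !(mulr1, mulr0) ?addr0 ?add0r.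
  rewrite minE mulr0n addr0; case: n nm minE => [|n]; case: m => [|m] // _ _ /=.
  - rewrite !subn0 subSS sub0n gA0 !mulr1 b1 min0n; lra.
  - rewrite !subn0 subSS sub0n gA0 mul1r mulrCA !mul1r b1 minn0; lra.
  - rewrite !subSS !sub0n gA0 !mulr1 /b; lra.
rewrite qformD; apply: addr_ge0; last first.
  apply: (@qform_toeplitz_ge0 _ _ _ _ _ residA_sum_le).
  rewrite /residA eqxx step_sum_zr step_corr_zr -mulrDl -zrD.
  have t1 : 0 < zr (10 ^ 9)%Z by apply: zr_gt0; vm_compute.
  have -> : zr (step_sumZ 9) / zr 100000 - zr (step_corrZ 0) / zr 100000 ^+ 2 - zr 59011 / zr 100000 =
     zr (step_sumZ 9 * 100000 - step_corrZ 0 - 59011 * 100000)%Z / zr 100000 ^+ 2.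
    by rewrite !zrB !zrM; field; rewrite gt_eqF.
  rewrite ler_pdivrMr // mulrAC ler_pdivlMr ?exprn_gt0 //.
  by rewrite -(zrX _ _ 2) -!zrM; apply: zr_le; vm_compute.
rewrite qformD; apply: addr_ge0; last exact: qform_corner_ge0.
rewrite qformD; apply: addr_ge0; last by apply: qform_rank1_ge0; exact: ltW.
have -> : qform Gm N y = qform (fun n m => \sum_(i <- index_iota 2 (N + N + 12)) gA (i - n) * gA (i - m)) N y.
  apply: eq_bigr => n _; apply: eq_bigr => m _; congr (_ * _).
  rewrite /Gm [RHS](big_cat_nat (n := (n + m + 12)%N)) //=; last 2 first.
  - by lia.
  - by have := ltn_ord n; have := ltn_ord m; lia.
  rewrite [X in _ + X]big_nat [X in _ + X]big1 ?addr0 // => i /andP[hi _].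
  by rewrite gA_out ?mul0r //; lia.
exact: qform_gram_ge0.
Qed.

End CertificateA.

(** * Goursat's theorem in logarithmic polar coordinates *)

Local Open Scope classical_set_scope.
Local Open Scope ring_scope.

Section SegmentIntegral.
Variable R : realType.
Implicit Types (a b c d m : R) (f g : R -> R).
Local Notation mu := (@lebesgue_measure R).

Definition cont_on a b f := {within `[a, b], continuous f}.
Definition segint a b f : R := Rintegral mu `[a, b]%classic f.

Lemma cont_onP a b f :
  (forall x, a <= x <= b -> forall e, 0 < e -> exists2 dl, 0 < dl &
    forall y, a <= y <= b -> `|y - x| <= dl -> `|f y - f x| <= e) ->
  cont_on a b f.
Proof.
move=> h; apply/subspace_continuousP => x /=; rewrite in_itv /= => xab.
apply/cvgrPdist_le => e e0; have [dl dl0 hd] := h x xab e e0.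
rewrite near_withinE; near=> y => /=; rewrite in_itv /= => yab.
rewrite distrC; apply: hd => //.
Unshelve. all: by end_near. Qed.

Lemma cont_on_sub a b c d f : a <= c -> d <= b -> cont_on a b f -> cont_on c d f.
Proof.
move=> ac db; apply: continuous_subspaceW => x /=.
by rewrite !in_itv /= => /andP[cx xd]; rewrite (le_trans ac cx) (le_trans xd db).
Qed.

Lemma cont_on_integrable a b f : cont_on a b f -> mu.-integrable `[a, b] (EFin \o f).
Proof. by move=> cf; apply: continuous_compact_integrable => //; exact: segment_compact. Qed.

Lemma cont_onD a b f g : cont_on a b f -> cont_on a b g -> cont_on a b (fun x => f x + g x).
Proof. by move=> cf cg x; apply: cvgD; [exact: cf|exact: cg]. Qed.
Lemma cont_onN a b f : cont_on a b f -> cont_on a b (fun x => - f x).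
Proof. by move=> cf x; apply: cvgN; exact: cf. Qed.
Lemma cont_onB a b f g : cont_on a b f -> cont_on a b g -> cont_on a b (fun x => f x - g x).
Proof. by move=> cf cg; apply: cont_onD => //; exact: cont_onN. Qed.
Lemma cont_onM a b f g : cont_on a b f -> cont_on a b g -> cont_on a b (fun x => f x * g x).
Proof. by move=> cf cg x; apply: cvgM; [exact: cf|exact: cg]. Qed.
Lemma cont_on_cst a b (k : R) : cont_on a b (fun=> k).
Proof. by move=> x; exact: cvg_cst. Qed.

Lemma segintD a b f g : cont_on a b f -> cont_on a b g ->
  segint a b (fun x => f x + g x) = segint a b f + segint a b g.
Proof. by move=> cf cg; rewrite /segint RintegralD //; exact: cont_on_integrable. Qed.
Lemma segintB a b f g : cont_on a b f -> cont_on a b g ->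
  segint a b (fun x => f x - g x) = segint a b f - segint a b g.
Proof. by move=> cf cg; rewrite /segint RintegralB //; exact: cont_on_integrable. Qed.
Lemma segintZl a b (k : R) f : cont_on a b f ->
  segint a b (fun x => k * f x) = k * segint a b f.
Proof. by move=> cf; rewrite /segint RintegralZl //; exact: cont_on_integrable. Qed.

Lemma segint_cst a b (k : R) : a <= b -> segint a b (fun=> k) = k * (b - a).
Proof.
move=> ab; rewrite /segint Rintegral_cst //= lebesgue_measure_itv /= lte_fin.
by case: ltgtP ab => // -> _; rewrite subrr.
Qed.

Lemma eq_segint a b f g : (forall x, a <= x <= b -> f x = g x) -> segint a b f = segint a b g.
Proof. by move=> h; apply: eq_Rintegral => x; rewrite inE /= in_itv /=; exact: h. Qed.

Lemma le_segint a b f g : cont_on a b f -> cont_on a b g ->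
  (forall x, a <= x <= b -> f x <= g x) -> segint a b f <= segint a b g.
Proof.
move=> cf cg h; apply: le_Rintegral => //; exact: cont_on_integrable.
Qed.

Lemma segint_split a m b f : a <= m -> m <= b -> cont_on a b f ->
  segint a b f = segint a m f + segint m b f.
Proof.
move=> am mb cf; have cm := cont_on_sub (le_trans am mb) (lexx b).
apply/eqP; rewrite -subr_eq0 opprD addrA subr_eq0; apply/eqP.
rewrite /segint Rintegral_itvB ?bnd_simp //; last exact: cont_on_integrable.
rewrite Rintegral_itv_obnd_cbnd //.
apply: integrableS (cont_on_integrable cf) => //.
by move=> x /=; rewrite !in_itv /= => /andP[/ltW mx ->]; rewrite (le_trans am mx).
Qed.

Lemma segint_norm_le a b f (M : R) : a <= b -> cont_on a b f ->
  (forall x, a <= x <= b -> `|f x| <= M) -> `|segint a b f| <= M * (b - a).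
Proof.
move=> ab cf h; rewrite ler_norml -mulNr -!segint_cst //.
by rewrite !le_segint ?andbT //; try exact: cont_on_cst;
  move=> x /h; rewrite ler_norml => /andP[].
Qed.

End SegmentIntegral.

(** * Flux of a divergence free field through rectangles *)

Section Flux.
Variable R : realType.
Implicit Types (a b c d : R).

(** Outward flux of the field (Q, P) through the boundary of a rectangle, opposite edges being
    paired under one integral. *)
Definition flux (P Q : R -> R -> R) a b c d : R :=
  segint c d (fun t => Q b t - Q a t) + segint a b (fun s => P s d - P s c).

(** Increments are confined to the rectangle, so that the notion passes to subrectangles and makes
    sense at boundary points. *)
Definition diff_at (P : R -> R -> R) a b c d s0 t0 p1 p2 :=
  forall e, 0 < e -> exists2 dl, 0 < dl & forall s t, a <= s <= b -> c <= t <= d ->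
    `|s - s0| <= dl -> `|t - t0| <= dl ->
    `|P s t - P s0 t0 - (p1 * (s - s0) + p2 * (t - t0))| <= e * (`|s - s0| + `|t - t0|).

(* The field (Q, P) in the variables (s, t) is differentiable, without any
   continuity of its derivatives, and divergence free. *)
Definition divfree (P Q : R -> R -> R) a b c d :=
  forall s0 t0, a <= s0 <= b -> c <= t0 <= d -> exists p1 p2 q1 q2,
    [/\ q1 + p2 = 0, diff_at P a b c d s0 t0 p1 p2 & diff_at Q a b c d s0 t0 q1 q2].

Lemma diff_at_cont P a b c d s0 t0 p1 p2 : diff_at P a b c d s0 t0 p1 p2 ->
  forall e, 0 < e -> exists2 dl, 0 < dl & forall s t, a <= s <= b -> c <= t <= d ->
    `|s - s0| <= dl -> `|t - t0| <= dl -> `|P s t - P s0 t0| <= e.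
Proof.
move=> /(_ 1 ltr01)[dl dl0 h] e e0.
pose L := 1 + `|p1| + `|p2|; have L0 : 0 < L by rewrite /L -addrA ltr_pwDl ?addr_ge0.
exists (Num.min dl (e / (L * 2))) => [|s t hs ht]; first by rewrite lt_min dl0 divr_gt0 ?mulr_gt0.
rewrite !le_min => /andP[s1 s2] /andP[t1 t2].
have := h s t hs ht s1 t1; rewrite mul1r => hh.
have e2 : `|p1 * (s - s0) + p2 * (t - t0)| <= `|p1| * `|s - s0| + `|p2| * `|t - t0|.
  by apply: le_trans (ler_normD _ _) _; rewrite !normrM.
have -> : P s t - P s0 t0 = P s t - P s0 t0 - (p1 * (s - s0) + p2 * (t - t0)) + (p1 * (s - s0) + p2 * (t - t0)) by rewrite subrK.
apply: le_trans (ler_normD _ _) _.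
apply: le_trans (lerD hh e2) _.
set x := `|s - s0| in s2 *; set y := `|t - t0| in t2 *.
apply: le_trans (_ : L * x + L * y <= _).
  have := normr_ge0 p1; have := normr_ge0 p2; have := normr_ge0 (s - s0); have := normr_ge0 (t - t0).
  rewrite -/x -/y /L; nra.
have : L * (e / (L * 2)) = e / 2 by field; rewrite gt_eqF.
have := ler_wpM2l (ltW L0) s2; have := ler_wpM2l (ltW L0) t2; lra.
Qed.

Lemma divfree_sub P Q a b c d a' b' c' d' : a <= a' -> b' <= b -> c <= c' -> d' <= d ->
  divfree P Q a b c d -> divfree P Q a' b' c' d'.
Proof.
move=> aa bb cc dd h s0 t0 hs ht.
have lift (x y x' y' z : R) : x <= x' -> y' <= y -> x' <= z <= y' -> x <= z <= y.
  by move=> h1 h2 /andP[h3 h4]; rewrite (le_trans h1 h3) (le_trans h4 h2).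
have [p1 [p2 [q1 [q2 [pq hP hQ]]]]] := h s0 t0 (lift _ _ _ _ _ aa bb hs) (lift _ _ _ _ _ cc dd ht).
exists p1, p2, q1, q2; split => // e e0.
  have [dl dl0 hd] := hP e e0; exists dl => // s t hs' ht'; apply: hd;
  by [apply: lift hs'|apply: lift ht'].
have [dl dl0 hd] := hQ e e0; exists dl => // s t hs' ht'; apply: hd;
by [apply: lift hs'|apply: lift ht'].
Qed.

Lemma divfree_cont P Q a b c d : divfree P Q a b c d ->
  [/\ forall s, a <= s <= b -> cont_on c d (P s),
      forall s, a <= s <= b -> cont_on c d (Q s),
      forall t, c <= t <= d -> cont_on a b (P^~ t) &
      forall t, c <= t <= d -> cont_on a b (Q^~ t)].
Proof.
move=> h; split.
- move=> s hs; apply: cont_onP => t ht e e0.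
  have [p1 [p2 [q1 [q2 [pq hP hQ]]]]] := h s t hs ht.
  have [dl dl0 hd] := diff_at_cont hP e0; exists dl => // y hy yt.
  by apply: hd => //; rewrite subrr normr0 ltW.
- move=> s hs; apply: cont_onP => t ht e e0.
  have [p1 [p2 [q1 [q2 [pq hP hQ]]]]] := h s t hs ht.
  have [dl dl0 hd] := diff_at_cont hQ e0; exists dl => // y hy yt.
  by apply: hd => //; rewrite subrr normr0 ltW.
- move=> t ht; apply: cont_onP => s hs e e0.
  have [p1 [p2 [q1 [q2 [pq hP hQ]]]]] := h s t hs ht.
  have [dl dl0 hd] := diff_at_cont hP e0; exists dl => // y hy yt.
  by apply: hd => //; rewrite subrr normr0 ltW.
- move=> t ht; apply: cont_onP => s hs e e0.
  have [p1 [p2 [q1 [q2 [pq hP hQ]]]]] := h s t hs ht.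
  have [dl dl0 hd] := diff_at_cont hQ e0; exists dl => // y hy yt.
  by apply: hd => //; rewrite subrr normr0 ltW.
Qed.

Lemma flux_split_s P Q a m b c d : a <= m -> m <= b -> c <= d -> divfree P Q a b c d ->
  flux P Q a b c d = flux P Q a m c d + flux P Q m b c d.
Proof.
move=> am mb cd /divfree_cont[cP cQ cPs cQs].
have ab := le_trans am mb.
have [hc hd] : c <= c <= d /\ c <= d <= d by rewrite !lexx cd.
have [ha hb hm] : [/\ a <= a <= b, a <= b <= b & a <= m <= b] by rewrite !lexx ab am mb.
rewrite /flux (segint_split am mb); last exact: cont_onB (cPs _ hd) (cPs _ hc).
rewrite !segintB; try exact: cQ; try by [].
all: try by apply: cont_on_sub (cPs _ hd).
all: try by apply: cont_on_sub (cPs _ hc).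
ring.
Qed.

Lemma flux_split_t P Q a b c m d : c <= m -> m <= d -> a <= b -> divfree P Q a b c d ->
  flux P Q a b c d = flux P Q a b c m + flux P Q a b m d.
Proof.
move=> cm md ab /divfree_cont[cP cQ cPs cQs].
have cd := le_trans cm md.
have [hc hd hm] : [/\ c <= c <= d, c <= d <= d & c <= m <= d] by rewrite !lexx cd cm md.
have [ha hb] : a <= a <= b /\ a <= b <= b by rewrite !lexx ab.
rewrite /flux (segint_split cm md); last exact: cont_onB (cQ _ hb) (cQ _ ha).
rewrite !segintB; try exact: cPs; try by [].
all: try by apply: cont_on_sub (cQ _ hb).
all: try by apply: cont_on_sub (cQ _ ha).
ring.
Qed.

(** The affine part of the field contributes q1 + p2 = 0 times the area, while its [p1] and [q2]
    terms cancel between opposite edges. What remains on a pair of edges is at most twice the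
    pointwise error times their length. *)
Lemma flux_local P Q a b c d s0 t0 p1 p2 q1 q2 e : a <= b -> c <= d ->
  divfree P Q a b c d -> a <= s0 <= b -> c <= t0 <= d -> 0 <= e -> q1 + p2 = 0 ->
  (forall s t, a <= s <= b -> c <= t <= d ->
    `|P s t - P s0 t0 - (p1 * (s - s0) + p2 * (t - t0))| <= e * ((b - a) + (d - c))) ->
  (forall s t, a <= s <= b -> c <= t <= d ->
    `|Q s t - Q s0 t0 - (q1 * (s - s0) + q2 * (t - t0))| <= e * ((b - a) + (d - c))) ->
  `|flux P Q a b c d| <= 2 * e * ((b - a) + (d - c)) ^+ 2.
Proof.
move=> ab cd /divfree_cont[cP cQ cPs cQs] hs0 ht0 e0 pq hP hQ.
have [hc hd] : c <= c <= d /\ c <= d <= d by rewrite !lexx cd.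
have [ha hb] : a <= a <= b /\ a <= b <= b by rewrite !lexx ab.
set E := e * _ in hP hQ.
have dist2 (x y k l : R) : `|x - k| <= E -> `|y - l| <= E -> `|(x - y) - (k - l)| <= 2 * E.
  move=> h1 h2; have -> : x - y - (k - l) = (x - k) - (y - l) by ring.
  by apply: le_trans (ler_normB _ _) _; lra.
have hI : `|segint c d (fun t => Q b t - Q a t - q1 * (b - a))| <= 2 * E * (d - c).
  apply: segint_norm_le => //.
    apply: cont_onB; last exact: cont_on_cst.
    by apply: cont_onB; [exact: cQ|exact: cQ].
  move=> t ht; have := dist2 _ _ _ _ (hQ b t hb ht) (hQ a t ha ht).
  by congr (`|_| <= _); ring.
have hJ : `|segint a b (fun s => P s d - P s c - p2 * (d - c))| <= 2 * E * (b - a).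
  apply: segint_norm_le => //.
    apply: cont_onB; last exact: cont_on_cst.
    by apply: cont_onB; [exact: cPs|exact: cPs].
  move=> s hs; have := dist2 _ _ _ _ (hP s d hs hd) (hP s c hs hc).
  by congr (`|_| <= _); ring.
rewrite segintB ?segint_cst // in hI; [|by apply: cont_onB; [exact: cQ|exact: cQ]|exact: cont_on_cst].
rewrite segintB ?segint_cst // in hJ; [|by apply: cont_onB; [exact: cPs|exact: cPs]|exact: cont_on_cst].
have -> : flux P Q a b c d =
    (segint c d (fun t => Q b t - Q a t) - q1 * (b - a) * (d - c)) +
    (segint a b (fun s => P s d - P s c) - p2 * (d - c) * (b - a)).
  have q1E : q1 = - p2 by lra.
  by rewrite /flux q1E; ring.
apply: le_trans (ler_normD _ _) _; apply: le_trans (lerD hI hJ) _.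
by rewrite /E le_eqVlt; apply/orP; left; apply/eqP; ring.
Qed.

End Flux.

Section GoursatTheorem.
Variable R : realType.

Lemma nested_point (x w : nat -> R) : (forall n, x n <= x n.+1) ->
  (forall n, x n.+1 + w n.+1 <= x n + w n) -> (forall n, 0 <= w n) ->
  exists l, forall n, x n <= l <= x n + w n.
Proof.
move=> hx hw w0.
have mx n m : (n <= m)%N -> x n <= x m.
  by move=> nm; rewrite -(subnKC nm); elim: (m - n)%N => [|k IH]; rewrite ?addn0 ?addnS // (le_trans IH).
have mw n m : (n <= m)%N -> x m + w m <= x n + w n.
  by move=> nm; rewrite -(subnKC nm); elim: (m - n)%N => [|k IH]; rewrite ?addn0 ?addnS // (le_trans _ IH).
have xw n m : x m <= x n + w n.
  have [nm|/ltnW mn] := leqP n m; first by apply: le_trans (mw _ _ nm); rewrite lerDl.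
  by apply: le_trans (mx _ _ mn) _; rewrite lerDl.
exists (sup (range x)) => n; apply/andP; split.
  by apply: ub_le_sup; [exists (x 0 + w 0) => _ [m _ <-]; exact: xw|exists n].
by apply: ge_sup; [exists (x 0); exists 0%N|move=> _ [m _ <-]; exact: xw].
Qed.

(* Bisection: a nonzero flux would have a fixed density on a nested sequence of
   rectangles, against differentiability at their common point. *)
Lemma goursat (P Q : R -> R -> R) a b c d : a < b -> c < d ->
  divfree P Q a b c d -> flux P Q a b c d = 0.
Proof.
move=> ab cd hD; apply/eqP/negP => /negP F0.
pose w n : R := (b - a) / 2 ^+ n; pose h n : R := (d - c) / 2 ^+ n.
have w_gt n : 0 < w n by rewrite divr_gt0 ?subr_gt0 ?exprn_gt0.
have h_gt n : 0 < h n by rewrite divr_gt0 ?subr_gt0 ?exprn_gt0.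
have wS n : w n = w n.+1 + w n.+1.
  by rewrite /w exprS; field; rewrite expf_neq0 ?pnatr_eq0.
have hS n : h n = h n.+1 + h n.+1.
  by rewrite /h exprS; field; rewrite expf_neq0 ?pnatr_eq0.
pose eta := `|flux P Q a b c d| / ((b - a) * (d - c)).
have eta0 : 0 < eta by rewrite divr_gt0 ?normr_gt0 ?mulr_gt0 ?subr_gt0.
pose ok n (z : R * R) := [/\ a <= z.1, z.1 + w n <= b, c <= z.2, z.2 + h n <= d &
  eta * (w n * h n) <= `|flux P Q z.1 (z.1 + w n) z.2 (z.2 + h n)|].
pose nxt n (z z' : R * R) := [/\ z.1 <= z'.1, z'.1 + w n.+1 <= z.1 + w n, z.2 <= z'.2 & z'.2 + h n.+1 <= z.2 + h n].
have ok0 : ok 0%N (a, c).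
  rewrite /ok /w /h /= expr0 !divr1 !lexx !(addrC _ (_ - _)) !subrK !lexx; split => //.
  by rewrite /eta divfK // mulf_neq0 // subr_eq0 gt_eqF.
(* An implication, because [choice] wants a successor for every pair; a rectangle that is not [ok]
   gets a dummy one. *)
have step (nz : nat * (R * R)) : exists z', ok nz.1 nz.2 -> ok nz.1.+1 z' /\ nxt nz.1 nz.2 z'.
  case: nz => n [x y] /=; have [okz|nokz] := pselect (ok n (x, y)); last by exists (0, 0).
  case: okz => /= ax xb cy yd; rewrite (wS n) (hS n) => big.
  have := w_gt n.+1; have := h_gt n.+1; have := wS n; have := hS n.
  set u := w n.+1 in big *; set v := h n.+1 in big *; move=> hE wE v0 u0.
  have sub1 : divfree P Q x (x + u + u) y (y + v + v).
    by apply: divfree_sub hD => //; rewrite -addrA -?wE -?hE.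
  have [xu xuu yv yvv] : [/\ x <= x + u, x + u <= x + u + u, y <= y + v & y + v <= y + v + v].
    by rewrite !lerDl !ltW.
  have e1 : flux P Q x (x + (u + u)) y (y + (v + v)) =
     flux P Q x (x + u) y (y + v) + flux P Q x (x + u) (y + v) (y + v + v) +
     (flux P Q (x + u) (x + u + u) y (y + v) + flux P Q (x + u) (x + u + u) (y + v) (y + v + v)).
    have E1 := flux_split_t yv yvv xu (divfree_sub (lexx _) xuu (lexx _) (lexx _) sub1).
    have E2 := flux_split_t yv yvv xuu (divfree_sub xu (lexx _) (lexx _) (lexx _) sub1).
    by rewrite (addrA x) (addrA y) (flux_split_s xu xuu (le_trans yv yvv) sub1) E1 E2.
  have e2 : eta * (u * v) <= `|flux P Q x (x + u) y (y + v)| \/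
     eta * (u * v) <= `|flux P Q x (x + u) (y + v) (y + v + v)| \/
     eta * (u * v) <= `|flux P Q (x + u) (x + u + u) y (y + v)| \/
     eta * (u * v) <= `|flux P Q (x + u) (x + u + u) (y + v) (y + v + v)|.
    move: big; rewrite e1 => big.
    have := le_trans big (ler_normD _ _).
    set f1 := flux _ _ _ _ _ _; set f2 := flux _ _ _ _ _ _; set f3 := flux _ _ _ _ _ _; set f4 := flux _ _ _ _ _ _.
    have := ler_normD f1 f2; have := ler_normD f3 f4.
    have -> : eta * ((u + u) * (v + v)) = 4 * (eta * (u * v)) by ring.
    move=> n1 n2 n3; case: (leP (eta * (u * v)) `|f1|) => [|l1]; first by left.
    case: (leP (eta * (u * v)) `|f2|) => [|l2]; first by right; left.
    case: (leP (eta * (u * v)) `|f3|) => [|l3]; first by right; right; left.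
    case: (leP (eta * (u * v)) `|f4|) => [|l4]; first by right; right; right.
    by exfalso; lra.
  have mk x' y' : (x' = x \/ x' = x + u) -> (y' = y \/ y' = y + v) ->
      eta * (u * v) <= `|flux P Q x' (x' + u) y' (y' + v)| -> exists z', ok n (x, y) -> ok n.+1 z' /\ nxt n (x, y) z'.
    move=> hx' hy' he; exists (x', y') => _.
    have xr : x <= x' <= x + u by case: hx' => ->; rewrite !lexx xu.
    have yr : y <= y' <= y + v by case: hy' => ->; rewrite !lexx yv.
    rewrite /ok /nxt /= -/u -/v; clear -ax xb cy yd xr yr wE hE he u0 v0.
    by split; split => //; lra.
  case: e2 => [e2|[e2|[e2|e2]]].
  - by apply: (mk x y) => //; left.
  - by apply: (mk x (y + v)) => //; [left|right].
  - by apply: (mk (x + u) y) => //; [right|left].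
  - by apply: (mk (x + u) (y + v)) => //; right.
have [f hf] := choice step.
pose z := fix z n : R * R := if n is m.+1 then f (m, z m) else (a, c).
have okz n : ok n (z n) by elim: n => [|n IH] //=; have [] := hf (n, z n) IH.
have nz n : nxt n (z n) (z n.+1) by have [] := hf (n, z n) (okz n).
have [s0 hs0] : exists l, forall n, (z n).1 <= l <= (z n).1 + w n.
  by apply: nested_point => n; [have [] := nz n|have [] := nz n|exact: ltW].
have [t0 ht0] : exists l, forall n, (z n).2 <= l <= (z n).2 + h n.
  by apply: nested_point => n; [have [] := nz n|have [] := nz n|exact: ltW].
have hs : a <= s0 <= b.
  by have := hs0 0%N; rewrite /w /= expr0 divr1 addrC subrK.
have ht : c <= t0 <= d.
  by have := ht0 0%N; rewrite /h /= expr0 divr1 addrC subrK.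
have [p1 [p2 [q1 [q2 [pq hP hQ]]]]] := hD s0 t0 hs ht.
pose A := (b - a) * (d - c); pose B := (b - a) + (d - c).
have A0 : 0 < A by rewrite mulr_gt0 ?subr_gt0.
have B0 : 0 < B by rewrite addr_gt0 ?subr_gt0.
(* Chosen so that the local estimate yields half of the assumed density: 2 e (B / 2^n)^2 = (eta A /
   4^n) / 2. *)
pose e := eta * A / (4 * B ^+ 2).
have e0 : 0 < e.
  apply: divr_gt0; first exact: mulr_gt0.
  by apply: mulr_gt0; [exact: ltr0Sn|exact: exprn_gt0].
have [dp dp0 hdp] := hP e e0; have [dq dq0 hdq] := hQ e e0.
pose dl := Num.min dp dq; have dl0 : 0 < dl by rewrite lt_min dp0 dq0.
have [n nP] : exists n, w n + h n <= dl.
  exists (Num.truncn (B / dl)).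
  have : w (Num.truncn (B / dl)) + h (Num.truncn (B / dl)) = B / 2 ^+ Num.truncn (B / dl).
    by rewrite /w /h -mulrDl.
  move=> ->; rewrite ler_pdivrMr ?exprn_gt0 // mulrC -ler_pdivrMr //.
  apply: ltW; apply: lt_le_trans (truncnS_gt _) _.
  by rewrite -natrX ler_nat ltn_expl.
have [ax xb cy yd big] := okz n; have := hs0 n; have := ht0 n; set x := (z n).1 in ax xb big *; set y := (z n).2 in cy yd big *.
move=> hty hsx; have wn := w_gt n; have hn := h_gt n.
have close (k l x' s : R) : k <= s <= k + l -> k <= x' <= k + l -> `|s - x'| <= l.
  by move=> /andP[h1 h2] /andP[h3 h4]; rewrite ler_norml; apply/andP; split; lra.
have dlE : dl <= dp /\ dl <= dq by split; rewrite ge_min lexx ?orbT.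
have inb (s : R) : x <= s <= x + w n -> a <= s <= b by move=> /andP[h1 h2]; rewrite (le_trans ax h1) (le_trans h2 xb).
have ind (t : R) : y <= t <= y + h n -> c <= t <= d by move=> /andP[h1 h2]; rewrite (le_trans cy h1) (le_trans h2 yd).
have := @flux_local _ P Q x (x + w n) y (y + h n) s0 t0 p1 p2 q1 q2 e.
have -> : x + w n - x = w n by ring.
have -> : y + h n - y = h n by ring.
move=> /(_ _ _ _ hsx hty (ltW e0) pq).
have bnd (dd : R) (Z : R -> R -> R) (z1 z2 : R) : dl <= dd -> (forall s t, a <= s <= b -> c <= t <= d ->
    `|s - s0| <= dd -> `|t - t0| <= dd ->
    `|Z s t - Z s0 t0 - (z1 * (s - s0) + z2 * (t - t0))| <= e * (`|s - s0| + `|t - t0|)) ->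
   forall s t, x <= s <= x + w n -> y <= t <= y + h n ->
    `|Z s t - Z s0 t0 - (z1 * (s - s0) + z2 * (t - t0))| <= e * (w n + h n).
  move=> hdd hZ s t hs' ht'; have c1 := close _ _ _ _ hs' hsx; have c2 := close _ _ _ _ ht' hty.
  apply: le_trans (hZ s t (inb _ hs') (ind _ ht') _ _) _; try lra.
  by apply: ler_wpM2l; [exact: ltW|exact: lerD].
move=> /(_ _ _ _ (bnd _ _ _ _ dlE.1 hdp) (bnd _ _ _ _ dlE.2 hdq)).
have -> : w n + h n = B / 2 ^+ n by rewrite /w /h -mulrDl.
have sub1 : divfree P Q x (x + w n) y (y + h n) by apply: divfree_sub hD.
move=> /(_ _ _ sub1); have k1 : x <= x + w n by rewrite lerDl ltW.
have k2 : y <= y + h n by rewrite lerDl ltW.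
move=> /(_ k1 k2) le1; apply/negP: (le_trans big le1); rewrite -ltNge.
have -> : w n * h n = A / (2 ^+ n) ^+ 2 by rewrite /w /h /A; field; rewrite expf_neq0 ?pnatr_eq0.
have -> : 2 * e * (B / 2 ^+ n) ^+ 2 = eta * A / (2 ^+ n) ^+ 2 / 2.
  by rewrite /e; field; rewrite expf_neq0 ?pnatr_eq0 // gt_eqF.
have : 0 < eta * A / (2 ^+ n) ^+ 2.
  by apply: divr_gt0; [exact: mulr_gt0|apply: exprn_gt0; exact: exprn_gt0].
by move=> X0; rewrite [ltRHS]mulrA ltr_pdivrMr // mulr_natr mulr2n ltrDl.
Qed.

End GoursatTheorem.

(** * Circle means of holomorphic functions *)

Local Open Scope complex_scope.
Local Open Scope ring_scope.

Local Notation normc := ComplexField.Normc.normc.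
Local Notation normcM := ComplexField.Normc.normcM.
Local Notation normc0 := ComplexField.Normc.normc0.
Local Notation normcV := ComplexField.Normc.normcV.
Local Notation Re := complex.Re.
Local Notation Im := complex.Im.

Section ComplexBasics.
Variable R : realType.
Local Notation C := (Cplx R).
Implicit Types (z w x y : R[i]).

Lemma normE z : `|z| = (normc z)%:C. Proof. by []. Qed.

Lemma normc_ge0 z : 0 <= normc z.
Proof. by case: z => a b; exact: sqrtr_ge0. Qed.

Lemma normcN z : normc (- z) = normc z.
Proof. by case: z => a b /=; rewrite !sqrrN. Qed.

Lemma normc_distC z w : normc (z - w) = normc (w - z).
Proof. by rewrite -normcN opprB. Qed.

Lemma le_normcD z w : normc (z + w) <= normc z + normc w.
Proof. by have := ler_normD z w; rewrite !normE -raddfD /= lecR. Qed.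

Lemma le_normcB z w : normc (z - w) <= normc z + normc w.
Proof. by rewrite -(normcN w) le_normcD. Qed.

Lemma le_Re_normc z : `|Re z| <= normc z.
Proof. by have := normc_ge_Re z; rewrite normE lecR. Qed.

Lemma le_Im_normc z : `|Im z| <= normc z.
Proof.
have := le_Re_normc (z * (0 -i* 1)); rewrite ComplexField.Normc.normcM.
by case: z => a b /=; rewrite mulr0 mulrN mulr1 opprK add0r expr0n add0r sqrrN expr1n sqrtr1 mulr1.
Qed.

Lemma normc_le_ReIm z : normc z <= `|Re z| + `|Im z|.
Proof.
case: z => a b /=; rewrite -[leRHS]ger0_norm ?addr_ge0 // -sqrtr_sqr ler_wsqrtr //.
rewrite sqrrD !real_normK ?num_real //.
by rewrite lerD2r lerDl mulrn_wge0 // mulr_ge0.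
Qed.

Lemma normc_real (a : R) : normc a%:C = `|a|.
Proof. by rewrite /= expr0n addr0 sqrtr_sqr. Qed.

Lemma normcX z n : normc (z ^+ n) = normc z ^+ n.
Proof.
by elim: n => [|n IH]; rewrite ?expr0 ?ComplexField.Normc.normc1 // !exprS ComplexField.Normc.normcM IH.
Qed.

Lemma normc_eq0 z : (normc z == 0) = (z == 0).
Proof.
by apply/eqP/eqP => [/ComplexField.Normc.eq0_normc|->]; rewrite ?normc0.
Qed.

Lemma normc_gt0 z : (0 < normc z) = (z != 0).
Proof. by rewrite lt_neqAle normc_ge0 andbT eq_sym normc_eq0. Qed.

Lemma cReD z w : Re (z + w) = Re z + Re w. Proof. by case: z w => [? ?] [? ?]. Qed.
Lemma cImD z w : Im (z + w) = Im z + Im w. Proof. by case: z w => [? ?] [? ?]. Qed.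
Lemma cReN z : Re (- z) = - Re z. Proof. by case: z. Qed.
Lemma cImN z : Im (- z) = - Im z. Proof. by case: z. Qed.
Lemma cReB z w : Re (z - w) = Re z - Re w. Proof. by rewrite cReD cReN. Qed.
Lemma cImB z w : Im (z - w) = Im z - Im w. Proof. by rewrite cImD cImN. Qed.
Lemma cReM z w : Re (z * w) = Re z * Re w - Im z * Im w. Proof. by case: z w => [? ?] [? ?]. Qed.
Lemma cImM z w : Im (z * w) = Re z * Im w + Im z * Re w. Proof. by case: z w => [? ?] [? ?]. Qed.

Definition cderiv (f : R[i] -> R[i]) z d := forall e : R, 0 < e -> exists2 dl : R, 0 < dl &
  forall w, normc (w - z) <= dl -> normc (f w - f z - d * (w - z)) <= e * normc (w - z).

Lemma derivable_cderiv (f : C -> C) (z : C) : derivable f z 1 -> exists d, cderiv f z d.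
Proof.
move=> /cvg_ex[d /= hd]; exists d => e e0.
have e0' : (0 : C) < e%:C by rewrite -[0]/((0 : R)%:C) ltcR.
have := proj1 (@cvgrPdist_le C C C _ _ (fun h : C => h^-1 *: (f (h *: 1 + z) - f z)) d) hd _ e0'; rewrite near_withinE => hn; have [dl /= dl0 hdl] := proj1 (nbhs_ballP _ _) (hn _).
(* A positive element of [R[i]] is real. *)
have dlE : dl = (Re dl)%:C.
  by move: (gtr0_real dl0) => /RRe_real ->.
have dlr : 0 < Re dl by move: dl0; rewrite dlE -[0]/((0 : R)%:C) ltcR.
exists (Re dl / 2) => [|w hw]; first by rewrite divr_gt0.
have [->|wz] := eqVneq w z.
  by rewrite !subrr mulr0 subr0 normc0 mulr0.
have wz0 : (w - z : C) != 0 by rewrite subr_eq0.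
have := hdl (w - z : C); rewrite /ball /= sub0r normrN => /(_ _ wz0).
have -> : `|(w - z : C)| < dl.
  rewrite dlE [`|_|]normE ltcR; apply: le_lt_trans hw _.
  by rewrite ltr_pdivrMr // mulr_natr mulr2n ltrDl.
move=> /(_ isT); rewrite [(_ - _) *: 1]mulr1 subrK => h1.
have -> : f w - f z - d * (w - z) = - (d - (w - z)^-1 * (f w - f z)) * (w - z).
  by rewrite opprB mulrBl mulrAC mulVf // mul1r.
rewrite ComplexField.Normc.normcM normcN ler_wpM2r ?normc_ge0 //.
by move: h1; rewrite [`|_|]normE lecR.
Qed.

End ComplexBasics.

(** * The exponential map in real coordinates *)

Section PolarCoordinates.
Variable R : realType.
Implicit Types (z w x y : R[i]).

Lemma is_derive_eps (f : R -> R) (x d : R) : is_derive x 1 f d ->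
  forall e, 0 < e -> exists2 dl, 0 < dl &
    forall h, `|h| <= dl -> `|f (x + h) - f x - d * h| <= e * `|h|.
Proof.
move=> [/= fx dE] e e0.
have hd : (fun h : R => h^-1 *: (f (h *: 1 + x) - f x)) h @[h --> (0 : R)^'] --> d.
  by rewrite -dE; exact: fx.
have := proj1 (@cvgrPdist_le R R R _ _ (fun h : R => h^-1 *: (f (h *: 1 + x) - f x)) d) hd _ e0.
rewrite near_withinE => hn; have [dl /= dl0 hdl] := proj1 (nbhs_ballP _ _) (hn _).
exists (dl / 2) => [|h hh]; first by rewrite divr_gt0.
have [->|h0] := eqVneq h 0; first by rewrite addr0 subrr mulr0 subr0 normr0 mulr0.
have := hdl h; rewrite /ball /= sub0r normrN => /(_ _ h0).
have -> : `|h| < dl.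
  by apply: le_lt_trans hh _; rewrite ltr_pdivrMr // mulr_natr mulr2n ltrDl.
move=> /(_ isT); rewrite [h *: 1]mulr1 [_ *: (_ - _)]/(_ * _) => h1.
have -> : f (x + h) - f x - d * h = - (d - h^-1 * (f (h + x) - f x)) * h.
  by rewrite opprB mulrBl mulrAC mulVf // mul1r (addrC x).
by rewrite normrM normrN ler_wpM2r.
Qed.

Definition polar (r t : R) : R[i] := (r * cos t) +i* (r * sin t).

Lemma normc_polar r t : 0 <= r -> normc (polar r t) = r.
Proof.
by move=> r0; rewrite /= !exprMn -mulrDr cos2Dsin2 mulr1 sqrtr_sqr ger0_norm.
Qed.

Lemma polarM r s t u : polar r t * polar s u = polar (r * s) (t + u).
Proof.
apply/eqP; rewrite eq_complex cReM cImM /= cosD sinD.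
by apply/andP; split; apply/eqP; ring.
Qed.

Lemma polar1 : polar 1 0 = 1.
Proof. by rewrite /polar cos0 sin0 mulr0 mulr1. Qed.

(** The point is exp(h + ik), so this is the derivative of the complex exponential at 0, assembled
    from the real derivatives of exp, cos and sin. *)
Lemma polar_eps (e : R) : 0 < e -> exists2 dl, 0 < dl & forall h k, `|h| <= dl -> `|k| <= dl ->
  normc (polar (expR h) k - 1 - (h +i* k)) <= e * (`|h| + `|k|).
Proof.
move=> e0.
have e80 : 0 < e / 8 by rewrite divr_gt0.
have [d1 d10 h1] := is_derive_eps (is_derive_expR (0 : R)) e80.
have [d2 d20 h2] := is_derive_eps (is_derive_cos (0 : R)) e80.
have [d3 d30 h3] := is_derive_eps (is_derive_sin (0 : R)) e80.
have [d4 d40 h4] := is_derive_eps (is_derive_expR (0 : R)) ltr01.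
exists (Num.min (Num.min (Num.min d1 d2) (Num.min d3 d4)) (Num.min (e / 8) (1 / 2))).
  by rewrite !lt_min d10 d20 d30 d40 e80; lra.
move=> h k; rewrite !le_min => /andP[/andP[/andP[a1 a2] /andP[a3 a4]] /andP[a5 a6]].
move=> /andP[/andP[/andP[b1 b2] /andP[b3 b4]] /andP[b5 b6]].
have := h1 _ a1; have := h2 _ b2; have := h3 _ b3; have := h4 _ a4.
rewrite !add0r expR0 cos0 sin0 oppr0 !mul0r !mul1r !subr0 ?addr0.
set E := expR h; set ck := cos k; set sk := sin k => k1 k2 k3 k4.
have E3 : `|E| <= 2.
  have -> : E = (E - 1 - h) + (1 + h) by ring.
  apply: le_trans (ler_normD _ _) _; have := ler_normD 1 h; rewrite normr1; lra.
apply: le_trans (normc_le_ReIm _) _; rewrite !cReB !cImB /= -/E -/ck -/sk subr0.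
have r1 : `|E * ck - 1 - h| <= e / 8 * `|h| + 2 * (e / 8 * `|k|).
  have -> : E * ck - 1 - h = (E - 1 - h) + E * (ck - 1) by ring.
  by apply: le_trans (ler_normD _ _) _; rewrite normrM lerD // ler_pM.
have r2 : `|E * sk - k| <= 2 * (e / 8 * `|k|) + 2 * (e / 8) * `|k|.
  have -> : E * sk - k = E * (sk - k) + (E - 1) * k by ring.
  apply: le_trans (ler_normD _ _) _; rewrite !normrM lerD //; first by rewrite ler_pM.
  rewrite ler_wpM2r //; have -> : E - 1 = (E - 1 - h) + h by ring.
  apply: le_trans (ler_normD _ _) _; lra.
have := normr_ge0 h; have := normr_ge0 k.
set X := `|h| in r1 *; set Y := `|k| in r1 r2 *; nra.
Qed.

(** Multiplicativity of the exponential moves the base point to 0. *)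
Lemma polar_log_eps s0 t0 (e : R) : 0 < e -> exists2 dl, 0 < dl & forall s t,
  `|s - s0| <= dl -> `|t - t0| <= dl ->
  normc (polar (expR s) t - polar (expR s0) t0 - polar (expR s0) t0 * ((s - s0) +i* (t - t0)))
    <= e * (`|s - s0| + `|t - t0|).
Proof.
move=> e0; have E0 : 0 < expR s0 by exact: expR_gt0.
have [dl dl0 h] := polar_eps (divr_gt0 e0 E0); exists dl => // s t hs ht.
have -> : polar (expR s) t = polar (expR s0) t0 * polar (expR (s - s0)) (t - t0).
  by rewrite polarM -expRD !(addrC _ (_ - _)) !subrK.
have -> : polar (expR s0) t0 * polar (expR (s - s0)) (t - t0) - polar (expR s0) t0 -
   polar (expR s0) t0 * ((s - s0) +i* (t - t0)) =
   polar (expR s0) t0 * (polar (expR (s - s0)) (t - t0) - 1 - ((s - s0) +i* (t - t0))).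
  by rewrite !mulrBr mulr1.
rewrite ComplexField.Normc.normcM normc_polar ?expR_ge0 // [leLHS]mulrC -ler_pdivlMr //.
by rewrite mulrAC; exact: h.
Qed.

Lemma cderiv_polar (f : R[i] -> R[i]) s0 t0 d : cderiv f (polar (expR s0) t0) d ->
  let D := d * polar (expR s0) t0 in
  forall e : R, 0 < e -> exists2 dl, 0 < dl & forall s t,
  `|s - s0| <= dl -> `|t - t0| <= dl ->
  normc (f (polar (expR s) t) - f (polar (expR s0) t0) - D * ((s - s0) +i* (t - t0)))
    <= e * (`|s - s0| + `|t - t0|).
Proof.
move=> hf D e e0; set z0 := polar _ _ in hf D *.
pose L := 1 + normc z0.
have L0 : 0 < L by rewrite ltr_pwDl // normc_ge0.
pose M := 1 + normc d.
have M0 : 0 < M by rewrite ltr_pwDl // normc_ge0.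
have e1 : 0 < e / (2 * L) by rewrite divr_gt0 ?mulr_gt0.
have e2 : 0 < e / (2 * M) by rewrite divr_gt0 ?mulr_gt0.
have [d1 d10 h1] := hf _ e1.
have [d2 d20 h2] := polar_log_eps s0 t0 e2.
have [d3 d30 h3] := polar_log_eps s0 t0 (ltr01 : 0 < (1 : R)).
exists (Num.min (Num.min d2 d3) (d1 / (2 * L))) => [|s t].
  by rewrite !lt_min d20 d30 divr_gt0 ?mulr_gt0.
rewrite !le_min => /andP[/andP[a2 a3] a1] /andP[/andP[b2 b3] b1].
set w := polar (expR s) t; set hk := (s - s0) +i* (t - t0).
have k2 := h2 _ _ a2 b2; have k3 := h3 _ _ a3 b3; rewrite -/w -/z0 -/hk in k2 k3.
set S := `|s - s0| + `|t - t0| in k2 k3 *.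
have hkS : normc hk <= S by exact: normc_le_ReIm.
have wz : normc (w - z0) <= L * S.
  have -> : w - z0 = (w - z0 - z0 * hk) + z0 * hk by rewrite subrK.
  apply: le_trans (le_normcD _ _) _; rewrite ComplexField.Normc.normcM /L mulrDl.
  by rewrite lerD // ler_wpM2l ?normc_ge0.
have wd : normc (w - z0) <= d1.
  apply: le_trans wz _.
  have : L * S <= L * (d1 / (2 * L) + d1 / (2 * L)) by apply: ler_wpM2l; [exact: ltW|exact: lerD].
  have -> : L * (d1 / (2 * L) + d1 / (2 * L)) = d1 by field; rewrite gt_eqF.
  by [].
have k1 := h1 _ wd.
have -> : f w - f z0 - D * hk = (f w - f z0 - d * (w - z0)) + d * (w - z0 - z0 * hk).
  by rewrite /D; ring.
apply: le_trans (le_normcD _ _) _; rewrite ComplexField.Normc.normcM.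
have : e / (2 * L) * normc (w - z0) <= e / (2 * L) * (L * S) by rewrite ler_wpM2l // ltW.
have -> : e / (2 * L) * (L * S) = e / 2 * S by field; rewrite gt_eqF.
have : normc d * normc (w - z0 - z0 * hk) <= M * (e / (2 * M) * S).
  by apply: ler_pM; rewrite ?normc_ge0 // /M lerDr.
have -> : M * (e / (2 * M) * S) = e / 2 * S by field; rewrite gt_eqF.
move: k1; lra.
Qed.

End PolarCoordinates.

Section CircleMeans.
Variable R : realType.
Local Notation C := (Cplx R).
Implicit Types (z w x y : R[i]).

(* A variant rather than a definition, so that unification never unfolds it. *)
Variant hol (f : R[i] -> R[i]) z : Prop := Hol of derivable (f : C -> C) (z : C) 1.

Lemma hol_cderiv f z : hol f z -> exists d, cderiv f z d.
Proof. by case=> h; exact: derivable_cderiv. Qed.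

Definition circ_cont (g : R -> R[i]) :=
  cont_on 0 (2 * pi) (fun t => Re (g t)) /\ cont_on 0 (2 * pi) (fun t => Im (g t)).

Definition cmeant (g : R -> R[i]) : R[i] :=
  (segint 0 (2 * pi) (fun t => Re (g t)) / (2 * pi)) +i*
  (segint 0 (2 * pi) (fun t => Im (g t)) / (2 * pi)).

Definition cmean r (f : R[i] -> R[i]) := cmeant (fun t => f (polar r t)).

Lemma pi2_gt0 : 0 < 2 * pi :> R.
Proof. by rewrite mulr_gt0 // pi_gt0. Qed.

(** Along exp(s + it) the t-derivative of [f] is i times its s-derivative. These Cauchy-Riemann
    equations make the fields (Im f, Re f) and (Re f, -Im f) divergence free; they encode the
    imaginary and the real part of the closed form f dz / z. *)
Lemma hol_divfree (f : R[i] -> R[i]) a b c d :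
  (forall s t, a <= s <= b -> hol f (polar (expR s) t)) ->
  divfree (fun s t => Re (f (polar (expR s) t))) (fun s t => Im (f (polar (expR s) t))) a b c d /\
  divfree (fun s t => - Im (f (polar (expR s) t))) (fun s t => Re (f (polar (expR s) t))) a b c d.
Proof.
move=> hf.
have key s0 t0 : a <= s0 <= b -> exists D : R[i],
    diff_at (fun s t => Re (f (polar (expR s) t))) a b c d s0 t0 (Re D) (- Im D) /\
    diff_at (fun s t => Im (f (polar (expR s) t))) a b c d s0 t0 (Im D) (Re D).
  move=> hs; have [d0 hd] := hol_cderiv (hf s0 t0 hs).
  exists (d0 * polar (expR s0) t0); have := cderiv_polar hd; cbv zeta.
  move: (d0 * polar (expR s0) t0) => D hD.
  split=> e e0; have [dl dl0 h] := hD e e0; exists dl => // s t _ _ h1 h2; have := h s t h1 h2.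
    move=> h3; apply: le_trans h3; apply: le_trans (le_Re_normc _).
    by rewrite !cReB cReM /= mulNr.
  move=> h3; apply: le_trans h3; apply: le_trans (le_Im_normc _).
  by rewrite !cImB cImM /= [Im D * _ + _]addrC.
split=> s0 t0 hs ht; have [D [hR hI]] := key s0 t0 hs.
  by exists (Re D), (- Im D), (Im D), (Re D); split => //; rewrite subrr.
exists (- Im D), (- Re D), (Re D), (- Im D); split => //; first by rewrite subrr.
move=> e e0; have [dl dl0 h] := hI e e0; exists dl => // s t h1 h2 h3 h4.
have := h s t h1 h2 h3 h4; rewrite -normrN; congr (`|_| <= _); ring.
Qed.

Lemma polar_2pi (r : R) : polar r (2 * pi) = polar r 0.
Proof. by rewrite /polar (_ : 2 * pi = pi *+ 2) ?mulr_natl // cos2pi sin2pi cos0 sin0. Qed.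

(** On the rectangle [ln r1, ln r2] x [0, 2 pi] the edges t = 0 and t = 2 pi cancel by periodicity,
    so zero flux says that the two circle integrals agree. *)
Lemma cmean_const f r1 r2 : 0 < r1 -> r1 <= r2 ->
  (forall z, r1 <= normc z <= r2 -> hol f z) -> cmean r1 f = cmean r2 f.
Proof.
move=> r10; rewrite le_eqVlt => /orP[/eqP -> //|r12] hf.
have r20 : 0 < r2 by exact: lt_trans r12.
have ab : ln r1 < ln r2 by rewrite ltr_ln.
have [|D1 D2] := @hol_divfree f (ln r1) (ln r2) 0 (2 * pi).
  move=> s t /andP[h1 h2]; apply: hf; rewrite normc_polar ?expR_ge0 //.
  by rewrite -(lnK r10) -(lnK r20) !ler_expR h1 h2.
have ha : ln r1 <= ln r1 <= ln r2 by rewrite lexx ltW.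
have hb : ln r1 <= ln r2 <= ln r2 by rewrite lexx ltW.
have [_ c1 _ _] := divfree_cont D1; have [_ c2 _ _] := divfree_cont D2.
have zero (g : R -> R) : (forall s, g s = 0) -> segint (ln r1) (ln r2) g = 0.
  move=> hg; rewrite -[RHS](mul0r (ln r2 - ln r1)) -(segint_cst _ (ltW ab)).
  by apply: eq_segint => s _; rewrite hg.
have := goursat ab pi2_gt0 D1; rewrite /flux [X in _ + X]zero; last by move=> s; rewrite polar_2pi subrr.
have := goursat ab pi2_gt0 D2; rewrite /flux [X in _ + X]zero; last by move=> s; rewrite polar_2pi subrr.
rewrite !addr0 (segintB (c1 _ hb) (c1 _ ha)) (segintB (c2 _ hb) (c2 _ ha)).
rewrite (lnK r10) (lnK r20) => /subr0_eq e2 /subr0_eq e1.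
by rewrite /cmean /cmeant e1 e2.
Qed.

Lemma cmeant_ext g h : (forall t, g t = h t) -> cmeant g = cmeant h.
Proof. by move=> e; rewrite (funext e). Qed.

Lemma cmeantD g h : circ_cont g -> circ_cont h ->
  cmeant (fun t => g t + h t) = cmeant g + cmeant h.
Proof.
move=> [g1 g2] [h1 h2]; rewrite /cmeant.
rewrite (_ : (fun t => Re (g t + h t)) = fun t => Re (g t) + Re (h t)); last by apply/funext => t; exact: cReD.
rewrite (_ : (fun t => Im (g t + h t)) = fun t => Im (g t) + Im (h t)); last by apply/funext => t; exact: cImD.
by rewrite !segintD // !mulrDl.
Qed.

Lemma circ_contD g h : circ_cont g -> circ_cont h -> circ_cont (fun t => g t + h t).
Proof.
move=> [g1 g2] [h1 h2]; split.
  by rewrite (_ : (fun t => _) = fun t => Re (g t) + Re (h t)); [exact: cont_onD|apply/funext => t; exact: cReD].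
by rewrite (_ : (fun t => _) = fun t => Im (g t) + Im (h t)); [exact: cont_onD|apply/funext => t; exact: cImD].
Qed.

Lemma circ_contM g h : circ_cont g -> circ_cont h -> circ_cont (fun t => g t * h t).
Proof.
move=> [g1 g2] [h1 h2]; split.
  rewrite (_ : (fun t => _) = fun t => Re (g t) * Re (h t) - Im (g t) * Im (h t)); last by apply/funext => t; exact: cReM.
  by apply: cont_onB; exact: cont_onM.
rewrite (_ : (fun t => _) = fun t => Re (g t) * Im (h t) + Im (g t) * Re (h t)); last by apply/funext => t; exact: cImM.
by apply: cont_onD; exact: cont_onM.
Qed.

Lemma circ_cont_cst k : circ_cont (fun=> k).
Proof. by split; exact: cont_on_cst. Qed.

Lemma cmeant_cst k : cmeant (fun=> k) = k.
Proof.
rewrite /cmeant !segint_cst ?ltW ?pi2_gt0 // subr0 !mulfK ?gt_eqF ?pi2_gt0 //.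
by case: k.
Qed.

Lemma cmeantZ k g : circ_cont g -> cmeant (fun t => k * g t) = k * cmeant g.
Proof.
move=> [g1 g2]; rewrite /cmeant.
have Z1 (a : R) := segintZl a g1; have Z2 (a : R) := segintZl a g2.
have c1 (a : R) : cont_on 0 (2 * pi) (fun t => a * Re (g t)) by apply: cont_onM => //; exact: cont_on_cst.
have c2 (a : R) : cont_on 0 (2 * pi) (fun t => a * Im (g t)) by apply: cont_onM => //; exact: cont_on_cst.
rewrite (_ : (fun t => Re (k * g t)) = fun t => Re k * Re (g t) - Im k * Im (g t)); last by apply/funext => t; exact: cReM.
rewrite (_ : (fun t => Im (k * g t)) = fun t => Re k * Im (g t) + Im k * Re (g t)); last by apply/funext => t; exact: cImM.
rewrite segintB ?segintD // !Z1 !Z2.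
by apply/eqP; rewrite eq_complex cReM cImM /=; apply/andP; split; apply/eqP; ring.
Qed.

(* The factor 2 is lost by estimating real and imaginary parts separately. *)
Lemma cmeant_norm_le g (M : R) : circ_cont g -> (forall t, normc (g t) <= M) ->
  normc (cmeant g) <= 2 * M.
Proof.
move=> [g1 g2] h; have p0 := pi2_gt0.
have part f : cont_on 0 (2 * pi) f -> (forall t, `|f t| <= M) -> `|segint 0 (2 * pi) f / (2 * pi)| <= M.
  move=> cf hf; rewrite normrM normfV (gtr0_norm p0) ler_pdivrMr //.
  have := segint_norm_le (ltW p0) cf (fun t _ => hf t); by rewrite subr0.
apply: le_trans (normc_le_ReIm _) _; have -> : 2 * M = M + M by ring.
apply: lerD; apply: part => // t.
  exact: le_trans (le_Re_normc _) (h t).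
exact: le_trans (le_Im_normc _) (h t).
Qed.

End CircleMeans.

(** * Means on circles that cross bounded singularities *)

Section Singular.
Variable R : realType.
Local Notation mu := (@lebesgue_measure R).
Implicit Types (z w x y : R[i]) (f g : R[i] -> R[i]).

Lemma hol_cst k z : hol (fun=> k) z.
Proof. by constructor; exact: derivable_cst. Qed.
Lemma hol_id z : hol id z.
Proof. by constructor; exact: derivable_id. Qed.
Lemma holD f g z : hol f z -> hol g z -> hol (fun w => f w + g w) z.
Proof. by move=> [h1] [h2]; constructor; exact: derivableD. Qed.
Lemma holB f g z : hol f z -> hol g z -> hol (fun w => f w - g w) z.
Proof. by move=> [h1] [h2]; constructor; exact: derivableB. Qed.
Lemma holM f g z : hol f z -> hol g z -> hol (fun w => f w * g w) z.
Proof. by move=> [h1] [h2]; constructor; exact: derivableM. Qed.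
Lemma holV f z : f z != 0 -> hol f z -> hol (fun w => (f w)^-1) z.
Proof. by move=> z0 [h]; constructor; exact: derivableV. Qed.
Lemma holX f n z : hol f z -> hol (fun w => f w ^+ n) z.
Proof.
move=> hf; elim: n => [|n IH].
  by rewrite (_ : (fun w => _) = fun=> 1); [exact: hol_cst|apply/funext => w; rewrite expr0].
by rewrite (_ : (fun w => _) = fun w => f w * f w ^+ n); [exact: holM|apply/funext => w; rewrite exprS].
Qed.

Lemma hol_cont f z : hol f z -> forall e : R, 0 < e ->
  exists2 dl : R, 0 < dl & forall w, normc (w - z) <= dl -> normc (f w - f z) <= e.
Proof.
move=> /hol_cderiv[d /(_ 1 ltr01)[dl dl0 h]] e e0.
pose L := 1 + normc d; have L0 : 0 < L by rewrite ltr_pwDl ?normc_ge0.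
exists (Num.min dl (e / L)) => [|w]; first by rewrite lt_min dl0 divr_gt0.
rewrite le_min => /andP[h1 h2]; have := h w h1; rewrite mul1r => h3.
have -> : f w - f z = (f w - f z - d * (w - z)) + d * (w - z) by rewrite subrK.
apply: le_trans (le_normcD _ _) _; rewrite ComplexField.Normc.normcM.
apply: le_trans (lerD h3 (lexx _)) _.
have -> : normc (w - z) + normc d * normc (w - z) = L * normc (w - z) by rewrite /L mulrDl mul1r.
by rewrite mulrC -ler_pdivlMr.
Qed.

Lemma hol_circ_cont f r : 0 < r -> (forall z, normc z = r -> hol f z) ->
  circ_cont (fun t => f (polar r t)).
Proof.
move=> r0 hf.
have [|D1 _] := @hol_divfree R f (ln r) (ln r) 0 (2 * pi).
  move=> s t /andP[h1 h2]; apply: hf; rewrite normc_polar ?expR_ge0 //.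
  by rewrite (le_anti (introT andP (conj h2 h1))) lnK.
have hr : ln r <= ln r <= ln r by rewrite lexx.
have [c1 c2 _ _] := divfree_cont D1.
by have := c1 _ hr; have := c2 _ hr; rewrite lnK.
Qed.

Lemma polar_inj (r t u : R) : r != 0 -> 0 < t < 2 * pi -> 0 < u < 2 * pi ->
  polar r t = polar r u -> t = u.
Proof.
move=> r0 ht hu []; move=> /(mulfI r0) ec /(mulfI r0) es.
(* The half angle lies in (0, pi), where sin is positive, whereas cos d = 1 would force sin(d/2) =
   0. *)
have key (d : R) : 0 < d < 2 * pi -> cos d != 1.
  move=> /andP[d0 d2]; apply/eqP => c1.
  have s0 : 0 < sin (d / 2).
    by apply: sin_gt0_pi; rewrite divr_gt0 //= ltr_pdivrMr // mulrC.
  have : cos (d / 2 *+ 2) = 1 by rewrite -mulr_natr divfK.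
  rewrite cos_mulr2n => h; have : cos (d / 2) ^+ 2 = 1.
    by move: h; rewrite -mulr_natr; lra.
  have := cos2Dsin2 (d / 2) => h2 h3; have : sin (d / 2) ^+ 2 = 0 by lra.
  by move/eqP; rewrite sqrf_eq0 gt_eqF.
have cd : cos (t - u) = 1 by rewrite cosB ec es -!expr2 cos2Dsin2.
have cd' : cos (u - t) = 1 by rewrite cosB ec es -!expr2 cos2Dsin2.
case: (ltgtP t u) => // h.
  by have := key (u - t); rewrite cd' eqxx; move=> /(_ _)/negP[]//; lra.
by have := key (t - u); rewrite cd eqxx; move=> /(_ _)/negP[]//; lra.
Qed.

(** Dominated convergence for a sequence whose integrals are all equal. The exceptional set [T] is
    meant for the angles at which a circle meets a singularity. *)
Lemma bounded_convergence0 (a b : R) (g : nat -> R -> R) (M A : R) (T : set R) :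
  (forall n, cont_on a b (g n)) ->
  (forall n t, a <= t <= b -> `|g n t| <= M) ->
  finite_set T ->
  (forall t, a <= t <= b -> ~ T t -> forall e, 0 < e -> \forall n \near \oo, `|g n t| <= e) ->
  (forall n, segint a b (g n) = A) -> A = 0.
Proof.
move=> cg bg fT hg gA.
have ig n := cont_on_integrable (cg n).
have negT : mu.-negligible T.
  by apply/negligibleP; [exact: countable_measurable (finite_set_countable fT)|
    exact: countable_lebesgue_measure0 (finite_set_countable fT)].
have mD : measurable (`[a, b]%classic : set R) by [].
have mg n := proj1 (elimT (integrableP _ _ _) (ig n)).
have cv : \forall x \ae mu, `[a, b]%classic x -> ((EFin \o g n) x @[n --> \oo] --> (cst 0%E : R -> \bar R) x).
  apply: negligibleS negT => t /= h; apply: contrapT => Tt; apply: h; rewrite in_itv /= => tab.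
  apply: cvg_EFin; first exact: nearW.
  apply/cvgrPdist_le => /= e e0; have := hg t tab Tt e e0.
  by apply: filterS => n; rewrite sub0r normrN.
have iM := cont_on_integrable (@cont_on_cst R a b M).
have bd : \forall x \ae mu, forall n, `[a, b]%classic x -> (`|(EFin \o g n) x| <= (EFin \o (fun=> M)) x)%E.
  by apply: aeW => t n /=; rewrite in_itv /= => tab; rewrite lee_fin bg.
have [_ _] := @dominated_convergence _ _ R mu _ mD (fun n => EFin \o g n) (cst 0%E) (EFin \o (fun=> M)) mg (measurable_cst _) cv iM bd.
rewrite integral0 => hc.
have := fine_cvg hc; rewrite /comp /=.
under eq_cvg => n do rewrite -/(Rintegral mu `[a, b]%classic (g n)) -/(segint a b (g n)) gA.
move=> hA; exact: (cvg_unique (@norm_hausdorff _ R) (cvg_cst A) (hA _)).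
Qed.
End Singular.

Section SingularMeans.
Variable R : realType.
Implicit Types (z w x y : R[i]) (f g : R[i] -> R[i]).

Lemma normc_polarB (r s t : R) : normc (polar r t - polar s t) = `|r - s|.
Proof.
have -> : polar r t - polar s t = (r - s)%:C * polar 1 t.
  by apply/eqP; rewrite eq_complex cReB cImB cReM cImM /=; apply/andP; split; apply/eqP; ring.
by rewrite ComplexField.Normc.normcM normc_polar // mulr1 normc_real.
Qed.

Lemma finite_polar_preimage (S : seq R[i]) (r : R) : 0 < r ->
  finite_set [set t : R | (0 < t < 2 * pi) && (polar r t \in S)].
Proof.
move=> r0.
elim: S => [|z S IH].
  by rewrite (_ : mkset _ = set0) //; apply/seteqP; split => t //=; rewrite in_nil andbF.
apply: (@sub_finite_set _ _ ([set t : R | (0 < t < 2 * pi) /\ polar r t = z] `|`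
    [set t : R | (0 < t < 2 * pi) && (polar r t \in S)])).
  move=> t /= /andP[ht]; rewrite in_cons => /orP[/eqP <-|h]; first by left.
  by right; rewrite ht h.
rewrite finite_setU; split => //.
have [[t0 [h0 z0]]|no] := pselect (exists t0 : R, 0 < t0 < 2 * pi /\ polar r t0 = z).
  apply: (@sub_finite_set _ _ [set t0]) (finite_set1 _) => t /= [ht zt].
  by apply: (@polar_inj _ r) => //; rewrite ?gt_eqF // zt z0.
rewrite (_ : mkset _ = set0) //; apply/seteqP; split => t //= h.
by apply: no; exists t.
Qed.

(** The circles of radius p - eta and p + eta carry no singularity, so the mean is constant in eta
    on either side. As eta tends to 0 the two integrands approach each other except at finitely many
    angles, and the bound [M] lets the limit pass under the integral. *)
Lemma cmean_cross f (S : seq R[i]) (p dl M : R) : 0 < dl -> dl < p ->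
  (forall z, `|normc z - p| <= dl -> z \notin S -> hol f z /\ normc (f z) <= M) ->
  (forall z, z \in S -> `|normc z - p| <= dl -> normc z = p) ->
  cmean (p - dl) f = cmean (p + dl) f.
Proof.
move=> dl0 dlp hf hS.
pose eta n : R := dl / n.+1%:R.
have eta0 n : 0 < eta n by rewrite divr_gt0.
have etal n : eta n <= dl by rewrite ler_pdivrMr // ler_peMr ?ler1n // ltW.
have off z : `|normc z - p| <= dl -> normc z != p -> hol f z /\ normc (f z) <= M.
  by move=> h1 h2; apply: hf => //; apply: contra h2 => zS; apply/eqP; exact: hS.
have Lm n : cmean (p - dl) f = cmean (p - eta n) f.
  apply: cmean_const; [lra|have := etal n; lra|].
  move=> z /andP[h1 h2]; have := eta0 n => h3; apply: (off z _ _).1; last by rewrite lt_eqF //; lra.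
  by rewrite ler_norml; apply/andP; split; lra.
have Lp n : cmean (p + eta n) f = cmean (p + dl) f.
  apply: cmean_const; [have := eta0 n; lra|have := etal n; lra|].
  move=> z /andP[h1 h2]; have := eta0 n => h3; apply: (off z _ _).1; last by rewrite gt_eqF //; lra.
  by rewrite ler_norml; apply/andP; split; lra.
have p0 : 0 < p by lra.
have circ s : s != p -> `|s - p| <= dl -> circ_cont (fun t => f (polar s t)).
  move=> sp hs; apply: hol_circ_cont; first by move: hs; rewrite ler_norml => /andP[]; lra.
  by move=> z zs; apply: (off z _ _).1; rewrite zs.
have dm n : `|p - eta n - p| <= dl.
  by rewrite addrAC subrr sub0r normrN gtr0_norm.
have dp n : `|p + eta n - p| <= dl.
  by rewrite addrAC subrr add0r gtr0_norm.
have nm n : p - eta n != p by rewrite lt_eqF // ltrBlDr ltrDl.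
have np n : p + eta n != p by rewrite gt_eqF // ltrDl.
(* The end angles are included because [polar_inj], hence the finiteness of the rest, concerns the
   open interval. *)
pose T : set R := [set 0; 2 * pi] `|` [set t | (0 < t < 2 * pi) && (polar p t \in S)].
have fT : finite_set T.
  by rewrite finite_setU; split; [rewrite finite_setU; split; exact: finite_set1|exact: finite_polar_preimage].
have conv t : 0 <= t <= 2 * pi -> ~ T t -> forall e, 0 < e ->
    \forall n \near \oo, normc (f (polar (p + eta n) t) - f (polar (p - eta n) t)) <= e.
  move=> ht nT e e0.
  have tS : polar p t \notin S.
    apply/negP => tS; apply: nT; case: (eqVneq t 0) => [->|t0]; first by left; left.
    case: (eqVneq t (2 * pi)) => [->|t1]; first by left; right.
    by right; rewrite /= !lt_neqAle tS t1 eq_sym t0 !andbT.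
  have [hp _] : hol f (polar p t) /\ normc (f (polar p t)) <= M.
    by apply: hf => //; rewrite (normc_polar _ (ltW p0)) subrr normr0; exact: ltW.
  have [d d0 hd] := hol_cont hp (divr_gt0 e0 (ltr0Sn R 1)).
  exists (Num.truncn (dl / d)) => // n /= hn.
  have en : eta n <= d.
    rewrite /eta ler_pdivrMr // mulrC -ler_pdivrMr //; apply: ltW; apply: lt_le_trans (truncnS_gt _) _.
    by rewrite ler_nat.
  have -> : f (polar (p + eta n) t) - f (polar (p - eta n) t) =
     (f (polar (p + eta n) t) - f (polar p t)) - (f (polar (p - eta n) t) - f (polar p t)) by ring.
  apply: le_trans (le_normcB _ _) _; rewrite [leRHS](splitr e); apply: lerD; apply: hd.
    by rewrite normc_polarB addrAC subrr add0r gtr0_norm.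
  by rewrite normc_polarB addrAC subrr add0r normrN gtr0_norm.
have pm n : 0 <= p - eta n by rewrite subr_ge0 (le_trans (etal n)) ?ltW.
have pp n : 0 <= p + eta n by rewrite addr_ge0 // ltW.
have bnd n t : normc (f (polar (p + eta n) t) - f (polar (p - eta n) t)) <= M + M.
  apply: le_trans (le_normcB _ _) _; apply: lerD; apply: (off _ _ _).2;
  by rewrite ?(normc_polar _ (pm n)) ?(normc_polar _ (pp n)).
have key (U : R[i] -> R) : (forall z, `|U z| <= normc z) -> (forall z w, U (z - w) = U z - U w) ->
    (forall s, s != p -> `|s - p| <= dl -> cont_on 0 (2 * pi) (fun t => U (f (polar s t)))) ->
    (forall n, segint 0 (2 * pi) (fun t => U (f (polar (p - dl) t))) =
      segint 0 (2 * pi) (fun t => U (f (polar (p - eta n) t)))) ->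
    (forall n, segint 0 (2 * pi) (fun t => U (f (polar (p + eta n) t))) =
      segint 0 (2 * pi) (fun t => U (f (polar (p + dl) t)))) ->
    segint 0 (2 * pi) (fun t => U (f (polar (p - dl) t))) =
    segint 0 (2 * pi) (fun t => U (f (polar (p + dl) t))).
  move=> Un UB Uc Um Up; symmetry; apply/eqP; rewrite -subr_eq0; apply/eqP.
  apply: (@bounded_convergence0 R 0 (2 * pi)
    (fun n t => U (f (polar (p + eta n) t)) - U (f (polar (p - eta n) t))) (M + M) _ T) => //.
  - by move=> n; apply: cont_onB; [exact: (Uc _ (np n) (dp n))|exact: (Uc _ (nm n) (dm n))].
  - by move=> n t _; rewrite -UB; apply: le_trans (Un _) _.
  - move=> t ht nT e e0; apply: filterS (conv t ht nT e e0) => n h.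
    by rewrite -UB; apply: le_trans h.
  - by move=> n; rewrite (segintB (Uc _ (np n) (dp n)) (Uc _ (nm n) (dm n))) Up -Um.
have div2 (x y : R) : x / (2 * pi) = y / (2 * pi) -> x = y.
  by move=> h; apply: (mulIf _ h); rewrite invr_eq0 gt_eqF // pi2_gt0.
rewrite /cmean /cmeant; congr (_ / _ +i* (_ / _)); apply: key.
- exact: le_Re_normc.
- exact: cReB.
- by move=> s h1 h2; have [] := circ s h1 h2.
- by move=> n; have [/div2] := Lm n.
- by move=> n; have [/div2] := Lp n.
- exact: le_Im_normc.
- exact: cImB.
- by move=> s h1 h2; have [] := circ s h1 h2.
- by move=> n; have [_ /div2] := Lm n.
- by move=> n; have [_ /div2] := Lp n.
Qed.

Lemma seq_gap (L : seq R) (p : R) : exists2 dl : R, 0 < dl & forall x : R, x \in L -> `|x - p| <= dl -> x = p.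
Proof.
elim: L => [|a L [dl dl0 h]]; first by exists 1.
have [->|xp] := eqVneq a p.
  by exists dl => // y; rewrite in_cons => /orP[/eqP ->|/h].
exists (Num.min dl (`|a - p| / 2)).
  by rewrite lt_min dl0 divr_gt0 // normr_gt0 subr_eq0.
move=> y; rewrite in_cons le_min => /orP[/eqP ->|/h hy] /andP[h1 h2]; last exact: hy.
move: h2; rewrite ler_pdivlMr // ger_pMr ?normr_gt0 ?subr_eq0 //.
by rewrite leNgt ltr1n.
Qed.

(* The mean is constant between consecutive moduli of singularities, and continuous
   across each of them because [f] is bounded. *)
Lemma cmean_const_sing f (S : seq R[i]) (c1 c2 M r1 r2 : R) : 0 <= c1 ->
  (forall z, c1 < normc z < c2 -> z \notin S -> hol f z /\ normc (f z) <= M) ->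
  c1 < r1 -> r1 <= r2 -> r2 < c2 ->
  (forall z, z \in S -> normc z != r1 /\ normc z != r2) ->
  cmean r1 f = cmean r2 f.
Proof.
move=> c10 hf.
have main (L : seq R) (a b : R) : c1 < a -> a <= b -> b < c2 ->
    (forall z, z \in S -> normc z != a /\ normc z != b) ->
    (forall z, z \in S -> a <= normc z <= b -> normc z \in L) -> cmean a f = cmean b f.
  elim: L a b => [|p L IH] a b ca ab bc hS hL.
    apply: cmean_const => //; first exact: le_lt_trans ca.
    move=> z hz; apply: (hf z _ _).1.
      by move/andP: hz => [h1 h2]; rewrite (lt_le_trans ca h1) (le_lt_trans h2 bc).
    by apply/negP => zS; have := hL z zS hz.
  have [/andP[ap pb]|np] := boolP (a < p < b); last first.
    apply: IH => // z zS hz; have := hL z zS hz; rewrite in_cons => /orP[/eqP zp|//].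
    move: hz np; rewrite zp => /andP[h1 h2]; have [] := hS z zS; rewrite zp => n1 n2.
    by rewrite !lt_neqAle h1 h2 n2 eq_sym n1.
  have [d0 d00 hd0] := seq_gap [seq normc z | z <- S] p.
  pose dl := Num.min d0 (Num.min ((p - a) / 2) ((b - p) / 2)).
  have dl0 : 0 < dl by rewrite !lt_min d00 !divr_gt0 ?subr_gt0.
  have dle : [/\ dl <= d0, dl <= (p - a) / 2 & dl <= (b - p) / 2].
    by split; rewrite /dl !ge_min lexx ?orbT.
  have [e1 e2 e3] := dle.
  have gap z : z \in S -> `|normc z - p| <= dl -> normc z = p.
    by move=> zS h; apply: hd0; [exact: map_f|exact: le_trans e1].
  have nope z : z \in S -> normc z != p - dl /\ normc z != p + dl.
    move=> zS; split; apply/eqP => zE; have := gap z zS; rewrite zE.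
      by rewrite addrAC subrr sub0r normrN gtr0_norm // => /(_ (lexx _)); lra.
    by rewrite addrAC subrr add0r gtr0_norm // => /(_ (lexx _)); lra.
  have -> : cmean a f = cmean (p - dl) f.
    apply: IH => //; try lra.
      by move=> z zS; split; [have [] := hS z zS|have [] := nope z zS].
    move=> z zS /andP[h1 h2]; have := hL z zS; rewrite h1 in_cons => /(_ _)/orP[|/eqP zp|//].
      by lra.
    by exfalso; lra.
  have -> : cmean (p - dl) f = cmean (p + dl) f.
    apply: (@cmean_cross _ S p dl M) => //; first by lra.
    move=> z; rewrite ler_norml => /andP[h1 h2] zS; apply: hf => //.
    by apply/andP; split; lra.
  apply: IH => //; try lra.
    by move=> z zS; split; [have [] := nope z zS|have [] := hS z zS].
  move=> z zS /andP[h1 h2]; have := hL z zS; rewrite h2 in_cons andbT => /(_ _)/orP[|/eqP zp|//].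
    by lra.
  by exfalso; lra.
move=> ca ab bc hS; apply: (main [seq normc z | z <- S]) => // z zS _; exact: map_f.
Qed.

End SingularMeans.

(** * Cauchy's formula, Taylor coefficients and zeros *)

Section Cauchy.
Variable R : realType.
Implicit Types (z w x y : R[i]) (f g : R[i] -> R[i]).

(** Local boundedness plus compactness of the square [-1, 1]^2, the bound being the parameter that
    tends to infinity. Near a point of modulus at least 1 the claim is vacuous, because moduli there
    exceed [c]. *)
Lemma hol_bounded f (c : R) : c < 1 -> (forall z, normc z < 1 -> hol f z) ->
  exists M : R, forall z, normc z <= c -> normc (f z) <= M.
Proof.
move=> c1 hf.
have cK : compact ((`[(-1 : R), 1]%classic : set R) `*` (`[(-1 : R), 1]%classic : set R)).
  by apply: compact_setX; exact: segment_compact.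
have := (compact_near_coveringP _).1 cK R (pinfty_nbhs R)
  (fun M p => normc (p.1 +i* p.2) <= c -> normc (f (p.1 +i* p.2)) <= M) _.
move=> h; have : \forall M \near (pinfty_nbhs R), ((`[(-1 : R), 1]%classic : set R) `*` (`[(-1 : R), 1]%classic : set R)) `<=`
    (fun p => normc (p.1 +i* p.2) <= c -> normc (f (p.1 +i* p.2)) <= M).
  apply: h => -[x0 y0] _.
  have near_le (d : R) : 0 < d -> \forall p \near ((x0, y0) : R * R), normc ((p.1 +i* p.2) - (x0 +i* y0)) <= d.
    move=> d0; exists (ball x0 (d / 2), ball y0 (d / 2)).
      by split; apply: nbhsx_ballx; rewrite divr_gt0.
    move=> -[a b] [ha hb]; rewrite /mkset; apply: le_trans (normc_le_ReIm _) _; rewrite cReB cImB /= (splitr d).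
    by apply: lerD; rewrite distrC ltW.
  have [z1|z1] := ltP (normc (x0 +i* y0)) 1.
    have [d d0 hd] := hol_cont (hf _ z1) ltr01.
    exists ([set p : R * R | normc ((p.1 +i* p.2) - (x0 +i* y0)) <= d], [set M : R | normc (f (x0 +i* y0)) + 1 <= M]).
      by split; [exact: near_le|apply: nbhs_pinfty_ge; exact: num_real].
    move=> -[[a b] M] [/hd h1 h2] _; apply: le_trans h2.
    rewrite -[f _](subrK (f (x0 +i* y0))) addrC.
    by apply: le_trans (le_normcD _ _) _; rewrite lerD2l.
  have d0 : 0 < (1 - c) / 2 by rewrite divr_gt0 ?subr_gt0.
  exists ([set p : R * R | normc ((p.1 +i* p.2) - (x0 +i* y0)) <= (1 - c) / 2], setT).
    by split; [exact: near_le|exact: filterT].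
  move=> -[[a b] M] [h1 _] h2; exfalso.
  change (is_true (normc ((a +i* b) - (x0 +i* y0)) <= (1 - c) / 2)) in h1.
  change (is_true (normc (a +i* b) <= c)) in h2.
  have := le_normcD (- ((a +i* b) - (x0 +i* y0))) (a +i* b).
  rewrite opprB subrK -opprB normcN; lra.
case=> M [_ hM]; exists (M + 1) => z zc.
case: z zc => a b zc; apply: (hM (M + 1) _ (a, b)) => //=; first by rewrite ltrDl.
have h1 := le_Re_normc (a +i* b); have h2 := le_Im_normc (a +i* b).
rewrite !in_itv -!ler_norml; split; first exact: le_trans h1 (le_trans zc (ltW c1)).
exact: le_trans h2 (le_trans zc (ltW c1)).
Qed.

Lemma small_zero (k : R[i]) (B d0 : R) : 0 < d0 ->
  (forall e, 0 < e -> e <= d0 -> normc k <= B * e) -> k = 0.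
Proof.
move=> d00 h; apply/eqP; rewrite -normc_eq0; apply/eqP/le_anti; rewrite normc_ge0 andbT.
have [//|k0] := lerP (normc k) 0.
pose D := 1 + `|B|; have D0 : 0 < D by rewrite ltr_pwDl.
have e0 : 0 < Num.min d0 (normc k / (2 * D)) by rewrite lt_min d00 divr_gt0 ?mulr_gt0.
have e1 : Num.min d0 (normc k / (2 * D)) <= d0 by rewrite ge_min lexx.
have e2 : Num.min d0 (normc k / (2 * D)) <= normc k / (2 * D) by rewrite ge_min lexx orbT.
have h1 := h _ e0 e1.
have BD : B <= D by rewrite /D; have := ler_norm B; lra.
have h2 : normc k <= D * (normc k / (2 * D)).
  by apply: le_trans h1 _; apply: le_trans (ler_wpM2r (ltW e0) BD) _; exact: ler_wpM2l (ltW D0) _ _ e2.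
move: h2; have -> : D * (normc k / (2 * D)) = normc k / 2 by field; rewrite gt_eqF.
lra.
Qed.

Lemma holVsub a z : z != a -> hol (fun w => (w - a)^-1) z.
Proof.
move=> za; apply: holV; first by rewrite subr_eq0.
by apply: holB; [exact: hol_id|exact: hol_cst].
Qed.

Lemma normc_sub_ge z a : normc z - normc a <= normc (z - a).
Proof. by have := le_normcD (z - a) a; rewrite subrK; lra. Qed.

(** The kernel is 1 + a / (z - a), and the mean of the second term does not depend on the radius and
    tends to 0 as the radius grows. In the proof [e] is the inverse of the distance from the radius
    to |a|. *)
Lemma cmean_kernel a (r : R) : normc a < r -> cmean r (fun z => z / (z - a)) = 1.
Proof.
move=> ar; have a0 := normc_ge0 a; have r0 : 0 < r by lra.
have hk z : r <= normc z -> hol (fun w => a / (w - a)) z.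
  move=> rz; apply: holM; first exact: hol_cst.
  by apply: holVsub; apply/eqP => za; move: rz; rewrite za; lra.
have cc s : r <= s -> circ_cont (fun t => a / (polar s t - a)).
  by move=> rs; apply: (@hol_circ_cont R (fun w => a / (w - a))); [lra|move=> z zs; apply: hk; rewrite zs].
have za z : r <= normc z -> z - a != 0.
  by move=> rz; rewrite subr_eq0; apply/eqP => zE; move: rz; rewrite zE; lra.
have -> : cmean r (fun z => z / (z - a)) = cmeant (fun t => 1 + a / (polar r t - a)).
  apply: cmeant_ext => t; rewrite -{1}[polar r t](subrK a) mulrDl divff // za //.
  by rewrite normc_polar // ltW.
rewrite cmeantD ?cmeant_cst; [|exact: circ_cont_cst|exact: cc].
suff -> : cmeant (fun t => a / (polar r t - a)) = 0 by rewrite addr0.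
apply: (@small_zero _ (2 * normc a) ((r - normc a)^-1)); first by rewrite invr_gt0 subr_gt0.
move=> e e0 er.
have -> : cmeant (fun t => a / (polar r t - a)) = cmean (normc a + e^-1) (fun w => a / (w - a)).
  apply: (@cmean_const R (fun w => a / (w - a))) => //.
    by rewrite -lerBlDl -[leLHS]invrK lef_pV2 ?posrE ?invr_gt0 ?subr_gt0.
  by move=> z /andP[rz _]; exact: hk.
have re : r <= normc a + e^-1.
  by rewrite -lerBlDl -[leLHS]invrK lef_pV2 ?posrE ?invr_gt0 ?subr_gt0.
rewrite -mulrA; apply: cmeant_norm_le; first exact: cc.
move=> t; rewrite normcM ComplexField.Normc.normcV ler_wpM2l //.
have ei : 0 < e^-1 by rewrite invr_gt0.
have : e^-1 <= normc (polar (normc a + e^-1) t - a).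
  by apply: le_trans (normc_sub_ge _ _); rewrite normc_polar ?addr_ge0 ?(ltW ei) // addrAC subrr add0r.
move=> h; rewrite -[leRHS]invrK lef_pV2 ?posrE //; exact: lt_le_trans h.
Qed.

(** The factor z / (z - a) is Cauchy's kernel for the angular measure. After subtracting f a, the
    product [phi] is bounded by a multiple of |z|, thanks to differentiability at [a]; its mean is
    the same on small circles around 0, hence zero. The point [a] joins the list of singularities of
    [phi]. *)
Lemma cauchy_sing f (S : seq R[i]) (c M r : R) a :
  (forall z, normc z < c -> z \notin S -> hol f z /\ normc (f z) <= M) ->
  a \notin S -> normc a < r -> r < c -> (forall z, z \in S -> normc z != r) ->
  cmean r (fun z => f z * (z / (z - a))) = f a.
Proof.
move=> hf aS ar rc Sr; have a0 := normc_ge0 a; have r0 : 0 < r by lra.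
have [ha hMa] : hol f a /\ normc (f a) <= M by apply: hf => //; lra.
pose phi z := (f z - f a) * (z / (z - a)).
have [d hd] := hol_cderiv ha; have [dl dl0 hdl] := hd 1 ltr01.
have M0 : 0 <= M by apply: le_trans hMa; exact: normc_ge0.
pose B := Num.max (1 + normc d) ((M + M) / dl).
have B0 : 0 <= B by rewrite le_max addr_ge0 ?normc_ge0.
have phiB z : normc z < c -> z \notin a :: S -> normc (phi z) <= B * normc z.
  rewrite in_cons negb_or => zc /andP[za zS]; rewrite /phi mulrCA mulrC normcM.
  rewrite ler_wpM2r ?normc_ge0 // normcM ComplexField.Normc.normcV.
  have z0 : 0 < normc (z - a) by rewrite normc_gt0 subr_eq0.
  rewrite ler_pdivrMr //.
  have [h|h] := leP (normc (z - a)) dl.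
    have := hdl z h; rewrite mul1r => h1.
    rewrite -[f z - f a](subrK (d * (z - a))); apply: le_trans (le_normcD _ _) _.
    rewrite normcM; apply: le_trans (lerD h1 (lexx _)) _.
    rewrite -[X in X + _]mul1r -mulrDl ler_wpM2r ?normc_ge0 //.
    by rewrite /B le_max lexx.
  apply: le_trans (le_normcB _ _) _; have [_ h1] := hf z zc zS.
  apply: le_trans (lerD h1 hMa) _.
  apply: le_trans (_ : (M + M) / dl * normc (z - a) <= _).
    by rewrite mulrAC ler_pdivlMr // ler_wpM2l ?addr_ge0 // ltW.
  by rewrite ler_wpM2r ?normc_ge0 // /B le_max lexx orbT.
have hphi z : normc z < c -> z \notin a :: S -> hol phi z.
  rewrite in_cons negb_or => zc /andP[za zS]; have [h1 _] := hf z zc zS.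
  apply: (@holM R (fun z => f z - f a) (fun z => z / (z - a))).
    by apply: (@holB R f (fun=> f a)); [exact: h1|exact: hol_cst].
  by apply: (@holM R id (fun z => (z - a)^-1)); [exact: hol_id|exact: holVsub].
have cph s : 0 < s -> s < c -> (forall z, z \in a :: S -> normc z != s) -> circ_cont (fun t => phi (polar s t)).
  move=> s0 sc hs; apply: (@hol_circ_cont R phi _ s0) => z zs.
  apply: hphi; first by rewrite zs.
  by apply/negP => /hs; rewrite zs eqxx.
have Sr' z : z \in a :: S -> normc z != r.
  by rewrite in_cons => /orP[/eqP ->|/Sr //]; rewrite lt_eqF.
have phi0 : cmean r phi = 0.
  have [e0 e00 he0] := seq_gap [seq normc z | z <- a :: S] 0.
  apply: (@small_zero _ (2 * B) (Num.min e0 r)); first by rewrite lt_min e00 r0.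
  move=> e ep; rewrite le_min => /andP[ee er].
  have eS z : z \in a :: S -> normc z != e.
    move=> zS; apply/eqP => ze; have : normc z = 0.
      by apply: he0; [exact: map_f|rewrite subr0 ger0_norm ?normc_ge0 // ze].
    by rewrite ze; lra.
  have -> : cmean r phi = cmean e phi.
    symmetry; apply: (@cmean_const_sing R phi (a :: S) 0 c (B * c) e r (lexx 0) _ ep er rc).
      move=> z /andP[_ zc] zS; split; first exact: hphi.
      by apply: le_trans (phiB z zc zS) _; apply: ler_wpM2l => //; exact: ltW.
    by move=> z zS; split; [exact: eS|exact: Sr'].
  rewrite -mulrA; apply: cmeant_norm_le; first by apply: cph; [exact: ep|exact: le_lt_trans rc|exact: eS].
  move=> t; apply: le_trans (phiB _ _ _) _; rewrite ?normc_polar ?(ltW ep) //; first lra.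
  by apply/negP => /eS; rewrite normc_polar ?(ltW ep) // eqxx.
have ck : circ_cont (fun t => polar r t / (polar r t - a)).
  clear -r0 ar; apply: (@hol_circ_cont R (fun z => z / (z - a)) _ r0) => z zr; apply: holM; first exact: hol_id.
  by apply: holVsub; apply/eqP => za; move: zr ar; rewrite za => ->; rewrite ltxx.
have cp := cph _ r0 rc Sr'; clear hphi cph phiB.
have -> : cmean r (fun z => f z * (z / (z - a))) =
    cmeant (fun t => phi (polar r t) + f a * (polar r t / (polar r t - a))).
  by apply: cmeant_ext => t; rewrite /phi mulrBl subrK.
rewrite (cmeantD cp); last exact: circ_contM (circ_cont_cst _) ck.
rewrite -/(cmean r phi) phi0 add0r (cmeantZ _ ck).
by rewrite -/(cmean r (fun z => z / (z - a))) (cmean_kernel ar) mulr1.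
Qed.

End Cauchy.

(** * Taylor polynomials with a geometric remainder *)

Section Taylor.
Variable R : realType.
Implicit Types (z w x y : R[i]) (f g : R[i] -> R[i]).

Lemma pow_small (k e : R) : 0 <= k -> k < 1 -> 0 < e ->
  exists n0, forall n, (n0 <= n)%N -> k ^+ n <= e.
Proof.
move=> k0 k1 e0.
have hc : (fun n => k ^+ n) @ \oo --> (0 : R) by apply: cvg_expr; rewrite ger0_norm.
have [n0 _ h] := proj1 (cvgrPdist_le _ _) hc e e0.
by exists n0 => n hn; have := h n hn; rewrite /= sub0r normrN ger0_norm // exprn_ge0.
Qed.

Lemma circ_cont_sum n (h : nat -> R -> R[i]) : (forall k, circ_cont (h k)) ->
  circ_cont (fun t => \sum_(k < n) h k t).
Proof.
move=> hc; elim: n => [|n IH].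
  by rewrite (_ : (fun t => _) = fun=> 0); [exact: circ_cont_cst|apply/funext => t; rewrite big_ord0].
by rewrite (_ : (fun t => _) = fun t => \sum_(k < n) h k t + h n t);
  [exact: circ_contD|apply/funext => t; rewrite big_ord_recr].
Qed.

Lemma cmeant_sum n (h : nat -> R -> R[i]) : (forall k, circ_cont (h k)) ->
  cmeant (fun t => \sum_(k < n) h k t) = \sum_(k < n) cmeant (h k).
Proof.
move=> hc; elim: n => [|n IH].
  by rewrite big_ord0 (_ : (fun t => _) = fun=> 0) ?cmeant_cst //; apply/funext => t; rewrite big_ord0.
rewrite (_ : (fun t => _) = fun t => \sum_(k < n) h k t + h n t); last first.
  by apply/funext => t; rewrite big_ord_recr.
by rewrite cmeantD ?IH ?big_ord_recr //; exact: circ_cont_sum.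
Qed.

Definition hol_disc f := forall z, normc z < 1 -> hol f z.
(* By [tcoefE], any radius in (0, 1) gives the same value. *)
Definition tcoef f k : R[i] := cmean (1 / 2) (fun z => f z / z ^+ k).
Definition tpoly f N z : R[i] := \sum_(k < N) tcoef f k * z ^+ k.

Lemma hol_divX f k z : z != 0 -> hol f z -> hol (fun w => f w / w ^+ k) z.
Proof.
move=> z0 hf; apply: (holM hf); apply: (@holV R (fun w => w ^+ k)); first by rewrite expf_neq0.
exact: (@holX R (fun w => w) k z (hol_id z)).
Qed.

Lemma normc_neq0 z : 0 < normc z -> z != 0.
Proof. by rewrite normc_gt0. Qed.

Lemma tcoefE f k (r : R) : hol_disc f -> 0 < r -> r < 1 ->
  cmean r (fun z => f z / z ^+ k) = tcoef f k.
Proof.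
move=> hf r0 r1; have h z : 0 < normc z < 1 -> hol (fun w => f w / w ^+ k) z.
  by move=> /andP[z0 z1]; apply: hol_divX; [exact: normc_neq0|exact: hf].
have [le|/ltW le] := leP r (1 / 2); [|symmetry]; apply: cmean_const => //;
  by [lra|move=> z /andP[h1 h2]; apply: h; apply/andP; split; lra].
Qed.

Lemma tcoef_bound f k (r M : R) : hol_disc f -> 0 < r -> r < 1 ->
  (forall z, normc z = r -> normc (f z) <= M) -> normc (tcoef f k) <= 2 * M / r ^+ k.
Proof.
move=> hf r0 r1 hM; rewrite -(tcoefE k hf r0 r1) -mulrA; apply: cmeant_norm_le.
  apply: (@hol_circ_cont R (fun z => f z / z ^+ k)) => // z zr.
  by apply: hol_divX; [apply: normc_neq0; rewrite zr|apply: hf; rewrite zr].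
move=> t; rewrite normcM normcV normcX normc_polar ?(ltW r0) //.
by rewrite ler_wpM2r ?invr_ge0 ?exprn_ge0 ?(ltW r0) // hM // normc_polar // ltW.
Qed.

Lemma geom_expand (a z : R[i]) N : z != 0 -> z - a != 0 ->
  z / (z - a) = \sum_(k < N) a ^+ k * (z ^+ k)^-1 + (a / z) ^+ N * (z / (z - a)).
Proof.
move=> z0 za; elim: N => [|N IH]; first by rewrite big_ord0 expr0 mul1r add0r.
rewrite {}[LHS]IH big_ord_recr /= -addrA; congr (_ + _).
rewrite exprS (mulrC (a / z)) -mulrA -[a ^+ N / z ^+ N]mulr1 -exprVn -exprMn -mulrDr; congr (_ * _).
by field; rewrite z0 za.
Qed.

(** Cauchy's formula with the kernel expanded as a finite geometric sum in a / z, whose remainder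
    carries (a / z)^N. The factor 2 is that of [cmeant_norm_le]. *)
Lemma tpoly_err f N a (r M : R) : hol_disc f -> normc a < r -> r < 1 ->
  (forall z, normc z <= r -> normc (f z) <= M) ->
  normc (f a - tpoly f N a) <= 2 * M * (normc a / r) ^+ N * (r / (r - normc a)).
Proof.
move=> hf ar r1 hM; have a0 := normc_ge0 a; have r0 : 0 < r by lra.
have c1 : r < (1 + r) / 2 by lra.
have [M' hM'] := @hol_bounded R f ((1 + r) / 2) ltac:(lra) hf.
have pz t : polar r t != 0 by apply: normc_neq0; rewrite normc_polar ?(ltW r0).
have pa t : polar r t - a != 0.
  by apply: normc_neq0; apply: lt_le_trans (normc_sub_ge _ _); rewrite normc_polar ?(ltW r0) // subr_gt0.
have hfc g : (forall z, normc z = r -> hol g z) -> circ_cont (fun t => g (polar r t)) by exact: hol_circ_cont.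
have cf : circ_cont (fun t => f (polar r t)) by apply: hfc => z zr; apply: hf; rewrite zr.
have ck : circ_cont (fun t => polar r t / (polar r t - a)).
  apply: (hfc (fun z => z / (z - a))) => z zr; apply: holM; first exact: hol_id.
  by apply: holVsub; apply/eqP => za; move: zr ar; rewrite za => ->; rewrite ltxx.
have cz k : circ_cont (fun t => f (polar r t) / polar r t ^+ k).
  apply: (hfc (fun z => f z / z ^+ k)) => z zr; apply: hol_divX; last by apply: hf; rewrite zr.
  by apply: normc_neq0; rewrite zr.
have cP : circ_cont (fun t => \sum_(k < N) a ^+ k * (f (polar r t) / polar r t ^+ k)).
  apply: (@circ_cont_sum N (fun k t => a ^+ k * (f (polar r t) / polar r t ^+ k))) => k.
  by apply: circ_contM; [exact: circ_cont_cst|exact: cz].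
have cV : circ_cont (fun t => (polar r t)^-1).
  apply: (hfc (fun z => z^-1)) => z zr; apply: holV; last exact: hol_id.
  by apply: normc_neq0; rewrite zr.
have cX n (g : R -> R[i]) : circ_cont g -> circ_cont (fun t => g t ^+ n).
  move=> hg; elim: n => [|n IH].
    by rewrite (_ : (fun t => _) = fun=> 1); [exact: circ_cont_cst|apply/funext => t; rewrite expr0].
  by rewrite (_ : (fun t => _) = fun t => g t * g t ^+ n); [exact: circ_contM|apply/funext => t; rewrite exprS].
have cE : circ_cont (fun t => f (polar r t) * ((a / polar r t) ^+ N * (polar r t / (polar r t - a)))).
  apply: circ_contM => //; apply: circ_contM => //; apply: cX.
  by apply: circ_contM => //; exact: circ_cont_cst.
have E : f a = \sum_(k < N) a ^+ k * tcoef f k +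
    cmeant (fun t => f (polar r t) * ((a / polar r t) ^+ N * (polar r t / (polar r t - a)))).
  rewrite -(@cauchy_sing R f [::] ((1 + r) / 2) M' r a) //; last first.
    by move=> z zc _; split; [apply: hf; lra|apply: hM'; exact: ltW].
  under eq_bigr => k _ do rewrite -(tcoefE k hf r0 r1).
  rewrite (_ : cmean r _ = cmeant (fun t => \sum_(k < N) a ^+ k * (f (polar r t) / polar r t ^+ k) +
      f (polar r t) * ((a / polar r t) ^+ N * (polar r t / (polar r t - a))))); last first.
    apply: cmeant_ext => t; rewrite [in LHS](geom_expand N (pz t) (pa t)) mulrDr; congr (_ + _).
    by rewrite mulr_sumr; apply: eq_bigr => k _; rewrite mulrCA.
  rewrite cmeantD //; congr (_ + _).
  rewrite (@cmeant_sum N (fun k t => a ^+ k * (f (polar r t) / polar r t ^+ k))); last first.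
    by move=> k; apply: circ_contM; [exact: circ_cont_cst|exact: cz].
  by apply: eq_bigr => k _; rewrite cmeantZ.
have -> : f a - tpoly f N a = cmeant (fun t => f (polar r t) * ((a / polar r t) ^+ N * (polar r t / (polar r t - a)))).
  rewrite E /tpoly; under eq_bigr => k _ do rewrite mulrC.
  by rewrite addrAC subrr add0r.
rewrite -!mulrA; apply: cmeant_norm_le => // t.
rewrite !normcM normcX normcM !normcV normc_polar ?(ltW r0) //.
have r0' := ltW r0; have q0 : 0 <= normc a / r by rewrite divr_ge0.
apply: ler_pM.
- exact: normc_ge0.
- by rewrite mulr_ge0 ?exprn_ge0 // divr_ge0 ?normc_ge0.
- by apply: hM; rewrite normc_polar.
- apply: ler_wpM2l; first exact: exprn_ge0.
  apply: ler_wpM2l => //; rewrite lef_pV2 ?posrE ?subr_gt0 ?normc_gt0 //.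
  by apply: le_trans (normc_sub_ge _ _); rewrite normc_polar.
Qed.

End Taylor.

(** * Blaschke factors and finiteness of the zeros on smaller discs *)

Section Zeros.
Variable R : realType.
Implicit Types (z w x y : R[i]) (f g : R[i] -> R[i]).

Definition blaschke (p : R) w z : R[i] := p%:C * (z - w) / ((p ^+ 2)%:C - conjc w * z).

Lemma normc_sq z : normc z ^+ 2 = Re z ^+ 2 + Im z ^+ 2.
Proof. by case: z => a b /=; rewrite sqr_sqrtr // addr_ge0 // sqr_ge0. Qed.

Lemma blaschke_id (p : R) w z :
  normc ((p ^+ 2)%:C - conjc w * z) ^+ 2 - normc (p%:C * (z - w)) ^+ 2 =
  (p ^+ 2 - normc w ^+ 2) * (p ^+ 2 - normc z ^+ 2).
Proof.
rewrite !normc_sq !(cReB, cImB, cReM, cImM).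
by case: z => a b; case: w => c d /=; ring.
Qed.

Lemma normcJ w : normc (conjc w) = normc w.
Proof. by case: w => a b /=; rewrite sqrrN. Qed.

Lemma blaschke_den (p : R) w z : normc w * normc z < p ^+ 2 ->
  (p ^+ 2)%:C - conjc w * z != 0.
Proof.
move=> h; apply: normc_neq0; apply: lt_le_trans (normc_sub_ge _ _).
by rewrite normcM normc_real ger0_norm ?sqr_ge0 // subr_gt0 normcJ.
Qed.

Lemma mul_lt_sq (p a b : R) : 0 <= a -> a < p -> 0 <= b -> b <= p -> a * b < p ^+ 2.
Proof.
move=> a0 ap b0 bp; apply: le_lt_trans (_ : a * p < _); first exact: ler_wpM2l.
by rewrite expr2 ltr_pM2r // (le_lt_trans a0).
Qed.

Lemma blaschke_circle (p : R) w z : 0 < p -> normc w < p -> normc z = p ->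
  normc (blaschke p w z) = 1.
Proof.
move=> p0 wp zp; have dn : normc ((p ^+ 2)%:C - conjc w * z) != 0.
  by rewrite normc_eq0 blaschke_den // mul_lt_sq ?normc_ge0 // zp.
rewrite /blaschke normcM normcV; apply: (mulIf dn); rewrite divfK // mul1r.
apply/eqP; rewrite -(eqrXn2 (ltn0Sn 1)) ?normc_ge0 //.
by rewrite eq_sym -subr_eq0 blaschke_id zp subrr mulr0.
Qed.

(** By [blaschke_id], one minus the squared modulus is (p^2 - |w|^2)(p^2 - |z|^2) over the squared
    denominator. The numerator is at least (p^2 - r^2)^2, the denominator at most (2 p^2)^2. The
    point is a bound below 1 that is uniform in [w]. *)
Lemma blaschke_le (p r : R) w z : 0 < r -> r < p -> normc w <= r -> normc z <= r ->
  normc (blaschke p w z) <= Num.sqrt (1 - ((p ^+ 2 - r ^+ 2) / (2 * p ^+ 2)) ^+ 2).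
Proof.
move=> r0 rp wr zr; have p0 : 0 < p by exact: lt_trans rp.
have dn : normc ((p ^+ 2)%:C - conjc w * z) != 0.
  by rewrite normc_eq0 blaschke_den // mul_lt_sq ?normc_ge0 // ?(le_lt_trans wr) // (le_trans zr) // ltW.
have dn0 : 0 < normc ((p ^+ 2)%:C - conjc w * z) by rewrite lt_neqAle eq_sym dn normc_ge0.
rewrite -[leLHS]ger0_norm ?normc_ge0 // -sqrtr_sqr ler_wsqrtr //.
rewrite /blaschke normcM normcV expr_div_n ler_pdivrMr ?exprn_gt0 //.
have id := blaschke_id p w z.
have up : normc ((p ^+ 2)%:C - conjc w * z) <= 2 * p ^+ 2.
  apply: le_trans (le_normcB _ _) _; rewrite normcM normc_real ger0_norm ?sqr_ge0 //.
  rewrite normcJ.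
  have : normc w * normc z <= p * p.
    by apply: ler_pM; rewrite ?normc_ge0 // ?(le_trans wr) ?(le_trans zr) // ltW.
  rewrite expr2; lra.
set D := normc (_ - _) in id up dn dn0 *; set E := normc (_ * _) in id *.
have sq (a : R) : 0 <= a -> a <= r -> r ^+ 2 >= a ^+ 2 by move=> a0 ar; rewrite ler_sqr ?nnegrE // ltW.
have w2 := sq _ (normc_ge0 w) wr; have z2 := sq _ (normc_ge0 z) zr.
have pr : 0 <= p ^+ 2 - r ^+ 2 by rewrite subr_ge0 ler_sqr ?nnegrE ?ltW.
have low : (p ^+ 2 - r ^+ 2) ^+ 2 <= (p ^+ 2 - normc w ^+ 2) * (p ^+ 2 - normc z ^+ 2).
  by rewrite expr2; apply: ler_pM => //; rewrite lerB.
have D2 : D ^+ 2 <= (2 * p ^+ 2) ^+ 2 by rewrite ler_sqr ?nnegrE ?normc_ge0 // mulr_ge0 ?sqr_ge0.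
have P0 : 0 < 2 * p ^+ 2 by rewrite mulr_gt0 ?exprn_gt0.
have : ((p ^+ 2 - r ^+ 2) / (2 * p ^+ 2)) ^+ 2 * D ^+ 2 <= (p ^+ 2 - r ^+ 2) ^+ 2.
  rewrite expr_div_n mulrAC ler_pdivrMr ?exprn_gt0 //.
  by rewrite ler_wpM2l ?sqr_ge0.
move=> h; rewrite mulrBl mul1r; lra.
Qed.

Lemma hol_blaschke (p : R) w z : normc w * normc z < p ^+ 2 -> hol (blaschke p w) z.
Proof.
move=> wz; apply: (@holM R (fun z => p%:C * (z - w)) (fun z => ((p ^+ 2)%:C - conjc w * z)^-1)).
  apply: (@holM R (fun=> p%:C) (fun z => z - w)); first exact: hol_cst.
  by apply: (@holB R (fun z => z) (fun=> w)); [exact: hol_id|exact: hol_cst].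
apply: (@holV R (fun z => (p ^+ 2)%:C - conjc w * z)); first exact: blaschke_den.
apply: (@holB R (fun=> (p ^+ 2)%:C) (fun z => conjc w * z)); first exact: hol_cst.
by apply: (@holM R (fun=> conjc w) (fun z => z)); [exact: hol_cst|exact: hol_id].
Qed.

(** Lets the linear factors of [prod_zero_bound] be traded for Blaschke factors. *)
Lemma sub_le_blaschke (p : R) w z : 0 < p -> p < 1 -> normc w <= 1 -> normc z <= 1 ->
  normc w * normc z < p ^+ 2 -> normc (z - w) <= 2 / p * normc (blaschke p w z).
Proof.
move=> p0 p1 w1 z1 wz; have d0 := blaschke_den wz.
have den : normc ((p ^+ 2)%:C - conjc w * z) <= 2.
  apply: le_trans (le_normcB _ _) _; rewrite normcM normcJ normc_real ger0_norm ?sqr_ge0 //.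
  have : p ^+ 2 <= 1 by rewrite expr_le1 // ltW.
  lra.
rewrite /blaschke !normcM normcV normc_real (gtr0_norm p0).
have -> : 2 / p * (p * normc (z - w) / normc ((p ^+ 2)%:C - conjc w * z)) =
    normc (z - w) * (2 / normc ((p ^+ 2)%:C - conjc w * z)).
  by field; rewrite (gt_eqF p0) normc_eq0 d0.
by rewrite ler_peMr ?normc_ge0 // ler_pdivlMr ?mul1r // normc_gt0.
Qed.

Lemma prod_ge_exp (e : R) (S : seq R[i]) (h : R[i] -> R) : 0 <= e ->
  (forall v, v \in S -> e <= h v) -> e ^+ size S <= \prod_(v <- S) h v.
Proof.
move=> e0; elim: S => [|v S IH] hS; first by rewrite big_nil expr0.
rewrite big_cons exprS; apply: ler_pM => //; first exact: exprn_ge0.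
  by apply: hS; rewrite mem_head.
by apply: IH => u uS; apply: hS; rewrite in_cons uS orbT.
Qed.

Lemma prod_le_exp (e : R) (S : seq R[i]) (h : R[i] -> R) : (forall v, 0 <= h v) ->
  (forall v, v \in S -> h v <= e) -> \prod_(v <- S) h v <= e ^+ size S.
Proof.
move=> h0; elim: S => [|v S IH] hS; first by rewrite big_nil expr0.
rewrite big_cons exprS; apply: ler_pM => //; first by apply: prodr_ge0 => u _.
  by apply: hS; rewrite mem_head.
by apply: IH => u uS; apply: hS; rewrite in_cons uS orbT.
Qed.

Lemma lip_zero g (c M : R) w : hol_disc g -> c < 1 -> normc w <= c -> g w = 0 ->
  (forall z, normc z <= c -> normc (g z) <= M) ->
  exists2 L, 0 <= L & forall z, normc z <= c -> normc (g z) <= L * normc (z - w).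
Proof.
move=> hg c1 wc gw hM; have [d hd] := hol_cderiv (hg w (le_lt_trans wc c1)).
have [dl dl0 h] := hd 1 ltr01; have M0 : 0 <= M := le_trans (normc_ge0 _) (hM w wc).
exists (Num.max (1 + normc d) (M / dl)) => [|z zc].
  by rewrite le_max addr_ge0 ?normc_ge0.
have [zw|zw] := leP (normc (z - w)) dl.
  have := h z zw; rewrite gw subr0 mul1r => h1.
  rewrite -[g z](subrK (d * (z - w))); apply: le_trans (le_normcD _ _) _.
  rewrite normcM; apply: le_trans (lerD h1 (lexx _)) _.
  by rewrite -[X in X + _]mul1r -mulrDl ler_wpM2r ?normc_ge0 // le_max lexx.
apply: le_trans (hM z zc) _; apply: le_trans (_ : M / dl * normc (z - w) <= _).
  by rewrite mulrAC ler_pdivlMr // ler_wpM2l // ltW.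
by rewrite ler_wpM2r ?normc_ge0 // le_max lexx orbT.
Qed.

(** Stands in for a factorisation of [g] through its zeros: it makes [g] over a Blaschke product
    bounded off [S], as [cauchy_sing] requires. In the induction, the factor of the new zero [w] is
    bounded below away from [w]; near [w] all the other factors are, and the Lipschitz bound at [w]
    supplies the missing one. *)
Lemma prod_zero_bound g (c : R) (S : seq R[i]) : hol_disc g -> c < 1 -> uniq S ->
  (forall w, w \in S -> normc w <= c /\ g w = 0) ->
  exists2 C : R, 0 <= C & forall z, normc z <= c -> normc (g z) <= C * \prod_(w <- S) normc (z - w).
Proof.
move=> hg c1; have [M hM] := hol_bounded c1 hg.
elim: S => [|w S IH] uS hS.
  exists (Num.max M 0); first by rewrite le_max lexx orbT.
  by move=> z zc; rewrite big_nil mulr1 le_max hM.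
move: uS => /= /andP[wS uS]; have [wc gw] := hS w (mem_head _ _).
have [C C0 hC] := IH uS (fun v vS => hS v (mem_behead (vS : v \in behead (w :: S)))).
have [L L0 hL] := lip_zero hg c1 wc gw hM.
have [d0 d00 hd0] := seq_gap [seq normc (v - w) | v <- S] 0.
have sep v : v \in S -> d0 <= normc (v - w).
  move=> vS; rewrite leNgt; apply/negP => h; have := hd0 (normc (v - w)) (map_f _ vS).
  rewrite subr0 ger0_norm ?normc_ge0 // => /(_ (ltW h))/eqP; rewrite normc_eq0 subr_eq0 => /eqP vw.
  by move: wS; rewrite -vw vS.
pose e := d0 / 2; have e0 : 0 < e by rewrite divr_gt0.
exists (Num.max (C / e) (L / e ^+ size S)) => [|z zc].
  by rewrite le_max divr_ge0 // ltW.
have P0 : 0 <= \prod_(v <- w :: S) normc (z - v).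
  by apply: prodr_ge0 => v _; exact: normc_ge0.
have [zw|zw] := leP (normc (z - w)) e; last first.
  apply: le_trans (_ : C / e * \prod_(v <- w :: S) normc (z - v) <= _); last first.
    by rewrite ler_wpM2r // le_max lexx.
  apply: le_trans (hC z zc) _; rewrite big_cons mulrA ler_wpM2r //.
    by apply: prodr_ge0 => v _; exact: normc_ge0.
  by rewrite mulrAC ler_pdivlMr // ler_wpM2l // ltW.
apply: le_trans (_ : L / e ^+ size S * \prod_(v <- w :: S) normc (z - v) <= _); last first.
  by rewrite ler_wpM2r // le_max lexx orbT.
apply: le_trans (hL z zc) _; rewrite big_cons mulrCA [leLHS]mulrC ler_wpM2l ?normc_ge0 //.
rewrite mulrAC ler_pdivlMr ?exprn_gt0 // ler_wpM2l //.
apply: prod_ge_exp => [|v vS]; first exact: ltW.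
have h1 := sep v vS; have := le_normcD (v - z) (z - w).
have -> : v - z + (z - w) = v - w by ring.
rewrite (normc_distC z v) => h2; rewrite /e in zw *; lra.
Qed.

Lemma prod_le_scaled (e : R) (S : seq R[i]) (h1 h2 : R[i] -> R) : (forall v, 0 <= h1 v) ->
  (forall v, v \in S -> h1 v <= e * h2 v) -> \prod_(v <- S) h1 v <= e ^+ size S * \prod_(v <- S) h2 v.
Proof.
move=> h0; elim: S => [|v S IH] hS; first by rewrite !big_nil expr0 mulr1.
rewrite !big_cons exprS mulrACA; apply: ler_pM => //; first by apply: prodr_ge0 => u _.
  by apply: hS; rewrite mem_head.
by apply: IH => u uS; apply: hS; rewrite in_cons uS orbT.
Qed.

Lemma hol_prod (S : seq R[i]) (h : R[i] -> R[i] -> R[i]) z :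
  (forall v, v \in S -> hol (h v) z) -> hol (fun z => \prod_(v <- S) h v z) z.
Proof.
elim: S => [|v S IH] hS.
  by rewrite (_ : (fun z => _) = fun=> 1); [exact: hol_cst|apply/funext => u; rewrite big_nil].
rewrite (_ : (fun z => _) = fun z => h v z * \prod_(u <- S) h u z); last by apply/funext => u; rewrite big_cons.
apply: holM; first by apply: hS; rewrite mem_head.
by apply: IH => u uS; apply: hS; rewrite in_cons uS orbT.
Qed.

Lemma normc_prod (S : seq R[i]) (h : R[i] -> R[i]) :
  normc (\prod_(v <- S) h v) = \prod_(v <- S) normc (h v).
Proof.
elim: S => [|v S IH]; first by rewrite !big_nil ComplexField.Normc.normc1.
by rewrite !big_cons normcM IH.
Qed.

(* Jensen-type estimate: dividing by the Blaschke product of the zeros does not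
   change the modulus on the circle of radius p, but gains a factor k per zero. *)
Lemma zeros_bound g (r p M k : R) (S : seq R[i]) a : hol_disc g -> 0 < r -> r < p -> p < 1 ->
  (forall z, normc z <= p -> normc (g z) <= M) -> uniq S ->
  (forall w, w \in S -> normc w <= r /\ g w = 0) -> normc a <= r -> a \notin S -> 0 <= k ->
  (forall w z, normc w <= r -> normc z <= r -> normc (blaschke p w z) <= k) ->
  normc (g a) <= 2 * M * (p / (p - r)) * k ^+ size S.
Proof.
move=> hg r0 rp p1 hM uS hS ar aS k0 hk; have p0 : 0 < p by exact: lt_trans rp.
have r1 : r < 1 by exact: lt_trans p1.
(* Larger than [p], so that Cauchy's formula applies on |z| = p, while r c <= p^2 keeps the Blaschke
   denominators nonzero for |z| < c. *)
pose c := Num.min ((1 + p) / 2) (p ^+ 2 / r).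
have pc : p < c.
  rewrite lt_min; apply/andP; split; first by lra.
  by rewrite ltr_pdivlMr // expr2 ltr_pM2l.
have c1 : c < 1 by rewrite gt_min; apply/orP; left; lra.
have cr : r * c <= p ^+ 2.
  have : c <= p ^+ 2 / r by rewrite ge_min lexx orbT.
  by rewrite ler_pdivlMr // mulrC.
have wz w z : w \in S -> normc z < c -> normc w * normc z < p ^+ 2.
  move=> wS zc; have [wr _] := hS w wS; apply: lt_le_trans cr.
  by apply: le_lt_trans (ler_wpM2r (normc_ge0 z) wr) _; rewrite ltr_pM2l.
have S1 w : w \in S -> normc w <= 1 by move=> wS; have [h _] := hS w wS; rewrite (le_trans h) // ltW.
have Sc w : w \in S -> normc w <= c /\ g w = 0.
  by move=> wS; have [h1 h2] := hS w wS; split => //; rewrite (le_trans h1) // ltW // (lt_trans rp).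
have [C C0 hC] := prod_zero_bound hg c1 uS Sc.
pose B z := \prod_(w <- S) blaschke p w z.
have B0 z : z \notin S -> normc z < c -> B z != 0.
  move=> zS zc; rewrite -normc_gt0 /B normc_prod big_seq.
  apply: prodr_gt0 => w wS; rewrite normc_gt0 /blaschke.
  rewrite mulf_neq0 ?invr_eq0 ?blaschke_den ?wz // mulf_neq0 ?subr_eq0 //.
    by apply/eqP => -[/eqP]; rewrite gt_eqF.
  by apply: contra zS => /eqP ->.
have C2 z : z \notin S -> normc z < c -> normc (g z / B z) <= C * (2 / p) ^+ size S.
  move=> zS zc; rewrite normcM normcV ler_pdivrMr ?normc_gt0 ?B0 //.
  apply: le_trans (hC z (ltW zc)) _; rewrite -mulrA ler_wpM2l //.
  rewrite /B normc_prod; apply: prod_le_scaled => [v|v vS]; first exact: normc_ge0.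
  by apply: sub_le_blaschke => //; [exact: S1|exact: ltW (lt_trans zc c1)|exact: wz].
have hB z : normc z < c -> hol B z.
  by move=> zc; apply: hol_prod => v vS; apply: hol_blaschke; exact: wz.
have Sp z : z \in S -> normc z != p.
  by move=> zS; have [h _] := hS z zS; rewrite lt_eqF // (le_lt_trans h).
have ap : normc a < p by exact: le_lt_trans rp.
have := @cauchy_sing R (fun z => g z / B z) S c (C * (2 / p) ^+ size S) p a _ aS ap pc Sp.
move=> /(_ _) E; have {}E : cmean p (fun z => g z / B z * (z / (z - a))) = g a / B a.
  apply: E => z zc zS; split; last exact: C2.
  apply: (@holM R g (fun z => (B z)^-1)); first by apply: hg; exact: lt_trans c1.
  by apply: holV; [exact: B0|exact: hB].
have Ba : normc (B a) <= k ^+ size S.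
  rewrite /B normc_prod; apply: prod_le_exp => [v|v vS]; first exact: normc_ge0.
  by apply: hk => //; have [] := hS v vS.
have Ba0 : B a != 0 by apply: B0 => //; exact: lt_trans pc.
have gB : g a = g a / B a * B a by rewrite divfK.
have M0 : 0 <= M := le_trans (normc_ge0 _) (hM a (ltW ap)).
rewrite gB -E normcM; apply: ler_pM; rewrite ?normc_ge0 // -mulrA.
apply: cmeant_norm_le.
  apply: (@hol_circ_cont R (fun z => g z / B z * (z / (z - a))) _ p0) => z zp.
  have zc : normc z < c by rewrite zp.
  apply: (@holM R (fun z => g z / B z) (fun z => z / (z - a))).
    apply: (@holM R g (fun z => (B z)^-1)); first by apply: hg; exact: lt_trans c1.
    by apply: holV; [apply: B0 => //; apply/negP => /Sp; rewrite zp eqxx|exact: hB].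
  apply: (@holM R (fun z => z) (fun z => (z - a)^-1)); first exact: hol_id.
  by apply: holVsub; apply/eqP => za; move: ap; rewrite -za zp ltxx.
move=> t; have zp : normc (polar p t) = p by rewrite normc_polar // ltW.
rewrite !normcM !normcV zp; apply: ler_pM; rewrite ?mulr_ge0 ?invr_ge0 ?normc_ge0 ?(ltW p0) //.
  have -> : normc (B (polar p t)) = 1.
    rewrite /B normc_prod big_seq big1 // => v vS; apply: blaschke_circle => //.
    by have [h _] := hS v vS; exact: le_lt_trans rp.
  by rewrite invr1 mulr1 hM // zp.
rewrite ler_pM2l // lef_pV2 ?posrE ?subr_gt0 //; last first.
  by rewrite normc_gt0 subr_eq0; apply/eqP => za; move: ap; rewrite -za zp ltxx.
by apply: le_trans (normc_sub_ge _ _); rewrite zp lerB.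
Qed.

(** With n distinct zeros [zeros_bound] gives |g a| <= K k^n, where K and k < 1 do not depend on n;
    arbitrarily many zeros would force g a = 0. *)
Lemma zeros_finite g (r : R) a : hol_disc g -> normc a < 1 -> g a != 0 -> r < 1 ->
  exists S : seq R[i], forall z, normc z <= r -> g z = 0 -> z \in S.
Proof.
move=> hg a1 ga r1; apply: contrapT => no.
pose r' := Num.max (Num.max r (normc a)) (1 / 2).
have r'1 : r' < 1 by rewrite !gt_max r1 a1 /=; lra.
have r'0 : 0 < r' by rewrite !lt_max; apply/orP; right; lra.
have rr : r <= r' by rewrite !le_max lexx.
have ar : normc a <= r' by rewrite !le_max lexx orbT.
have ex n : exists S : seq R[i], [/\ uniq S, size S = n & forall w, w \in S -> normc w <= r' /\ g w = 0].
  elim: n => [|n [S [uS sS hS]]]; first by exists [::].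
  have [z [zr gz zS]] : exists z, [/\ normc z <= r, g z = 0 & z \notin S].
    apply: contrapT => no2; apply: no; exists S => z zr gz; apply: contrapT => /negP zS.
    by apply: no2; exists z.
  exists (z :: S); split => //=; [by rewrite zS uS|by rewrite sS|].
  by move=> w; rewrite in_cons => /orP[/eqP ->|/hS //]; split => //; exact: le_trans rr.
pose p := (1 + r') / 2; have rp : r' < p by rewrite /p; lra.
have p1 : p < 1 by rewrite /p; lra.
have p0 : 0 < p by lra.
have [M hM] := hol_bounded p1 hg.
pose k := Num.sqrt (1 - ((p ^+ 2 - r' ^+ 2) / (2 * p ^+ 2)) ^+ 2).
have x0 : 0 < (p ^+ 2 - r' ^+ 2) / (2 * p ^+ 2).
  apply: divr_gt0; last by apply: mulr_gt0 => //; exact: exprn_gt0.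
  by rewrite subr_gt0 ltr_sqr ?nnegrE // ltW.
have k1 : k < 1.
  rewrite /k -[ltRHS]sqrtr1 ltr_sqrt //; rewrite ltrBlDr ltrDl exprn_gt0 //.
have hk w z : normc w <= r' -> normc z <= r' -> normc (blaschke p w z) <= k by exact: blaschke_le.
pose K := 2 * M * (p / (p - r')).
have M0 : 0 <= M := le_trans (normc_ge0 _) (hM a (le_trans ar (ltW rp))).
have K0 : 0 <= K.
  apply: mulr_ge0; first exact: mulr_ge0.
  by apply: divr_ge0; [exact: ltW|rewrite subr_ge0 ltW].
have g0 : 0 < normc (g a) by rewrite normc_gt0.
have e0 : 0 < normc (g a) / (2 * (K + 1)) by rewrite divr_gt0 // mulr_gt0 // ltr_wpDl.
have [n0 hn0] := pow_small (sqrtr_ge0 _) k1 e0.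
have [S [uS sS hS]] := ex n0.
have aS : a \notin S by apply/negP => /hS[_ /eqP]; rewrite (negbTE ga).
have := @zeros_bound g r' p M k S a hg r'0 rp p1 hM uS hS ar aS (sqrtr_ge0 _) hk.
rewrite sS -/K => h; have := le_trans h (ler_wpM2l K0 (hn0 n0 (leqnn _))).
apply/negP; rewrite -ltNge.
have -> : K * (normc (g a) / (2 * (K + 1))) = normc (g a) * (K / (2 * (K + 1))).
  by field; rewrite gt_eqF // ltr_wpDl.
rewrite gtr_pMr // ltr_pdivrMr ?mul1r ?mulr_gt0 ?ltr_wpDl //; lra.
Qed.

End Zeros.

(** * Positivity of the weighted series *)

Section KernelIdentity.
Variable R : realType.

Lemma kerA_sym n m : kerA R n m = kerA R m n.
Proof. by rewrite /kerA eq_sym minnC distn_natC; case: eqP => [->|]. Qed.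

Lemma kerB_sym n m : kerB R n m = kerB R m n.
Proof. by rewrite /kerB eq_sym distn_natC; case: eqP => [->|]. Qed.

(** The quotient of powers is the change of a Fourier coefficient of [u] between the two circles, so
    two symmetric kernels add up to the nonsymmetric m + 1. *)
Lemma kernel_identity n m :
  kerA R n m + kerB R n m * ((3 / 7) ^+ n / (3 / 7) ^+ m) = m.+1%:R.
Proof.
have c0 k : ((3 / 7 : R) ^+ k) != 0 by rewrite expf_neq0 // mulf_neq0 ?invr_eq0 ?pnatr_eq0.
rewrite /kerA /kerB; case: eqP => [->|/eqP nm].
  by rewrite divff // mulr1 subrK.
have q1 k : (0 < k)%N -> 1 - (9 / 49 : R) ^+ k != 0.
  move=> k0; rewrite subr_eq0 gt_eqF //.
  by rewrite exprn_ilt1; first (by lia); lra.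
have sq k : (3 / 7 : R) ^+ k * (3 / 7) ^+ k = (9 / 49) ^+ k.
  by rewrite -exprMn; congr (_ ^+ _); field.
move: nm; rewrite neq_ltn => /orP[nm|nm].
  have -> : distn_nat n m = (m - n)%N by rewrite /distn_nat; lia.
  rewrite (minn_idPl (ltnW nm)) /beta_coef /t_coef.
  have -> : (3 / 7 : R) ^+ m = (3 / 7) ^+ (m - n) * (3 / 7) ^+ n by rewrite -exprD subnK // ltnW.
  have -> : m.+1%:R = 1 + n%:R + (m - n)%:R :> R.
    by rewrite -addrA -natrD -(natrD _ 1); congr (_%:R); lia.
  have k0 : (0 < m - n)%N by lia.
  have := q1 _ k0; have := c0 (m - n)%N; have := c0 n.
  set C := (3 / 7) ^+ (m - n); set D := (3 / 7) ^+ n; set Q := (9 / 49) ^+ (m - n) => *.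
  by field; apply/and3P; split.
have -> : distn_nat n m = (n - m)%N by rewrite /distn_nat; lia.
rewrite (minn_idPr (ltnW nm)) /beta_coef /t_coef.
have -> : (3 / 7 : R) ^+ n = (3 / 7) ^+ (n - m) * (3 / 7) ^+ m by rewrite -exprD subnK // ltnW.
rewrite mulfK // -[m.+1%:R]natr1 -sq.
have k0 : (0 < n - m)%N by lia.
have := q1 _ k0; rewrite -sq; set C := (3 / 7) ^+ (n - m) => q.
by field.
Qed.

End KernelIdentity.

(** * Hermitian forms weighted by Fourier coefficients *)

Section FormPositivity.
Variable R : realType.
Implicit Types (z w x y : R[i]) (f g u : R[i] -> R[i]).

Lemma polarE (r t : R) : polar r t = r%:C * polar 1 t.
Proof.
by apply/eqP; rewrite eq_complex cReM cImM /=; apply/andP; split; apply/eqP; ring.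
Qed.

Lemma polar1_neq0 (t : R) : polar 1 t != 0.
Proof. by apply: normc_neq0; rewrite normc_polar. Qed.

Lemma conj_polar1 (t : R) : conjc (polar 1 t) = (polar 1 t)^-1.
Proof.
apply: (mulIf (polar1_neq0 t)); rewrite mulVf ?polar1_neq0 //.
apply/eqP; rewrite eq_complex cReM cImM /= !mul1r; apply/andP; split; apply/eqP; last by ring.
by rewrite mulNr opprK -!expr2 cos2Dsin2.
Qed.

Definition hermform (K : nat -> nat -> R) N (y : nat -> R[i]) : R[i] :=
  \sum_(n < N) \sum_(m < N) (K n m)%:C * (y m * conjc (y n)).

Lemma Re_sum n (h : 'I_n -> R[i]) : Re (\sum_(i < n) h i) = \sum_(i < n) Re (h i).
Proof. exact: (big_morph (fun z => Re z) (@cReD R) erefl). Qed.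
Lemma Im_sum n (h : 'I_n -> R[i]) : Im (\sum_(i < n) h i) = \sum_(i < n) Im (h i).
Proof. exact: (big_morph (fun z => Im z) (@cImD R) erefl). Qed.

(** Symmetry makes the imaginary cross terms cancel in pairs. That the value is real is what lets
    [Re u] be factored out under the mean. *)
Lemma hermformE K N (y : nat -> R[i]) : (forall n m, K n m = K m n) ->
  hermform K N y = (qform K N (fun n => Re (y n)) + qform K N (fun n => Im (y n)))%:C.
Proof.
move=> Ks; apply/eqP; rewrite eq_complex; apply/andP; split; apply/eqP => /=.
  rewrite Re_sum /qform -big_split; apply: eq_bigr => n _.
  rewrite Re_sum -big_split; apply: eq_bigr => m _ /=.
  by rewrite !cReM; case: (y n) => a b; case: (y m) => c d /=; ring.
rewrite Im_sum.
pose T n m := K n m * (Im (y m) * Re (y n)).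
transitivity (\sum_(n < N) \sum_(m < N) (T n m - T m n)).
  apply: eq_bigr => n _; rewrite Im_sum; apply: eq_bigr => m _; rewrite /T (Ks m n).
  by rewrite !cImM; case: (y n) => a b; case: (y m) => c d /=; ring.
under eq_bigr => n _ do rewrite sumrB.
by rewrite sumrB [X in _ - X]exchange_big subrr.
Qed.

(** Fourier coefficient of index n - m of [u] on the circle of radius [r]; the quotient of powers
    accommodates both signs of the index. *)
Definition circ_coef u (r : R) n m : R[i] :=
  cmeant (fun t => u (polar r t) * (polar 1 t ^+ m / polar 1 t ^+ n)).

Lemma circ_cont_polar1 (m n : nat) : circ_cont (fun t : R => polar 1 t ^+ m / polar 1 t ^+ n).
Proof.
apply: (@hol_circ_cont R (fun z => z ^+ m / z ^+ n)) => // z z1.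
apply: (@hol_divX R (fun z => z ^+ m)); first by apply: normc_neq0; rewrite z1.
exact: (@holX R (fun z => z) m z (hol_id z)).
Qed.

(* Integrating a nonnegative form against [Re u] over a circle gives the same
   form with its entries weighted by the Fourier coefficients of [u]. *)
Lemma circ_form_ge0 u (r : R) K N (x : nat -> R[i]) :
  circ_cont (fun t => u (polar r t)) -> (forall t, 0 <= Re (u (polar r t))) ->
  (forall n m, K n m = K m n) -> (forall y : nat -> R, 0 <= qform K N y) ->
  0 <= Re (\sum_(n < N) \sum_(m < N) (K n m)%:C * (x m * conjc (x n)) * circ_coef u r n m).
Proof.
move=> cu u0 Ks K0.
have cT n m : circ_cont (fun t => u (polar r t) * (polar 1 t ^+ m / polar 1 t ^+ n)).
  by apply: circ_contM => //; exact: circ_cont_polar1.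
pose k n m := (K n m)%:C * (x m * conjc (x n)).
have cK n m : circ_cont (fun t => k n m * (u (polar r t) * (polar 1 t ^+ m / polar 1 t ^+ n))).
  by apply: circ_contM => //; exact: circ_cont_cst.
have cS n : circ_cont (fun t => \sum_(m < N) k n m * (u (polar r t) * (polar 1 t ^+ m / polar 1 t ^+ n))).
  by apply: (@circ_cont_sum R N (fun m t => k n m * (u (polar r t) * (polar 1 t ^+ m / polar 1 t ^+ n)))).
have -> : \sum_(n < N) \sum_(m < N) (K n m)%:C * (x m * conjc (x n)) * circ_coef u r n m =
    cmeant (fun t => \sum_(n < N) \sum_(m < N) k n m * (u (polar r t) * (polar 1 t ^+ m / polar 1 t ^+ n))).
  rewrite (@cmeant_sum R N (fun n t => \sum_(m < N) k n m * (u (polar r t) * (polar 1 t ^+ m / polar 1 t ^+ n)))) //.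
  apply: eq_bigr => n _.
  rewrite (@cmeant_sum R N (fun m t => k n m * (u (polar r t) * (polar 1 t ^+ m / polar 1 t ^+ n)))) //.
  by apply: eq_bigr => m _; rewrite cmeantZ.
(* The exponentials are absorbed by rotating the vector to x_n e^(int). *)
have E t : \sum_(n < N) \sum_(m < N) k n m * (u (polar r t) * (polar 1 t ^+ m / polar 1 t ^+ n)) =
    u (polar r t) * hermform K N (fun n => x n * polar 1 t ^+ n).
  rewrite /hermform mulr_sumr; apply: eq_bigr => n _; rewrite mulr_sumr; apply: eq_bigr => m _.
  have -> : conjc (x n * polar 1 t ^+ n) = conjc (x n) * (polar 1 t ^+ n)^-1.
    by rewrite rmorphM rmorphXn /= -exprVn -conj_polar1.
  by rewrite /k; ring.
rewrite /cmeant /=; apply: divr_ge0; last by rewrite ltW // pi2_gt0.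
rewrite -[X in X <= _](mul0r (2 * pi - 0)) -segint_cst; last by rewrite ltW // pi2_gt0.
apply: le_segint; first exact: cont_on_cst.
  by have [] := @circ_cont_sum R N (fun n t => \sum_(m < N) k n m * (u (polar r t) * (polar 1 t ^+ m / polar 1 t ^+ n))) cS.
move=> t _; rewrite E hermformE // cReM /= mulr0 subr0 mulr_ge0 //.
by rewrite addr_ge0.
Qed.

End FormPositivity.

Section WeightedForm.
Variable R : realType.
Implicit Types (z w : R[i]) (f g u : R[i] -> R[i]).

(** Both sides are the mean of u(z) z^(m-n), which is bounded on the annulus and holomorphic off
    [S]. *)
Lemma circ_coef_radii u (S : seq R[i]) (c p M r1 r2 : R) n m : 0 < c ->
  (forall z, c < normc z < p -> z \notin S -> hol u z /\ normc (u z) <= M) ->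
  c < r1 -> r1 <= r2 -> r2 < p -> (forall z, z \in S -> normc z != r1 /\ normc z != r2) ->
  (r1 ^+ m / r1 ^+ n)%:C * circ_coef u r1 n m = (r2 ^+ m / r2 ^+ n)%:C * circ_coef u r2 n m.
Proof.
move=> c0 hu cr1 r12 r2p hS; have r10 : 0 < r1 by exact: lt_trans cr1.
have M0 z : c < normc z < p -> z \notin S -> 0 <= M.
  by move=> h1 h2; have [_ h] := hu z h1 h2; exact: le_trans (normc_ge0 _) h.
have cu r : c < r -> r < p -> (forall z, z \in S -> normc z != r) -> circ_cont (fun t => u (polar r t)).
  move=> cr rp hr; apply: (@hol_circ_cont R u) => [|z zr]; first exact: lt_trans cr.
  by apply: (hu z _ _).1; rewrite ?zr ?cr //; apply/negP => /hr; rewrite zr eqxx.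
have E r : c < r -> r < p -> (forall z, z \in S -> normc z != r) ->
    (r ^+ m / r ^+ n)%:C * circ_coef u r n m = cmean r (fun z => u z * (z ^+ m / z ^+ n)).
  move=> cr rp hr; rewrite /circ_coef -cmeantZ; last first.
    by apply: circ_contM; [exact: cu|exact: circ_cont_polar1].
  apply: cmeant_ext => t; rewrite [polar r t]polarE !exprMn invfM.
  rewrite rmorphM /= fmorphV /= !rmorphXn /=; ring.
rewrite (E r1 cr1 (le_lt_trans r12 r2p) (fun z zS => (hS z zS).1)).
rewrite (E r2 (lt_le_trans cr1 r12) r2p (fun z zS => (hS z zS).2)).
apply: (@cmean_const_sing R _ S c p (M * (p ^+ m / c ^+ n)) r1 r2 (ltW c0) _ cr1 r12 r2p hS).
move=> z hz zS; have [h1 h2] := hu z hz zS; case/andP: (hz) => cz zp; split.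
  apply: (@holM R u (fun z => z ^+ m / z ^+ n)); first exact: h1.
  apply: (@hol_divX R (fun z => z ^+ m)); first by apply: normc_neq0; exact: lt_trans cz.
  exact: (@holX R (fun z => z) m z (hol_id z)).
have z0 : 0 < normc z by exact: lt_trans cz.
rewrite !normcM normcV !normcX; apply: ler_pM; [exact: normc_ge0|by rewrite divr_ge0 ?exprn_ge0 // ltW|exact: h2|].
apply: ler_pM; rewrite ?invr_ge0 ?exprn_ge0 ?(ltW z0) //.
  by rewrite lerXn2r ?nnegrE ?(ltW z0) ?(ltW zp) // (le_trans (ltW z0)) // ltW.
by rewrite lef_pV2 ?posrE ?exprn_gt0 // lerXn2r ?nnegrE ?(ltW z0) ?(ltW c0) // ltW.
Qed.

Lemma weighted_form_ge0 u (S : seq R[i]) (c p M r : R) N (x : nat -> R[i]) : 0 < c ->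
  (forall z, c < normc z < p -> z \notin S -> hol u z /\ normc (u z) <= M) ->
  (forall z, c < normc z < p -> 0 <= Re (u z)) ->
  c < 3 / 7 * r -> r < p -> (forall z, z \in S -> normc z != 3 / 7 * r /\ normc z != r) ->
  0 <= Re (\sum_(n < N) \sum_(m < N) m.+1%:R * (x m * conjc (x n)) * circ_coef u r n m).
Proof.
move=> c0 hu u0 cr rp hS.
have r0 : 0 < r by lra.
pose r1 := 3 / 7 * r; have r10 : 0 < r1 by rewrite /r1; lra.
have r1r : r1 <= r by rewrite /r1; lra.
have cr' : c < r by exact: lt_le_trans r1r.
have r1p : r1 < p by exact: le_lt_trans rp.
have cu s : c < s -> s < p -> (forall z, z \in S -> normc z != s) -> circ_cont (fun t => u (polar s t)).
  move=> cs sp hs; apply: (@hol_circ_cont R u) => [|z zs]; first exact: lt_trans cs.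
  by apply: (hu z _ _).1; rewrite ?zs ?cs //; apply/negP => /hs; rewrite zs eqxx.
have pos s : c < s -> s < p -> forall t, 0 <= Re (u (polar s t)).
  by move=> cs sp t; apply: u0; rewrite normc_polar ?cs //; lra.
have hA := @circ_form_ge0 R u r (kerA R) N x (cu r cr' rp (fun z zS => (hS z zS).2)) (pos r cr' rp)
  (kerA_sym R) (kerA_qform_ge0 N).
have hB := @circ_form_ge0 R u r1 (kerB R) N x (cu r1 cr r1p (fun z zS => (hS z zS).1)) (pos r1 cr r1p)
  (kerB_sym R) (kerB_qform_ge0 N).
have := addr_ge0 hA hB; rewrite -cReD -big_split; congr (_ <= Re _).
apply: eq_bigr => n _; rewrite -big_split; apply: eq_bigr => m _ /=.
have c37 k : ((3 / 7 : R) ^+ k) != 0 by rewrite expf_neq0 // mulf_neq0 ?invr_eq0 ?pnatr_eq0.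
have rk k : r ^+ k != 0 by rewrite expf_neq0 // gt_eqF.
have -> : circ_coef u r1 n m = ((3 / 7) ^+ n / (3 / 7) ^+ m)%:C * circ_coef u r n m.
  have := circ_coef_radii n m c0 hu cr r1r rp hS; rewrite -/r1 => h.
  have d1 : (r1 ^+ m / r1 ^+ n)%:C != 0 :> R[i].
    by apply/eqP => -[/eqP]; rewrite mulf_eq0 invr_eq0 !expf_eq0 (gt_eqF r10) !andbF.
  apply: (mulfI d1); rewrite h mulrA -rmorphM /=; congr (_%:C * _).
  rewrite /r1 !exprMn; move: (c37 n) (c37 m) (rk n) (rk m).
  set a := (3 / 7) ^+ n; set b := (3 / 7) ^+ m; set a' := r ^+ n; set b' := r ^+ m => *.
  by field; do ?[apply/andP; split].
rewrite -[m.+1%:R](rmorph_nat (real_complex R)) -(kernel_identity R n m) rmorphD rmorphM /=.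
by ring.
Qed.

End WeightedForm.

Arguments tcoef : simpl never.
Arguments circ_coef : simpl never.
Arguments cmeant : simpl never.

(** * Truncation of the series *)

Section TruncatedForm.
Variable R : realType.
Implicit Types (z w : R[i]) (f g u : R[i] -> R[i]).

Definition comb f g (s : R) z : R[i] := g z + s%:C * f z.

Lemma hol_comb f g s : hol_disc f -> hol_disc g -> hol_disc (comb f g s).
Proof.
move=> hf hg z z1; apply: (@holD R g (fun z => s%:C * f z)); first exact: hg.
by apply: (@holM R (fun=> s%:C) f); [exact: hol_cst|exact: hf].
Qed.

Lemma circ_cont_divX f (r : R) k : hol_disc f -> 0 < r -> r < 1 ->
  circ_cont (fun t => f (polar r t) / polar r t ^+ k).
Proof.
move=> hf r0 r1; apply: (@hol_circ_cont R (fun z => f z / z ^+ k) _ r0) => z zr.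
by apply: hol_divX; [apply: normc_neq0; rewrite zr|apply: hf; rewrite zr].
Qed.

Lemma tcoef_comb f g s k : hol_disc f -> hol_disc g ->
  tcoef (comb f g s) k = tcoef g k + s%:C * tcoef f k.
Proof.
move=> hf hg; have h0 : (0 : R) < 1 / 2 by lra.
have h1 : (1 / 2 : R) < 1 by lra.
have cf := circ_cont_divX k hf h0 h1; have cg := circ_cont_divX k hg h0 h1.
rewrite /tcoef /cmean -(cmeantZ _ cf) -cmeantD //; last by apply: circ_contM => //; exact: circ_cont_cst.
by apply: cmeant_ext => t; rewrite /comb; ring.
Qed.

Lemma normc_sqE z : normc z ^+ 2 = Re (z * conjc z).
Proof. by rewrite normc_sq cReM; case: z => a b /=; ring. Qed.

(** Serves twice: on values it gives Re u >= 0 where |f| <= |g|, on Taylor coefficients it produces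
    the difference of squares to be summed. *)
Lemma Re_comb (a b : R[i]) (t : R) :
  Re ((b + t%:C * a) * conjc (b + (- t)%:C * a)) = normc b ^+ 2 - t ^+ 2 * normc a ^+ 2.
Proof. by rewrite !normc_sq; case: a => ? ?; case: b => ? ? /=; ring. Qed.

Lemma Re_normc_div z w : Re (z / w) = Re (z * conjc w) / normc w ^+ 2.
Proof.
rewrite normc_sq; case: z => a b; case: w => c d /=.
by ring.
Qed.

Lemma geom_sum_le (k : R) N : 0 <= k -> k < 1 -> \sum_(n < N) k ^+ n <= (1 - k)^-1.
Proof.
move=> k0 k1; have h : 0 < 1 - k by rewrite subr_gt0.
rewrite -[leRHS]mul1r ler_pdivlMr //.
suff -> : (\sum_(n < N) k ^+ n) * (1 - k) = 1 - k ^+ N by rewrite gerBl exprn_ge0.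
elim: N => [|N IH]; first by rewrite big_ord0 mul0r expr0 subrr.
by rewrite big_ord_recr /= mulrDl IH exprS; ring.
Qed.

Lemma avoid_radii (L : seq R) (a b : R) : a < b -> exists r, [/\ a < r, r < b & r \notin L].
Proof.
move=> ab; have [d d0 hd] := seq_gap L b.
exists (b - Num.min d ((b - a) / 2)).
have m0 : 0 < Num.min d ((b - a) / 2) by rewrite lt_min d0 divr_gt0 // subr_gt0.
have m1 : Num.min d ((b - a) / 2) <= d by rewrite ge_min lexx.
have m2 : Num.min d ((b - a) / 2) <= (b - a) / 2 by rewrite ge_min lexx orbT.
split; [by lra|by lra|apply/negP => hL; have := hd _ hL].
by rewrite addrAC subrr sub0r normrN gtr0_norm // => /(_ m1); lra.
Qed.

(** Replacing [H] by its Taylor polynomial makes the form finite. The remainder is of order (r/p)^N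
    and affects the n-th coefficient of [F] by a further r^(-n); together with the bound p^(-n) on
    the coefficients of [H] and the weight r^(2n) this leaves (r/p)^n, which is summable. *)
Lemma series_main u (S : seq R[i]) F H (c p Mu MH r : R) : 0 < c -> p < 1 ->
  hol_disc F -> hol_disc H ->
  (forall z, c < normc z < p -> z \notin S -> hol u z /\ normc (u z) <= Mu) ->
  (forall z, c < normc z < p -> 0 <= Re (u z)) ->
  (forall z, c < normc z < p -> F z = u z * H z) ->
  (forall z, normc z <= p -> normc (H z) <= MH) -> 0 <= Mu ->
  (forall z, c < normc z < p -> normc (u z) <= Mu) ->
  c < 3 / 7 * r -> r < p -> (forall z, z \in S -> normc z != 3 / 7 * r /\ normc z != r) ->
  forall N, - (2 * Mu * (2 * MH * (r / p) ^+ N * (p / (p - r))) * (2 * MH) * (1 - r / p)^-1) <=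
    \sum_(n < N) Re (tcoef F n * conjc (tcoef H n)) * r ^+ (2 * n) / n.+1%:R.
Proof.
move=> c0 p1 hF hH hu u0 FuH hMH Mu0 hMu cr rp hS N.
have r0 : 0 < r by lra.
have cr' : c < r by lra.
have p0 : 0 < p by lra.
have r1 : r < 1 by lra.
have MH0 : 0 <= MH.
  by apply: le_trans (normc_ge0 _) (hMH 0 _); rewrite normc0 ltW.
pose E := 2 * MH * (r / p) ^+ N * (p / (p - r)).
have E0 : 0 <= E.
  apply: mulr_ge0; last by rewrite divr_ge0 ?subr_ge0 ?ltW.
  by apply: mulr_ge0; [exact: mulr_ge0|rewrite exprn_ge0 // divr_ge0 // ltW].
have nz t : normc (polar r t) = r by rewrite normc_polar // ltW.
have an t : c < normc (polar r t) < p by rewrite nz cr'.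
have cu : circ_cont (fun t => u (polar r t)).
  apply: (@hol_circ_cont R u _ r0) => z zr.
  by apply: (hu z _ _).1; rewrite ?zr ?cr' //; apply/negP => /hS[_]; rewrite zr eqxx.
pose P := tpoly H N.
have hP : hol_disc P.
  move=> z z1; rewrite /P /tpoly; move: (N) => k0; elim: k0 => [|k IH].
    by rewrite (_ : (fun w => _) = fun=> 0); [exact: hol_cst|apply/funext => w; rewrite big_ord0].
  rewrite (_ : (fun w => _) = fun w => \sum_(j < k) tcoef H j * w ^+ j + tcoef H k * w ^+ k); last first.
    by apply/funext => w; rewrite big_ord_recr.
  apply: (@holD R (fun w => \sum_(j < k) tcoef H j * w ^+ j) (fun w => tcoef H k * w ^+ k)) => //.
  apply: (@holM R (fun=> tcoef H k) (fun w => w ^+ k)); first exact: hol_cst.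
  exact: (@holX R (fun z => z) k z (hol_id z)).
pose Q z := H z - P z.
have hQ : hol_disc Q.
  by move=> z z1; apply: (@holB R H P); [exact: hH|exact: hP].
have QE t : normc (Q (polar r t)) <= E.
  by have := @tpoly_err R H N (polar r t) p MH hH; rewrite nz => /(_ rp p1 hMH).
pose err n := cmeant (fun t => u (polar r t) * (Q (polar r t) / polar r t ^+ n)).
have cQ n := circ_cont_divX n hQ r0 r1.
have errb n : normc (err n) <= 2 * (Mu * (E / r ^+ n)).
  apply: cmeant_norm_le; first by apply: circ_contM.
  move=> t; rewrite normcM; apply: ler_pM; rewrite ?normc_ge0 //; first exact: hMu.
  by rewrite normcM normcV normcX nz ler_wpM2r // invr_ge0 exprn_ge0 // ltW.
have ce n m := circ_cont_polar1 R m n.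
have cc n m : circ_cont (fun t => u (polar r t) * (polar 1 t ^+ m / polar 1 t ^+ n)).
  by apply: circ_contM.
have FE n : tcoef F n = \sum_(m < N) tcoef H m * (r ^+ m / r ^+ n)%:C * circ_coef u r n m + err n.
  rewrite -(tcoefE n hF r0 r1) /cmean.
  have -> : \sum_(m < N) tcoef H m * (r ^+ m / r ^+ n)%:C * circ_coef u r n m =
     cmeant (fun t => \sum_(m < N) (tcoef H m * (r ^+ m / r ^+ n)%:C) * (u (polar r t) * (polar 1 t ^+ m / polar 1 t ^+ n))).
    rewrite (@cmeant_sum R N (fun m t => (tcoef H m * (r ^+ m / r ^+ n)%:C) * (u (polar r t) * (polar 1 t ^+ m / polar 1 t ^+ n)))).
      by apply: eq_bigr => m _; rewrite cmeantZ.
    by move=> m; apply: circ_contM; [exact: circ_cont_cst|exact: cc].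
  rewrite /err -cmeantD; last 2 first.
  - apply: (@circ_cont_sum R N (fun m t => (tcoef H m * (r ^+ m / r ^+ n)%:C) * (u (polar r t) * (polar 1 t ^+ m / polar 1 t ^+ n)))) => m.
    by apply: circ_contM; [exact: circ_cont_cst|exact: cc].
  - by apply: circ_contM.
  apply: cmeant_ext => t; rewrite (FuH _ (an t)).
  have -> : H (polar r t) = P (polar r t) + Q (polar r t) by rewrite /Q addrC subrK.
  rewrite mulrDr mulrDl -mulrA -[X in _ + X]mulrA; congr (_ + _).
  rewrite /P /tpoly mulr_suml mulr_sumr; apply: eq_bigr => m _.
  rewrite [polar r t]polarE !exprMn invfM rmorphM /= fmorphV /= !rmorphXn /=; ring.
(* In this scaling the weight r^(2n) / (n+1) and the factor r^(m-n) combine into (m+1) x_m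
   conj(x_n). *)
pose x n := tcoef H n * (r ^+ n / n.+1%:R)%:C.
have rk k : r ^+ k != 0 by rewrite expf_neq0 // gt_eqF.
have nk k : k.+1%:R != 0 :> R by rewrite pnatr_eq0.
have -> : \sum_(n < N) Re (tcoef F n * conjc (tcoef H n)) * r ^+ (2 * n) / n.+1%:R =
  Re (\sum_(n < N) \sum_(m < N) m.+1%:R * (x m * conjc (x n)) * circ_coef u r n m) +
  \sum_(n < N) Re (err n * conjc (tcoef H n)) * (r ^+ (2 * n) / n.+1%:R).
  suff T (n : nat) : Re (tcoef F n * conjc (tcoef H n)) * r ^+ (2 * n) / n.+1%:R =
      Re (\sum_(m < N) m.+1%:R * (x m * conjc (x n)) * circ_coef u r n m) +
      Re (err n * conjc (tcoef H n)) * (r ^+ (2 * n) / n.+1%:R).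
    under eq_bigr => n _ do rewrite T.
    by rewrite big_split -Re_sum.
  rewrite FE mulrDl cReD -mulrA mulrDl; congr (_ + _).
  have ReZ z (k : R) : Re z * k = Re (k%:C * z) by rewrite cReM /= mul0r subr0 mulrC.
  rewrite ReZ; congr (Re _); rewrite mulr_suml mulr_sumr; apply: eq_bigr => m _.
  have xn : conjc (x n) = conjc (tcoef H n) * (r ^+ n / n.+1%:R)%:C.
    by rewrite /x rmorphM; congr (_ * _); rewrite /= oppr0.
  have e1 : (r ^+ (2 * n) / n.+1%:R)%:C * (r ^+ m / r ^+ n)%:C =
      m.+1%:R * (r ^+ m / m.+1%:R)%:C * (r ^+ n / n.+1%:R)%:C :> R[i].
    rewrite -[m.+1%:R](rmorph_nat (real_complex R)) -!rmorphM; congr (_%:C).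
    rewrite mul2n -addnn exprD; move: (rk n) (rk m) (nk n) (nk m).
    set a := r ^+ n; set b := r ^+ m; set d := n.+1%:R; set e := m.+1%:R => *.
    by field; do ?[apply/andP; split].
  rewrite xn /x; transitivity ((r ^+ (2 * n) / n.+1%:R)%:C * (r ^+ m / r ^+ n)%:C * (tcoef H m * circ_coef u r n m * conjc (tcoef H n))).
    by ring.
  by rewrite e1; ring.
have pos := @weighted_form_ge0 R u S c p Mu r N x c0 hu u0 cr rp hS.
rewrite -[leLHS]add0r; apply: lerD => //.
rewrite lerNl -sumrN; apply: le_trans (_ : \sum_(n < N) (2 * Mu * E * (2 * MH)) * (r / p) ^+ n <= _).
  apply: ler_sum => n _; rewrite -mulNr.
  have hb : normc (tcoef H n) <= 2 * MH / p ^+ n.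
    by apply: (tcoef_bound n hH p0 p1) => z zp; apply: hMH; rewrite zp.
  have h1 : - Re (err n * conjc (tcoef H n)) <= 2 * (Mu * (E / r ^+ n)) * (2 * MH / p ^+ n).
    apply: le_trans (ler_norm _) _; rewrite normrN; apply: le_trans (le_Re_normc _) _.
    by rewrite normcM normcJ; apply: ler_pM; rewrite ?normc_ge0.
  have w0 : 0 <= r ^+ (2 * n) / n.+1%:R by rewrite divr_ge0 // exprn_ge0 // ltW.
  apply: le_trans (ler_wpM2r w0 h1) _.
  have B0 : 0 <= 2 * (Mu * (E / r ^+ n)) * (2 * MH / p ^+ n).
    have rn : 0 <= r ^+ n by rewrite exprn_ge0 // ltW.
    have pn : 0 <= p ^+ n by rewrite exprn_ge0 // ltW.
    apply: mulr_ge0; last by apply: divr_ge0 => //; exact: mulr_ge0.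
    by apply: mulr_ge0 => //; apply: mulr_ge0 => //; exact: divr_ge0.
  have w1 : r ^+ (2 * n) / n.+1%:R <= r ^+ (2 * n).
    rewrite ler_pdivrMr //; apply: ler_peMr; first by rewrite exprn_ge0 // ltW.
    by rewrite ler1n.
  apply: le_trans (ler_wpM2l B0 w1) _; rewrite le_eqVlt; apply/orP; left; apply/eqP.
  have pk : p ^+ n != 0 by rewrite expf_neq0 // gt_eqF.
  rewrite mul2n -addnn exprD expr_div_n; move: pk (rk n).
  by set a := r ^+ n; set b := p ^+ n => *; field; do ?[apply/andP; split].
rewrite -mulr_sumr; apply: ler_wpM2l.
  by apply: mulr_ge0; [apply: mulr_ge0 => //; exact: mulr_ge0|exact: mulr_ge0].
by apply: geom_sum_le; [rewrite divr_ge0 // ltW|rewrite ltr_pdivrMr // mul1r].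
Qed.

End TruncatedForm.

Section SeriesInequality.
Variable R : realType.
Implicit Types (z w : R[i]) (f g u : R[i] -> R[i]).

Lemma series_ineq f g (t c eta : R) a0 : hol_disc f -> hol_disc g ->
  0 <= t -> t < 1 -> 0 < c -> c < 3 / 7 * eta -> eta < 1 ->
  (forall z, c < normc z < 1 -> normc (f z) <= normc (g z)) ->
  normc a0 < 1 -> g a0 != 0 ->
  exists r, [/\ eta < r, r < 1 & forall e, 0 < e -> exists N0, forall N, (N0 <= N)%N ->
    - e <= \sum_(n < N) (normc (tcoef g n) ^+ 2 - t ^+ 2 * normc (tcoef f n) ^+ 2) *
       r ^+ (2 * n) / n.+1%:R].
Proof.
move=> hf hg t0 t1 c0 ceta eta1 fg a01 ga0.
have eta0 : 0 < eta by lra.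
pose p := (1 + eta) / 2; have [ep p1] : eta < p /\ p < 1 by rewrite /p; split; lra.
have [S hS0] := zeros_finite hg a01 ga0 p1.
(* Both [r] and [3 / 7 * r] have to avoid the moduli of the zeros, hence the second list. *)
have [r [er rp rL]] := avoid_radii ([seq normc z | z <- S] ++ [seq 7 / 3 * normc z | z <- S]) ep.
have r0 : 0 < r by lra.
have p0 : 0 < p by lra.
have hS z : z \in S -> normc z != 3 / 7 * r /\ normc z != r.
  move=> zS; move: rL; rewrite mem_cat negb_or => /andP[n1 n2]; split; apply/eqP => zE.
    apply: (negP n2); apply/mapP; exists z; first exact: zS.
    by rewrite zE; field.
  by apply: (negP n1); rewrite -zE; exact: map_f.
exists r; split => //; first exact: lt_trans p1.
pose F := comb f g t; pose H := comb f g (- t).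
have hF : hol_disc F by exact: hol_comb.
have hH : hol_disc H by exact: hol_comb.
pose u z := F z / H z.
have ann z : c < normc z < p -> c < normc z < 1.
  by move=> /andP[-> h]; exact: lt_trans p1.
have tf z : c < normc z < p -> normc (t%:C * f z) <= t * normc (g z).
  by move=> hz; rewrite normcM normc_real ger0_norm // ler_wpM2l // fg // ann.
have Flow z : c < normc z < p -> normc (F z) <= (1 + t) * normc (g z).
  move=> hz; apply: le_trans (le_normcD _ _) _; rewrite mulrDl mul1r lerD2l; exact: tf.
have Hlow z : c < normc z < p -> (1 - t) * normc (g z) <= normc (H z).
  move=> hz; rewrite mulrBl mul1r; have := normc_sub_ge (g z) (t%:C * f z).
  have -> : H z = g z - t%:C * f z by rewrite /H /comb rmorphN mulNr.
  have := tf z hz; lra.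
have t1' : 0 < 1 - t by lra.
have H0 z : c < normc z < p -> H z = 0 -> g z = 0.
  move=> hz Hz; have := Hlow z hz; rewrite Hz normc0 pmulr_rle0 // => h.
  by apply/eqP; rewrite -normc_eq0; apply/eqP/le_anti; rewrite h normc_ge0.
have F0 z : c < normc z < p -> g z = 0 -> F z = 0.
  move=> hz gz; have := Flow z hz; rewrite gz normc0 mulr0 => h.
  by apply/eqP; rewrite -normc_eq0; apply/eqP/le_anti; rewrite h normc_ge0.
(* A zero of [H] is a zero of [g], hence of [F]. There the quotient [u] takes the default value 0,
   so this equation, the bound and Re u >= 0 hold on the whole annulus. *)
have FuH z : c < normc z < p -> F z = u z * H z.
  move=> hz; rewrite /u; have [Hz|Hz] := eqVneq (H z) 0; last by rewrite divfK.
  by rewrite Hz mulr0 F0 // H0.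
have uM z : c < normc z < p -> normc (u z) <= (1 + t) / (1 - t).
  move=> hz; rewrite /u; have [Hz|Hz] := eqVneq (H z) 0.
    by rewrite Hz invr0 mulr0 normc0; apply: divr_ge0; lra.
  rewrite normcM normcV ler_pdivrMr; last by rewrite normc_gt0.
  apply: le_trans (Flow z hz) _; rewrite -mulrA; apply: ler_wpM2l; first lra.
  by rewrite mulrC ler_pdivlMr // mulrC; exact: Hlow.
have uR z : c < normc z < p -> 0 <= Re (u z).
  move=> hz; rewrite /u Re_normc_div divr_ge0 ?sqr_ge0 // /F /H Re_comb subr_ge0.
  have h1 : normc (f z) <= normc (g z) by apply: fg; exact: ann.
  have h2 : normc (f z) ^+ 2 <= normc (g z) ^+ 2 by rewrite ler_sqr // nnegrE normc_ge0.
  apply: le_trans h2; apply: ler_piMl; first exact: sqr_ge0.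
  by rewrite expr_le1 // ltW.
have hu z : c < normc z < p -> z \notin S -> hol u z /\ normc (u z) <= (1 + t) / (1 - t).
  move=> hz zS; split; last exact: uM.
  have z1 : normc z < 1 by case/andP: (ann z hz).
  apply: (@holM R F (fun z => (H z)^-1)); first exact: hF.
  apply: holV; last exact: hH.
  apply: contra zS => /eqP Hz; apply: hS0; last exact: H0.
  by case/andP: hz => _ /ltW.
have [MH hMH] := hol_bounded p1 hH.
have Mu0 : 0 <= (1 + t) / (1 - t) by apply: divr_ge0; lra.
have cr : c < 3 / 7 * r by lra.
have main := @series_main R u S F H c p _ MH r c0 p1 hF hH hu uR FuH hMH Mu0 uM cr rp hS.
have termE (n : nat) : normc (tcoef g n) ^+ 2 - t ^+ 2 * normc (tcoef f n) ^+ 2 =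
    Re (tcoef F n * conjc (tcoef H n)).
  by rewrite /F /H !tcoef_comb // Re_comb.
move=> e e0.
set Mu := (1 + t) / (1 - t) in main Mu0.
pose K := 2 * Mu * (2 * MH * (p / (p - r))) * (2 * MH) * (1 - r / p)^-1.
have K1 : 0 < `|K| + 1 by rewrite ltr_wpDl.
have rp1 : r / p < 1 by rewrite ltr_pdivrMr // mul1r.
have rp0 : 0 <= r / p by rewrite divr_ge0 // ltW.
have [N0 hN0] := pow_small rp0 rp1 (divr_gt0 e0 K1).
exists N0 => N hN; under eq_bigr => n _ do rewrite termE.
apply: le_trans (main N); rewrite lerN2.
have -> : 2 * Mu * (2 * MH * (r / p) ^+ N * (p / (p - r))) * (2 * MH) / (1 - r / p) = K * (r / p) ^+ N.
  by rewrite /K; ring.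
apply: le_trans (ler_norm _) _; rewrite normrM (ger0_norm (exprn_ge0 _ rp0)).
apply: le_trans (ler_wpM2l (normr_ge0 K) (hN0 N hN)) _.
by rewrite mulrCA ler_piMr ?(ltW e0) // ler_pdivrMr // mul1r lerDl.
Qed.

End SeriesInequality.

(** * Area integrals over discs *)

Section DiskFubini.
Variable R : realType.
Local Notation mu := (@lebesgue_measure R).
Local Notation mu2 := (@lebesgue_measure R \x @lebesgue_measure R)%E.

Local Notation mR := (measurableTypeR R).
Local Notation plane := (mR * mR)%type.

Lemma mfst : measurable_fun [set: plane] (fst : plane -> R).
Proof. exact: measurable_fst. Qed.
Lemma msnd : measurable_fun [set: plane] (snd : plane -> R).
Proof. exact: measurable_snd. Qed.

Definition disk (r : R) : set plane := [set p | p.1 ^+ 2 + p.2 ^+ 2 < r ^+ 2].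

Lemma measurable_disk r : measurable (disk r).
Proof.
have mf : measurable_fun [set: plane] (fun p : plane => p.1 ^+ 2 + p.2 ^+ 2).
  by apply: measurable_funD; apply: measurable_funX; [exact: mfst|exact: msnd].
have := mf measurableT `]-oo, (r ^+ 2)[%classic (measurable_itv _).
by rewrite setTI; congr measurable; apply/seteqP; split => p /=; rewrite in_itv.
Qed.

Lemma disk_finite r : (mu2 (disk r) < +oo)%E.
Proof.
have sub : disk r `<=` `[- `|r|, `|r|]%classic `*` `[- `|r|, `|r|]%classic.
  move=> [x y]; rewrite /disk /= !in_itv /= => h.
  have hr : r ^+ 2 = `|r| ^+ 2 by rewrite real_normK // num_real.
  have sq z : z ^+ 2 <= `|r| ^+ 2 -> - `|r| <= z <= `|r|.
    by move=> hz; rewrite -ler_norml -ler_sqr ?nnegrE // (real_normK (num_real z)).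
  by split; apply: sq; rewrite -hr; have := sqr_ge0 x; have := sqr_ge0 y; lra.
have mI : measurable (`[- `|r|, `|r|]%classic : set R) by exact: measurable_itv.
pose I : set R := `[- `|r|, `|r|]%classic.
apply: (@le_lt_trans _ _ (mu2 (I `*` I))).
  by apply: le_measure => //; rewrite inE; [exact: measurable_disk|exact: measurableX].
have fI : (mu I < +oo)%E.
  by rewrite lebesgue_measure_itv /=; case: ifP => _; rewrite -?EFinB ?ltry.
have gI : (0 <= mu I)%E by exact: measure_ge0.
rewrite product_measure1E //; apply: lte_mul_pinfty; [exact: gI| |exact: fI].
by change (mu I \is a fin_num); rewrite ge0_fin_numE.
Qed.

Lemma disk_integrable r (phi : plane -> R) (M : R) : measurable_fun (disk r) phi ->
  (forall p, disk r p -> `|phi p| <= M) -> mu2.-integrable (disk r) (EFin \o phi).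
Proof.
move=> mphi hM; apply: measurable_bounded_integrable => //; [exact: measurable_disk|exact: disk_finite|].
by exists M; split; [exact: num_real|move=> x Mx p /hM h /=; exact: le_trans h (ltW Mx)].
Qed.

(** With a primitive [G] in x, the inner integral over each horizontal chord is the difference of
    [G] at its ends, and the area integral becomes a single integral in y. *)
Lemma disk_fubini (r : R) (phi : plane -> R) (G : R -> R -> R) (M : R) : 0 < r ->
  measurable_fun [set: plane] phi -> (forall p, disk r p -> `|phi p| <= M) ->
  (forall x y : R, is_derive x 1 (fun x : R => G x y) (phi (x, y))) ->
  (forall y : R, continuous (fun x : R => phi (x, y))) ->
  (\int[mu2]_(p in disk r) (phi p)%:E =
   \int[mu]_(y in `[(- r)%R, r])
     (G (Num.sqrt (r ^+ 2 - y ^+ 2)) y - G (- Num.sqrt (r ^+ 2 - y ^+ 2)) y)%R%:E)%E.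
Proof.
move=> r0 mphi hM dG cphi.
have iphi : mu2.-integrable (disk r) (EFin \o phi).
  by apply: disk_integrable hM; exact: measurable_funTS.
have md := measurable_disk r.
rewrite integral_mkcond -integral21_prod_meas1; last first.
  exact: (proj1 (integrable_mkcond (EFin \o phi) md) iphi).
rewrite [RHS]integral_mkcond; apply: eq_integral => y _.
rewrite patchE mem_setE in_itv /=.
have [yr|ry] := ltP (y ^+ 2) (r ^+ 2); last first.
  rewrite /fubini_G integral0_eq => [|x _]; last first.
    rewrite patchE ifF //; apply/negbTE; rewrite notin_setE /disk /= => h.
    by have := sqr_ge0 x; lra.
  (* [Num.sqrt] is 0 on nonpositive arguments, so the right-hand integrand vanishes at y = r and y =
     -r, where the chord is empty. *)
  by case: ifP => // _; rewrite ler0_sqrtr ?subr_le0 // oppr0 subrr.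
have -> : - r <= y <= r.
  by rewrite -ler_norml -ler_sqr ?nnegrE ?(ltW r0) // real_normK ?num_real // ltW.
set s := Num.sqrt _.
have s0 : 0 < s by rewrite sqrtr_gt0 subr_gt0.
have s2 : s ^+ 2 = r ^+ 2 - y ^+ 2 by rewrite sqr_sqrtr // subr_ge0 ltW.
have dP x : (x, y) \in disk r = (x \in `]- s, s[).
  rewrite in_itv /= -ltr_norml -ltr_sqr ?nnegrE ?(ltW s0) // real_normK ?num_real // s2.
  by rewrite ltrBrDr; apply/idP/idP => [/set_mem //|h]; apply/mem_set.
transitivity (\int[mu]_(x in `](- s)%R, s[) (phi (x, y))%:E)%E.
  rewrite /fubini_G [RHS]integral_mkcond; apply: eq_integral => x _.
  by rewrite !patchE dP mem_setE.
have mphiy : measurable_fun setT (fun x : mR => phi (x, y)).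
  by apply: measurableT_comp mphi _; exact: pair2_measurable.
rewrite -(@integral_itv_bndoo _ (- s) s _ true false); last first.
  by apply/measurable_EFinP; exact: measurable_funTS.
rewrite (@continuous_FTC2 _ (fun x => phi (x, y)) (fun x => G x y)) //.
- by rewrite gtrN.
- exact: continuous_subspaceT.
- have cG x : {for x, continuous (fun x => G x y)}.
    by apply: differentiable_continuous; apply/derivable1_diffP; case: (dG x y).
  split; first by move=> x _; case: (dG x y).
    by apply: cvg_at_right_filter; exact: cG.
  by apply: cvg_at_left_filter; exact: cG.
- by move=> x _; rewrite derive1E; case: (dG x y).
Qed.

End DiskFubini.

(** * Integrals of monomials in z and its conjugate *)

Section Monomials.
Variable R : realType.
Implicit Types (w z : R[i]).

Definition gform w a b z : R := Re (w * z ^+ a * conjc z ^+ b).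

(** [gform] is a real polynomial in the two coordinates; one induction serves both continuity and
    measurability. *)
Lemma gform_closed (T : Type) (P : (T -> R) -> Prop) w a b (X Y : T -> R) :
  (forall k, P (fun=> k)) -> (forall f g, P f -> P g -> P (fun t => f t + g t)) ->
  (forall f g, P f -> P g -> P (fun t => f t * g t)) ->
  P X -> P Y -> P (fun t => gform w a b (X t +i* Y t)).
Proof.
move=> Pc Pd Pm PX PY.
pose Q (h : T -> R[i]) := P (fun t => Re (h t)) /\ P (fun t => Im (h t)).
have PN f : P f -> P (fun t => - f t).
  move=> Pf; have := Pm _ _ (Pc (-1)) Pf.
  by congr P; apply/funext => t; rewrite mulN1r.
have QM h k : Q h -> Q k -> Q (fun t => h t * k t).
  move=> [h1 h2] [k1 k2]; split.
    have := Pd _ _ (Pm _ _ h1 k1) (PN _ (Pm _ _ h2 k2)).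
    by congr P; apply/funext => t; rewrite cReM.
  have := Pd _ _ (Pm _ _ h1 k2) (Pm _ _ h2 k1).
  by congr P; apply/funext => t; rewrite cImM.
have Qc k : Q (fun=> k) by split; exact: Pc.
have QX h n : Q h -> Q (fun t => h t ^+ n).
  move=> Qh; elim: n => [|n IH]; first exact: Qc.
  by have := QM _ _ Qh IH; congr Q; apply/funext => t; rewrite exprS.
have Qz : Q (fun t => X t +i* Y t) by split.
have Qzb : Q (fun t => conjc (X t +i* Y t)) by split => //=; exact: PN.
by case: (QM _ _ (QM _ _ (Qc w) (QX _ a Qz)) (QX _ b Qzb)).
Qed.

Definition cder (h : R -> R[i]) d (x : R) :=
  is_derive x 1 (fun t : R => Re (h t)) (Re d) /\ is_derive x 1 (fun t : R => Im (h t)) (Im d).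

Lemma cder_cst k x : cder (fun=> k) 0 x.
Proof. by split; exact: is_derive_cst. Qed.

Lemma cderM h k d e x : cder h d x -> cder k e x ->
  cder (fun t => h t * k t) (d * k x + h x * e) x.
Proof.
move=> [h1 h2] [k1 k2]; split.
  have -> : (fun t => Re (h t * k t)) = (fun t => Re (h t)) * (fun t => Re (k t)) - (fun t => Im (h t)) * (fun t => Im (k t)).
    by apply/funext => t; rewrite cReM.
  apply: is_derive_eq; rewrite cReD !cReM /GRing.scale /=; ring.
have -> : (fun t => Im (h t * k t)) = (fun t => Re (h t)) * (fun t => Im (k t)) + (fun t => Im (h t)) * (fun t => Re (k t)).
  by apply/funext => t; rewrite cImM.
apply: is_derive_eq; rewrite cImD !cImM /GRing.scale /=; ring.
Qed.

Lemma cderX h d x n : cder h d x -> cder (fun t => h t ^+ n) (n%:R * h x ^+ n.-1 * d) x.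
Proof.
move=> hd; elim: n => [|n IH]; first by rewrite mul0r mul0r; exact: cder_cst.
have := cderM hd IH.
have -> : (fun t => h t * h t ^+ n) = (fun t => h t ^+ n.+1) by apply/funext => t; rewrite exprS.
congr cder; case: n {IH} => [|n]; rewrite /= ?expr0 ?mul0r ?mulr0 ?addr0 ?mulr1 ?mul1r //.
by rewrite -[in RHS]natr1 exprS; ring.
Qed.

(** Both z and its conjugate have x-derivative 1. At exponent 0 the truncated predecessor is
    harmless, being multiplied by 0. *)
Lemma gform_derive w a b (x y : R) :
  is_derive x 1 (fun t : R => gform w a b (t +i* y))
    (a%:R * gform w a.-1 b (x +i* y) + b%:R * gform w a b.-1 (x +i* y)).
Proof.
have dz (v : R) : cder (fun t => t +i* v) 1 x.
  split => /=; [exact: is_derive_id|exact: is_derive_cst].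
have := cderM (cderM (cder_cst w x) (cderX a (dz y))) (cderX b (dz (- y))).
move=> [h _]; move: h; congr (is_derive _ _ _ _).
have natRe (n : nat) z : Re (n%:R * z) = n%:R * Re z.
  by rewrite -(rmorph_nat (real_complex R)) cReM /= mul0r subr0.
rewrite /gform -!natRe -[RHS]cReD; apply: (congr1 (@complex.Re R)).
by rewrite mul0r add0r !mulr1; ring.
Qed.

End Monomials.

Section Angular.
Variable R : realType.
Local Notation mu := (@lebesgue_measure R).
Implicit Types (w z : R[i]).

Lemma polarX (r t : R) n : polar r t ^+ n = polar (r ^+ n) (n%:R * t).
Proof.
elim: n => [|n IH]; first by rewrite !expr0 mul0r polar1.
by rewrite exprS IH polarM exprS -natr1; congr polar; ring.
Qed.

Lemma conj_polar (r t : R) : conjc (polar r t) = polar r (- t).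
Proof. by rewrite /polar cosN sinN mulrN. Qed.

(** The real part of w e^(ikt). *)
Definition fourier w (k t : R) : R := Re w * cos (k * t) - Im w * sin (k * t).

Lemma gform_polar w a b (r t : R) :
  gform w a b (polar r t) = r ^+ (a + b) * fourier w (a%:R - b%:R) t.
Proof.
rewrite /gform conj_polar !polarX -mulrA polarM -exprD cReM /=.
rewrite (_ : a%:R * t + b%:R * - t = (a%:R - b%:R) * t); last by ring.
by rewrite /fourier; ring.
Qed.

Definition fourier_primitive w (j t : R) : R :=
  if j == 0 then Re w * t else (Re w * sin (j * t) + Im w * cos (j * t)) / j.

Lemma fourier_primitive_derive w (j t : R) : is_derive t 1 (fourier_primitive w j) (fourier w j t).
Proof.
have [->|j0] := eqVneq j 0.
  have -> : fourier_primitive w 0 = (fun t => Re w * t) by apply/funext => u; rewrite /fourier_primitive eqxx.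
  rewrite /fourier mul0r cos0 sin0 mulr0 subr0 mulr1.
  by apply: is_derive_eq; rewrite /GRing.scale /= mulr1.
have -> : fourier_primitive w j = (fun t => (Re w * sin (j * t) + Im w * cos (j * t)) * j^-1).
  by apply/funext => u; rewrite /fourier_primitive (negbTE j0).
apply: is_derive_eq; rewrite /fourier /GRing.scale /=.
by field.
Qed.

Lemma trig_periodic (c d : nat) (t : R) : let j := c%:R - d%:R in
  cos (j * (t + 2 * pi)) = cos (j * t) /\ sin (j * (t + 2 * pi)) = sin (j * t).
Proof.
move=> j; have -> : j * (t + 2 * pi) = j * t - (pi *+ 2) *+ d + (pi *+ 2) *+ c.
  by rewrite /j -(mulr_natr (pi *+ 2) d) -(mulr_natr (pi *+ 2) c) -(mulr_natr pi 2); ring.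
have per (f : R -> R) : periodic f (pi *+ 2) -> forall u, f (u - (pi *+ 2) *+ d + (pi *+ 2) *+ c) = f u.
  by move=> pf u; rewrite periodicn // -(periodicn pf d) subrK.
by rewrite (per cos (@cosD2pi R)) (per sin (@sinD2pi R)).
Qed.

Lemma fourier_primitive_shift w (c d : nat) (t : R) :
  fourier_primitive w (c%:R - d%:R) (t + 2 * pi) - fourier_primitive w (c%:R - d%:R) t = (c == d)%:R * Re w * (2 * pi).
Proof.
have [cE sE] := trig_periodic c d t.
rewrite /fourier_primitive subr_eq0 eqr_nat; case: eqVneq => _; first by rewrite mulr1n; ring.
by rewrite cE sE mulr0n; ring.
Qed.

(** The factor cos t of dy shifts the frequency by one in both directions; this is the source of the
    cases a+1 = b and a = b+1. *)
Lemma fourier_cos w (k t : R) :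
  (fourier w (k + 1) t + fourier w (k - 1) t) / 2 = fourier w k t * cos t.
Proof.
rewrite /fourier !mulrDl mulN1r mul1r cosD cosB sinD sinB.
by field.
Qed.

Lemma gform_continuous w a b (X Y : R -> R) : continuous X -> continuous Y ->
  continuous (fun t => gform w a b (X t +i* Y t)).
Proof.
move=> cX cY; apply: (@gform_closed R R (fun f => continuous f)) => // [k|f g cf cg|f g cf cg] t.
- exact: cvg_cst.
- by apply: cvgD; [exact: cf|exact: cg].
- by apply: cvgM; [exact: cf|exact: cg].
Qed.

(* The right half circle and its mirror image [t -> pi - t] close up to a full
   period, which only the constant Fourier modes survive. *)
Lemma half_circle_integral w (a b : nat) (r : R) :
  (\int[mu]_(t in `[(- (pi / 2))%R, (pi / 2)%R])
     ((gform w a b (polar r t) - gform w a b (polar r (pi - t))) * (r * cos t))%R%:E =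
   (((a.+1 == b) || (a == b.+1))%:R * Re w * pi * r ^+ (a + b).+1)%R%:E)%E.
Proof.
pose k : R := a%:R - b%:R.
pose Psi (t : R) := (fourier_primitive w (k + 1) t + fourier_primitive w (k - 1) t) / 2.
have dPsi (t : R) : is_derive t 1 Psi (fourier w k t * cos t).
  have h1 := fourier_primitive_derive w (k + 1) t; have h2 := fourier_primitive_derive w (k - 1) t.
  have -> : Psi = (fun t => (fourier_primitive w (k + 1) t + fourier_primitive w (k - 1) t) * 2^-1) by [].
  apply: is_derive_eq; rewrite /GRing.scale /= -fourier_cos; ring.
(* As cos(pi - t) = - cos t, the mirrored term is again an exact derivative, and between the end
   points [F] increases by the change of [Psi] over a full period. *)
pose F (t : R) := r ^+ (a + b).+1 * (Psi t - Psi (pi - t)).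
have dF (t : R) : is_derive t 1 F
    ((gform w a b (polar r t) - gform w a b (polar r (pi - t))) * (r * cos t)).
  have h1 := dPsi t; have h2 := dPsi (pi - t).
  have h3 : is_derive t 1 (fun t : R => Psi (pi - t)) (- (fourier w k (pi - t) * cos (pi - t))).
    apply: is_derive_eq; rewrite /GRing.scale /=; ring.
  rewrite /F; apply: is_derive_eq; rewrite !gform_polar -/k /GRing.scale /= exprS.
  have -> : cos (pi - t) = - cos t by rewrite cosB cospi sinpi; ring.
  by ring.
have cF (t : R) : {for t, continuous F}.
  by apply: differentiable_continuous; apply/derivable1_diffP; case: (dF t).
have pi0 := @pi_gt0 R.
rewrite (@continuous_FTC2 _ _ F) //.
- rewrite -EFinB; congr EFin; rewrite /F.
  have -> : pi - pi / 2 = pi / 2 :> R by lra.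
  have -> : pi - - (pi / 2) = - (pi / 2) + 2 * pi :> R by lra.
  have h1 := fourier_primitive_shift w a.+1 b (- (pi / 2)).
  have h2 := fourier_primitive_shift w a b.+1 (- (pi / 2)).
  move: h1 h2; rewrite -!natr1.
  rewrite (_ : a%:R + 1 - b%:R = k + 1); last by rewrite /k; ring.
  rewrite (_ : a%:R - (b%:R + 1) = k - 1); last by rewrite /k; ring.
  move=> /(canRL (subrK _)) h1 /(canRL (subrK _)) h2; rewrite /Psi h1 h2.
  have -> : ((a.+1 == b) || (a == b.+1))%:R = (a.+1 == b)%:R + (a == b.+1)%:R :> R.
    by have [<-|] := eqVneq a.+1 b; [rewrite -natrD; congr _%:R; lia|rewrite add0r].
  by field.
- by lra.
- have cr : continuous (fun t : R => r * cos t).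
    by move=> t; apply: cvgM; [exact: cvg_cst|exact: continuous_cos].
  have sr : continuous (fun t : R => r * sin t).
    by move=> t; apply: cvgM; [exact: cvg_cst|exact: continuous_sin].
  have cp : continuous (fun t : R => pi - t) by move=> t; apply: cvgB; [exact: cvg_cst|exact: cvg_id].
  apply: continuous_subspaceT => t; apply: cvgM; last exact: cr.
  have ccp : continuous (fun t : R => r * cos (pi - t)).
    by move=> u; exact: (@continuous_comp _ _ _ (fun t : R => pi - t) (fun t : R => r * cos t) u (cp u) (cr _)).
  have csp : continuous (fun t : R => r * sin (pi - t)).
    by move=> u; exact: (@continuous_comp _ _ _ (fun t : R => pi - t) (fun t : R => r * sin t) u (cp u) (sr _)).
  have h1 := @gform_continuous w a b _ _ cr sr t; have h2 := @gform_continuous w a b _ _ ccp csp t.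
  exact: (cvgB h1 h2).
- split; first by move=> x _; case: (dF x).
    by apply: cvg_at_right_filter; exact: cF.
  by apply: cvg_at_left_filter; exact: cF.
- by move=> x _; rewrite derive1E; case: (dF x).
Qed.

End Angular.

Section DiskMonomials.
Variable R : realType.
Local Notation mu := (@lebesgue_measure R).
Local Notation mu2 := (@lebesgue_measure R \x @lebesgue_measure R)%E.
Local Notation mR := (measurableTypeR R).
Local Notation plane := (mR * mR)%type.
Implicit Types (w z : R[i]).

Definition toC (p : plane) : R[i] := p.1 +i* p.2.

Lemma diskP (r : R) p : 0 <= r -> disk r p <-> normc (toC p) < r.
Proof.
move=> r0; have -> : normc (toC p) = Num.sqrt (p.1 ^+ 2 + p.2 ^+ 2) by [].
rewrite -(@ltr_sqr _ (Num.sqrt _)) ?nnegrE ?sqrtr_ge0 //.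
by rewrite sqr_sqrtr // addr_ge0 ?sqr_ge0.
Qed.

Lemma normc_conj z : normc (conjc z) = normc z.
Proof. by case: z => a b; rewrite /= sqrrN. Qed.

Lemma gform_bound w a b z (r : R) : normc z <= r ->
  `|gform w a b z| <= normc w * r ^+ (a + b).
Proof.
move=> zr; apply: le_trans (le_Re_normc _) _.
rewrite !normcM !normcX normc_conj -mulrA -exprD.
by apply: ler_wpM2l; [exact: normc_ge0|apply: lerXn2r => //; rewrite nnegrE ?normc_ge0 ?(le_trans (normc_ge0 _) zr)].
Qed.

Lemma measurable_gform w a b : measurable_fun [set: plane] (fun p => gform w a b (toC p)).
Proof.
apply: (@gform_closed R plane (fun f => measurable_fun [set: plane] f)).
- by move=> k; exact: measurable_cst.
- by move=> f g; exact: measurable_funD.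
- by move=> f g; exact: measurable_funM.
- exact: mfst.
- exact: msnd.
Qed.

Lemma gform_integrable w a b (r : R) : 0 <= r ->
  mu2.-integrable (disk r) (EFin \o (fun p => gform w a b (toC p))).
Proof.
move=> r0; apply: (@disk_integrable _ _ _ (normc w * r ^+ (a + b))).
  by apply: measurable_funTS; exact: measurable_gform.
by move=> p /(diskP p r0)/ltW; exact: gform_bound.
Qed.

Lemma sin_subst (K : R -> R) (r : R) : 0 < r -> continuous K ->
  (\int[mu]_(y in `[(- r)%R, r]) (K y)%:E =
   \int[mu]_(t in `[(- (pi / 2))%R, (pi / 2)%R]) (K (r * sin t) * (r * cos t))%R%:E)%E.
Proof.
move=> r0 cK; have pi0 := @pi_gt0 R.
pose F (t : R) := r * sin t.
have dF (t : R) : is_derive t 1 F (r * cos t).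
  by apply: is_derive_eq; rewrite /GRing.scale /=.
have dFE : derive1 F = (fun t => r * cos t).
  by apply/funext => t; rewrite derive1E; case: (dF t).
have cF (t : R) : {for t, continuous F}.
  by apply: differentiable_continuous; apply/derivable1_diffP; case: (dF t).
have cd : continuous (fun t : R => r * cos t).
  by move=> t; apply: cvgM; [exact: cvg_cst|exact: continuous_cos].
have F1 : F (pi / 2) = r by rewrite /F sin_pihalf mulr1.
have F2 : F (- (pi / 2)) = - r by rewrite /F sinN sin_pihalf mulrN1.
rewrite -[in LHS]F2 -[X in `[_, X]]F1 integration_by_substitution_increasing ?dFE //.
- by lra.
- by move=> x y hx hy xy; rewrite /F ltr_pM2l // ltr_sin.
- by apply/cvg_ex; eexists; apply: cvg_at_right_filter; exact: cd.
- by apply/cvg_ex; eexists; apply: cvg_at_left_filter; exact: cd.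
- split; first by move=> x _; case: (dF x).
    by apply: cvg_at_right_filter; exact: cF.
  by apply: cvg_at_left_filter; exact: cF.
- exact: continuous_subspaceT.
Qed.

(** The integrand is the x-derivative of [gform w a b], so slicing leaves its values at the ends of
    each chord; with y = r sin t these are [polar r t] and [polar r (pi - t)]. *)
Lemma disk_gform_step w a b (r : R) : 0 < r ->
  Rintegral mu2 (disk r)
    (fun p => a%:R * gform w a.-1 b (toC p) + b%:R * gform w a b.-1 (toC p)) =
  ((a.+1 == b) || (a == b.+1))%:R * Re w * pi * r ^+ (a + b).+1.
Proof.
move=> r0; have r0' := ltW r0.
pose phi p := a%:R * gform w a.-1 b (toC p) + b%:R * gform w a b.-1 (toC p).
have mphi : measurable_fun [set: plane] phi.
  by apply: measurable_funD; apply: measurable_funM;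
    [exact: measurable_cst|exact: measurable_gform|exact: measurable_cst|exact: measurable_gform].
have bphi p : disk r p ->
    `|phi p| <= a%:R * (normc w * r ^+ (a.-1 + b)) + b%:R * (normc w * r ^+ (a + b.-1)).
  move=> /(diskP p r0')/ltW hp; apply: le_trans (ler_normD _ _) _.
  by apply: lerD; rewrite normrM normr_nat; apply: ler_wpM2l => //; exact: gform_bound.
have cid : continuous (fun x : R => x) by move=> u; exact: cvg_id.
have cphi (y : R) : continuous (fun x : R => phi (x, y)).
  have cc : continuous (fun _ : R => y) by move=> u; exact: cvg_cst.
  have h1 := @gform_continuous _ w a.-1 b _ _ cid cc; have h2 := @gform_continuous _ w a b.-1 _ _ cid cc.
  by move=> x; exact: (cvgD (cvgM (cvg_cst _) (h1 x)) (cvgM (cvg_cst _) (h2 x))).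
have dphi (x y : R) : is_derive x 1 (fun x : R => gform w a b (x +i* y)) (phi (x, y)).
  exact: gform_derive.
rewrite /Rintegral -/phi (@disk_fubini R r phi _ _ r0 mphi bphi dphi cphi).
rewrite (sin_subst r0); last first.
  have csq : continuous (fun y : R => Num.sqrt (r ^+ 2 - y ^+ 2)).
    move=> y; apply: (@continuous_comp _ _ _ (fun y : R => r ^+ 2 - y ^+ 2) (@Num.sqrt R)).
      by apply: cvgB; [exact: cvg_cst|exact: exprn_continuous].
    exact: sqrt_continuous.
  have csqN : continuous (fun y : R => - Num.sqrt (r ^+ 2 - y ^+ 2)).
    by move=> y; apply: cvgN; exact: csq.
  have h1 := @gform_continuous _ w a b _ _ csq cid; have h2 := @gform_continuous _ w a b _ _ csqN cid.
  by move=> y; exact: (cvgB (h1 y) (h2 y)).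
have H := half_circle_integral w a b r.
set I := (X in fine X); suff -> : I = ((((a.+1 == b) || (a == b.+1))%:R * Re w * pi * r ^+ (a + b).+1)%R%:E)%E.
  by [].
rewrite -H /I.
apply: eq_integral => t; rewrite mem_setE in_itv => tP; congr EFin; congr (_ * _).
have c0 : 0 <= cos t by exact: cos_ge0_pihalf.
have -> : Num.sqrt (r ^+ 2 - (r * sin t) ^+ 2) = r * cos t.
  rewrite -[r * cos t]ger0_norm ?mulr_ge0 // -sqrtr_sqr; congr Num.sqrt.
  by rewrite !exprMn sin2cos2; ring.
rewrite /polar cosB sinB cospi sinpi; congr (_ - gform _ _ _ _).
by rewrite !mul0r !mulN1r !addr0 !sub0r opprK mulrN.
Qed.

End DiskMonomials.

Section DiskPolynomials.
Variable R : realType.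
Local Notation mu2 := (@lebesgue_measure R \x @lebesgue_measure R)%E.
Local Notation mR := (measurableTypeR R).
Local Notation plane := (mR * mR)%type.
Implicit Types (w z : R[i]).

Definition dint (r : R) (phi : plane -> R) : R := Rintegral mu2 (disk r) phi.

Definition dintegrable (r : R) (phi : plane -> R) : Prop :=
  mu2.-integrable (disk r) (EFin \o phi).

Lemma dintD r f g : dintegrable r f -> dintegrable r g ->
  dint r (fun p => f p + g p) = dint r f + dint r g.
Proof. by move=> hf hg; apply: RintegralD => //; exact: measurable_disk. Qed.

Lemma dintZ r k f : dintegrable r f -> dint r (fun p => k * f p) = k * dint r f.
Proof. by move=> hf; apply: RintegralZl => //; exact: measurable_disk. Qed.

Lemma dintegrableD r f g : dintegrable r f -> dintegrable r g -> dintegrable r (fun p => f p + g p).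
Proof. by move=> hf hg; exact: (integrableD (measurable_disk r) hf hg). Qed.

Lemma dintegrableZ r k f : dintegrable r f -> dintegrable r (fun p => k * f p).
Proof. by move=> hf; exact: (integrableZl (measurable_disk r) k hf). Qed.

Lemma dint_sum r n (h : 'I_n -> plane -> R) : (forall i, dintegrable r (h i)) ->
  dintegrable r (fun p => \sum_(i < n) h i p) /\
  dint r (fun p => \sum_(i < n) h i p) = \sum_(i < n) dint r (h i).
Proof.
elim: n h => [|n IH] h hi.
  have -> : (fun p => \sum_(i < 0) h i p) = (fun=> 0 : R) by apply/funext => p; rewrite big_ord0.
  rewrite big_ord0; split; last by rewrite /dint Rintegral_cst ?mul0r //; exact: measurable_disk.
  apply: (@disk_integrable _ _ _ 0); first exact: measurable_cst.
  by move=> p _; rewrite normr0.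
have -> : (fun p => \sum_(i < n.+1) h i p) = (fun p => \sum_(i < n) h (widen_ord (leqnSn n) i) p + h ord_max p).
  by apply/funext => p; rewrite big_ord_recr.
have [h1 h2] := IH (fun i => h (widen_ord (leqnSn n) i)) (fun i => hi _).
by split; [exact: dintegrableD|rewrite dintD // h2 big_ord_recr].
Qed.

(* The integral of [d/dx (z ^ n.+1 * conj z ^ m)] over the disc is a boundary term;
   this gives a recursion on [m]. *)
Lemma dint_gform w n m (r : R) : 0 < r ->
  dint r (fun p => gform w n m (toC p)) = (n == m)%:R * (Re w * pi * r ^+ (2 * n).+2 / n.+1%:R).
Proof.
move=> r0; have r0' := ltW r0.
have step (a b : nat) : a.+1%:R * dint r (fun p => gform w a b (toC p)) +
    b%:R * dint r (fun p => gform w a.+1 b.-1 (toC p)) =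
    ((a.+2 == b) || (a.+1 == b.+1))%:R * Re w * pi * r ^+ (a.+1 + b).+1.
  rewrite -(disk_gform_step w a.+1 b r0) -!dintZ; try exact: gform_integrable.
  by rewrite -dintD //; apply: dintegrableZ; exact: gform_integrable.
elim: m n => [|m IH] n.
  have := step n 0%N; rewrite mul0r addr0 orFb eqSS => /(canRL (mulKf _)) ->; last by rewrite pnatr_eq0.
  case: n => [|n]; last by rewrite /= !mul0r mulr0.
  by rewrite /= !mulr1n invr1 mulr1 !mul1r.
have := step n m.+1; rewrite IH => /(canRL (addrK _)) /(canRL (mulKf _)) ->; last by rewrite pnatr_eq0.
rewrite !eqSS; case: (eqVneq n.+1 m) => [e|ne].
  have -> : (n == m.+1) = false by apply/eqP; lia.
  rewrite orTb mul0r (_ : (n.+1 + m.+1).+1 = (2 * n.+1).+2); last by lia.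
  rewrite -e mulr1n !mul1r (_ : n.+2%:R * (Re w * pi * r ^+ (2 * n.+1).+2 / n.+2%:R) = Re w * pi * r ^+ (2 * n.+1).+2) ?subrr ?mulr0 //.
  by rewrite mulrC divfK // pnatr_eq0.
rewrite orFb mul0r mulr0 subr0; case: eqVneq => [->|_]; last by rewrite !mul0r mulr0.
rewrite mulr1n !mul1r (_ : (m.+2 + m.+1).+1 = (2 * m.+1).+2); last by lia.
by rewrite mulrC.
Qed.

Lemma dint_poly (A : nat -> R[i]) N (r : R) : 0 < r ->
  dintegrable r (fun p => normc (\sum_(k < N) A k * toC p ^+ k) ^+ 2) /\
  dint r (fun p => normc (\sum_(k < N) A k * toC p ^+ k) ^+ 2) =
    \sum_(k < N) normc (A k) ^+ 2 * pi * r ^+ (2 * k).+2 / k.+1%:R.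
Proof.
move=> r0; have r0' := ltW r0.
have -> : (fun p => normc (\sum_(k < N) A k * toC p ^+ k) ^+ 2) =
    (fun p => \sum_(n < N) \sum_(m < N) gform (A n * conjc (A m)) n m (toC p)).
  apply/funext => p; rewrite normc_sqE rmorph_sum /= mulr_suml Re_sum; apply: eq_bigr => n _.
  rewrite mulr_sumr Re_sum; apply: eq_bigr => m _; rewrite /gform rmorphM rmorphXn /=.
  by apply: (congr1 (@complex.Re R)); ring.
have i1 n m : dintegrable r (fun p => gform (A n * conjc (A m)) n m (toC p)).
  exact: gform_integrable.
have i2 (n : 'I_N) := @dint_sum r N (fun m p => gform (A n * conjc (A m)) n m (toC p)) (fun m => i1 n m).
have [h1 h2] := @dint_sum r N (fun n p => \sum_(m < N) gform (A n * conjc (A m)) n m (toC p)) (fun n => (i2 n).1).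
split; first exact: h1.
rewrite h2; apply: eq_bigr => n _; rewrite (i2 n).2.
rewrite (bigD1 n) //= big1 => [|m mn]; rewrite dint_gform //.
  by rewrite eqxx addr0 mul1r normc_sqE.
by rewrite eq_sym (_ : (m == n :> nat) = false) ?mul0r //; apply/negbTE.
Qed.

End DiskPolynomials.

(** * From polynomials to holomorphic functions on smaller discs *)

Section DiskLimit.
Variable R : realType.
Local Notation mu2 := (@lebesgue_measure R \x @lebesgue_measure R)%E.
Local Notation mR := (measurableTypeR R).
Local Notation plane := (mR * mR)%type.
Implicit Types (z w : R[i]) (f g : R[i] -> R[i]).

Lemma dint_near (r e : R) (f g : plane -> R) : dintegrable r f -> dintegrable r g ->
  (forall p, disk r p -> `|f p - g p| <= e) ->
  `|dint r f - dint r g| <= e * fine (mu2 (disk r)).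
Proof.
move=> hf hg h; have md := @measurable_disk R r.
rewrite /dint -RintegralB // -Rintegral_cst //.
have hfg := integrableB md hf hg.
apply: le_trans (le_normr_Rintegral md hfg) _; apply: le_Rintegral => //.
  exact: (integrable_norm hfg).
by apply: (@disk_integrable _ _ _ `|e|) => //; exact: measurable_cst.
Qed.

Lemma normc_dist z w : `|normc z - normc w| <= normc (z - w).
Proof.
rewrite ler_norml normc_sub_ge andbT lerNl opprB.
by rewrite normc_distC; exact: normc_sub_ge.
Qed.

Lemma disk_uniform f (r : R) : hol_disc f -> 0 < r -> r < 1 -> exists C q : R,
  [/\ 0 < C, 0 <= q, q < 1 & forall N p, disk r p ->
    `|normc (f (toC p)) ^+ 2 - normc (tpoly f N (toC p)) ^+ 2| <= C * q ^+ N].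
Proof.
move=> hf r0 r1; pose s := (1 + r) / 2.
have [rs s1] : r < s /\ s < 1 by rewrite /s; split; lra.
have s0 : 0 < s by lra.
have [M0 hM0] := hol_bounded s1 hf.
pose M := `|M0| + 1; have M1 : 0 < M by rewrite ltr_wpDl.
have hM z : normc z <= s -> normc (f z) <= M.
  by move=> /hM0 h; apply: le_trans h _; rewrite /M; have := ler_norm M0; lra.
pose D := 2 * M * (s / (s - r)).
have sr0 : 0 < s - r by lra.
have D0 : 0 < D by apply: mulr_gt0; [lra|apply: divr_gt0].
have q0 : 0 <= r / s by rewrite divr_ge0 // ltW.
have q1 : r / s < 1 by rewrite ltr_pdivrMr // mul1r.
exists (D * (2 * M + D)), (r / s); split => //; first by apply: mulr_gt0 => //; lra.
move=> N p /(diskP p (ltW r0)) pr; set a := toC p in pr *.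
have as_ : normc a < s by lra.
have err : normc (f a - tpoly f N a) <= D * (r / s) ^+ N.
  apply: le_trans (tpoly_err N hf as_ s1 hM) _.
  rewrite (_ : D * _ = 2 * M * (r / s) ^+ N * (s / (s - r))); last by rewrite /D; ring.
  have sa : 0 < s - normc a by lra.
  apply: ler_pM.
  - by apply: mulr_ge0; [lra|apply: exprn_ge0; apply: divr_ge0; [exact: normc_ge0|lra]].
  - by apply: divr_ge0; lra.
  - apply: ler_wpM2l; first lra.
    apply: lerXn2r; rewrite ?nnegrE //; first by apply: divr_ge0; [exact: normc_ge0|lra].
    by rewrite ler_pM2r ?invr_gt0 // ltW.
  - by rewrite ler_pM2l // lef_pV2 ?posrE //; lra.
have qN : (r / s) ^+ N <= 1 by apply: exprn_ile1 => //; exact: ltW.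
have d1 := normc_dist (f a) (tpoly f N a); have fa : normc (f a) <= M by apply: hM; exact: ltW.
have f0 := normc_ge0 (f a); have t0 := normc_ge0 (tpoly f N a).
have qN0 : 0 <= (r / s) ^+ N by exact: exprn_ge0.
set u := normc (f a) in d1 fa f0 *; set v := normc (tpoly f N a) in d1 t0 *.
set Q := (r / s) ^+ N in err qN qN0 *; set E := normc (f a - _) in err d1.
have DQ : D * Q <= D by rewrite ler_piMr // ltW.
have uv : u + v <= 2 * M + D by move: d1; rewrite ler_norml => /andP[]; lra.
rewrite subr_sqr normrM (ger0_norm (addr_ge0 f0 t0)) mulrAC.
apply: ler_pM => //; first exact: addr_ge0.
exact: le_trans d1 err.
Qed.

(** Parseval's formula for the Taylor polynomials carries over by their uniform convergence on the
    disc. Measurability of |f|^2 comes from the same approximation. *)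
Lemma disk_limit f (r : R) : hol_disc f -> 0 < r -> r < 1 ->
  dintegrable r (fun p => normc (f (toC p)) ^+ 2) /\
  forall e, 0 < e -> exists N0, forall N, (N0 <= N)%N ->
    `|dint r (fun p => normc (f (toC p)) ^+ 2) -
      \sum_(k < N) normc (tcoef f k) ^+ 2 * pi * r ^+ (2 * k).+2 / k.+1%:R| <= e.
Proof.
move=> hf r0 r1; have [C [q [C0 q0 q1 hC]]] := disk_uniform hf r0 r1.
have hp N := dint_poly (tcoef f) N r0.
have mf : measurable_fun (disk r) (fun p => normc (f (toC p)) ^+ 2).
  apply: (@measurable_fun_cvg _ _ _ _ (fun N p => normc (tpoly f N (toC p)) ^+ 2)) => [N|p pr].
    by apply/measurable_EFinP; exact: measurable_int (hp N).1.
  apply/cvgrPdist_le => e e0; have [N0 hN0] := pow_small q0 q1 (divr_gt0 e0 C0).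
  exists N0 => // N /= hN; apply: le_trans (hC N p pr) _.
  by rewrite mulrC -ler_pdivlMr // hN0.
have fi : dintegrable r (fun p => normc (f (toC p)) ^+ 2).
  have [M hM] := hol_bounded r1 hf.
  apply: (@disk_integrable _ _ _ (M ^+ 2)) => // p /(diskP p (ltW r0))/ltW/hM h.
  by rewrite ger0_norm ?sqr_ge0 // ler_sqr // nnegrE ?normc_ge0 // (le_trans (normc_ge0 _) h).
split => // e e0; set m := fine (mu2 (disk r)).
have m0 : 0 <= m by exact: fine_ge0.
have K0 : 0 < C * (m + 1) by rewrite mulr_gt0 // ltr_wpDl.
have [N0 hN0] := pow_small q0 q1 (divr_gt0 e0 K0).
exists N0 => N hN; rewrite -(hp N).2.
apply: le_trans (dint_near fi (hp N).1 (hC N)) _.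
have := hN0 N hN; rewrite ler_pdivlMr // => h; apply: le_trans h.
rewrite mulrC mulrA (mulrC (q ^+ N)); apply: ler_wpM2r; first exact: exprn_ge0.
by rewrite mulrC; apply: ler_wpM2l; [exact: ltW|rewrite lerDl].
Qed.

(** The series of [series_ineq], multiplied by pi r^2, is term by term the difference of the two
    area integrals. *)
Lemma disk_ineq f g (t c eta : R) a0 : hol_disc f -> hol_disc g ->
  0 <= t -> t < 1 -> 0 < c -> c < 3 / 7 * eta -> eta < 1 ->
  (forall z, c < normc z < 1 -> normc (f z) <= normc (g z)) ->
  normc a0 < 1 -> g a0 != 0 ->
  exists r, [/\ eta < r, r < 1 &
    t ^+ 2 * dint r (fun p => normc (f (toC p)) ^+ 2) <= dint r (fun p => normc (g (toC p)) ^+ 2)].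
Proof.
move=> hf hg t0 t1 c0 ceta eta1 fg a01 ga0.
have [r [er r1 hr]] := series_ineq hf hg t0 t1 c0 ceta eta1 fg a01 ga0.
exists r; split => //; have r0 : 0 < r by lra.
have [_ lf] := disk_limit hf r0 r1; have [_ lg] := disk_limit hg r0 r1.
set If := dint _ _ in lf *; set Ig := dint _ _ in lg *.
apply/ler_addgt0Pr => e e0.
have e3 : 0 < e / 3 by lra.
have pr0 : 0 < pi * r ^+ 2 by rewrite mulr_gt0 ?pi_gt0 // exprn_gt0.
have [N1 h1] := lf _ e3; have [N2 h2] := lg _ e3; have [N3 h3] := hr _ (divr_gt0 e3 pr0).
pose N := (N1 + N2 + N3)%N.
have n1 : (N1 <= N)%N by rewrite /N -addnA leq_addr.
have n2 : (N2 <= N)%N by rewrite /N addnAC leq_addl.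
have n3 : (N3 <= N)%N by rewrite /N leq_addl.
move: (h1 N n1) (h2 N n2) (h3 N n3) => {h1 h2 h3}.
set Sf := \sum_(k < N) normc (tcoef f k) ^+ 2 * _ * _ / _.
set Sg := \sum_(k < N) normc (tcoef g k) ^+ 2 * _ * _ / _.
set S := \sum_(n < N) _.
have SE : pi * r ^+ 2 * S = Sg - t ^+ 2 * Sf.
  rewrite /S /Sg /Sf !mulr_sumr -sumrB; apply: eq_bigr => k _.
  rewrite -(addn2 (2 * k)) exprD; move: (r ^+ (2 * k)) => x; field; by rewrite nat1r pnatr_eq0.
rewrite -mulNr ler_pdivrMr // [S * _]mulrC SE !ler_norml => /andP[f1 f2] /andP[g1 g2] hS.
have t21 : t ^+ 2 <= 1 by rewrite expr_le1 // ltW.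
have t20 := sqr_ge0 t.
have : t ^+ 2 * (If - Sf) <= 1 * (e / 3) by nra.
lra.
Qed.

End DiskLimit.

(** * From smaller discs to the Bergman norm *)

Section BergmanComparison.
Variable R : realType.
Local Notation mu2 := (@lebesgue_measure R \x @lebesgue_measure R)%E.
Local Notation mR := (measurableTypeR R).
Implicit Types (z w : R[i]) (f g : R[i] -> R[i]).

Lemma measurable_sqnormc f : hol_disc f ->
  measurable_fun (disk (1 : R)) (fun p => normc (f (toC p)) ^+ 2).
Proof.
move=> hf; apply: (@measurable_fun_cvg _ _ _ _ (fun N p => normc (tpoly f N (toC p)) ^+ 2)) => [N|p].
  by apply/measurable_EFinP; exact: measurable_int (dint_poly (tcoef f) N ltr01).1.
move=> /(diskP p ler01) p1; have p0 := normc_ge0 (toC p).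
pose r := (1 + normc (toC p)) / 2.
have [r0 r1 pr] : [/\ 0 < r, r < 1 & normc (toC p) < r] by rewrite /r; split; lra.
have [C [q [C0 q0 q1 hC]]] := disk_uniform hf r0 r1.
apply/cvgrPdist_le => e e0; have [N0 hN0] := pow_small q0 q1 (divr_gt0 e0 C0).
exists N0 => // N /= hN; apply: le_trans (hC N p _) _; first by apply/(diskP p (ltW r0)).
by rewrite mulrC -ler_pdivlMr // hN0.
Qed.

Definition sqint f (r : R) : \bar R := (\int[mu2]_(p in disk r) (normc (f (toC p)) ^+ 2)%:E)%E.

Lemma disk_sub (r s : R) : 0 <= r -> r <= s -> disk r `<=` disk s.
Proof.
move=> r0 rs p; rewrite /disk /= => h; apply: lt_le_trans h _.
by apply: lerXn2r => //; rewrite nnegrE // (le_trans r0).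
Qed.

Lemma sqint_le f (r s : R) : hol_disc f -> 0 <= r -> r <= s -> s <= 1 ->
  (sqint f r <= sqint f s)%E.
Proof.
move=> hf r0 rs s1; have s0 := le_trans r0 rs; apply: ge0_subset_integral.
- exact: measurable_disk.
- exact: measurable_disk.
- apply/measurable_EFinP; apply: measurable_funS (measurable_sqnormc hf).
    exact: measurable_disk.
  exact: disk_sub.
- by move=> p _; rewrite lee_fin sqr_ge0.
- exact: disk_sub.
Qed.

Lemma sqint_dint f (r : R) : hol_disc f -> 0 < r -> r < 1 ->
  sqint f r = (dint r (fun p => normc (f (toC p)) ^+ 2))%:E.
Proof.
move=> hf r0 r1; have [hi _] := disk_limit hf r0 r1.
by rewrite /dint /Rintegral fineK //; apply: integrable_fin_num hi; exact: measurable_disk.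
Qed.

(** Monotone convergence along the radii 1 - 1/(n+2), whose discs exhaust the unit disc. *)
Lemma sqint_lim f (B : \bar R) : hol_disc f ->
  (forall r, 0 < r -> r < 1 -> (sqint f r <= B)%E) -> (sqint f 1 <= B)%E.
Proof.
move=> hf hB; pose r (n : nat) : R := 1 - n.+2%:R^-1.
have rn n : 0 < r n /\ r n < 1.
  rewrite /r subr_gt0 gtrBl invr_gt0 ltr0n invf_lt1 ?ltr0n //; split => //.
  by rewrite ltr1n.
have nd : {homo r : m n / (m <= n)%N >-> m <= n}.
  by move=> m n mn; rewrite /r lerD2l lerN2 lef_pV2 ?posrE ?ltr0n // ler_nat.
have U : \bigcup_n disk (r n) = disk 1.
  apply/seteqP; split => p; first by move=> [n _]; apply: disk_sub; [apply: ltW|apply: ltW]; case: (rn n).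
  move=> /(diskP p ler01) p1.
  have d0 : 0 < 1 - normc (toC p) by rewrite subr_gt0.
  have [n hn] : exists n : nat, n.+2%:R^-1 < 1 - normc (toC p).
    exists (Num.truncn (1 - normc (toC p))^-1).
    rewrite invf_plt ?posrE ?ltr0n //.
    by apply: lt_trans (truncnS_gt _) _; rewrite ltr_nat.
  exists n => //; apply/(diskP p (ltW (rn n).1)).
  by rewrite /r ltrBrDr addrC -ltrBrDr.
have ndF : nondecreasing_seq (fun n => disk (r n)).
  by move=> m n mn; apply/subsetPset/disk_sub; [apply: ltW; case: (rn m)|exact: nd].
have := @ge0_nondecreasing_set_cvg_integral _ _ R (fun n => disk (r n))
  (fun p => (normc (f (toC p)) ^+ 2)%:E) mu2 ndF (fun n => measurable_disk (r n)).
rewrite U => h.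
have {}h : (sqint f (r n) @[n --> \oo] --> sqint f 1)%E.
  apply: h => [n|n p _]; last by rewrite lee_fin sqr_ge0.
  apply/measurable_EFinP; apply: measurable_funS (measurable_sqnormc hf).
    exact: measurable_disk.
  by apply: disk_sub; [apply: ltW|apply: ltW]; case: (rn n).
rewrite -(cvg_lim _ h) //; apply: lime_le; first by apply/cvg_ex; eexists; exact: h.
by near=> n; apply: hB; case: (rn n).
Unshelve. all: by end_near. Qed.

Lemma sqint_ge0 f (r : R) : (0 <= sqint f r)%E.
Proof. by apply: integral_ge0 => p _; rewrite lee_fin sqr_ge0. Qed.

(** Settles the case g = 0, where no point with g a0 != 0 exists: read on a circle inside the
    annulus, all Taylor coefficients of [f] are zero. *)
Lemma sqint_vanish f (c r : R) : hol_disc f -> 0 < c -> c < 1 ->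
  (forall z, c < normc z < 1 -> f z = 0) -> 0 < r -> r < 1 -> sqint f r = 0%E.
Proof.
move=> hf c0 c1 fz r0 r1; rewrite (sqint_dint hf r0 r1); congr EFin.
have [_ lim] := disk_limit hf r0 r1.
have t0 k : tcoef f k = 0.
  have s0 : 0 < (1 + c) / 2 by lra.
  have s1 : (1 + c) / 2 < 1 by lra.
  rewrite -(tcoefE k hf s0 s1) -[RHS](cmeant_cst 0); apply: cmeant_ext => t.
  by rewrite fz ?mul0r // normc_polar ?(ltW s0) //; apply/andP; split; lra.
apply/eqP; rewrite -normr_le0; apply/ler_addgt0Pr => e /lim[N0 /(_ _ (leqnn N0))].
rewrite big1 ?subr0 ?add0r // => k _.
by rewrite t0 normc0 expr0n !mul0r.
Qed.

Lemma sqint_mono f g (c : R) : hol_disc f -> hol_disc g -> 0 < c -> c < 3 / 7 ->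
  (forall z, c < normc z < 1 -> normc (f z) <= normc (g z)) ->
  (sqint f 1 <= sqint g 1)%E.
Proof.
move=> hf hg c0 c37 fg; apply: sqint_lim => // r r0 r1.
have [[a0 [a01 ga0]]|g0] := pselect (exists a0, normc a0 < 1 /\ g a0 != 0); last first.
  rewrite (@sqint_vanish f c r) ?sqint_ge0 //; first lra.
  move=> z hz; apply/eqP; rewrite -normc_eq0 -normr_le0 ger0_norm ?normc_ge0 //.
  have -> : 0 = normc (g z); last exact: fg.
  have [->|gz] := eqVneq (g z) 0; first by rewrite normc0.
  by case: g0; exists z; case/andP: hz.
have key t : 0 < t -> t < 1 -> ((t ^+ 2)%:E * sqint f r <= sqint g 1)%E.
  (* The first entry makes the disc of radius s > eta contain that of radius [r]; the second makes
     3/7 eta exceed [c], since 7 c / 3 < 1. *)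
  move=> t0 t1; pose eta := Num.max r ((c * 7 / 3 + 1) / 2).
  have er : r <= eta by rewrite le_max lexx.
  have ec : (c * 7 / 3 + 1) / 2 <= eta by rewrite le_max lexx orbT.
  have e1 : eta < 1 by rewrite gt_max r1 /=; lra.
  have ce : c < 3 / 7 * eta by lra.
  have [s [es s1 hs]] := disk_ineq hf hg (ltW t0) t1 c0 ce e1 fg a01 ga0.
  have s0 : 0 < s by lra.
  apply: le_trans (sqint_le hg (ltW s0) (ltW s1) (lexx 1)).
  rewrite (sqint_dint hg s0 s1); apply: le_trans (_ : _ <= (t ^+ 2)%:E * sqint f s)%E _.
    apply: lee_wpmul2l; first by rewrite lee_fin sqr_ge0.
    by apply: sqint_le => //; [exact: ltW|lra|exact: ltW].
  by rewrite (sqint_dint hf s0 s1) -EFinM lee_fin.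
rewrite (sqint_dint hf r0 r1); rewrite (sqint_dint hf r0 r1) in key.
set I := dint _ _ in key *.
have I0 : 0 <= I by apply: Rintegral_ge0 => p _; exact: sqr_ge0.
move: key; case: (sqint g 1) (sqint_ge0 g 1) => [G|_ _|//]; last by rewrite leey.
rewrite lee_fin => G0 key; rewrite lee_fin; apply/ler_addgt0Pr => e e0.
have [I1|I1] := leP I (G + e) => //.
(* If [I] exceeded G + e, this t < 1 would give t^2 I = G + e/2 > G, against [key]. *)
pose t := Num.sqrt ((G + e / 2) / I).
have Ip : 0 < I by lra.
have t2 : t ^+ 2 = (G + e / 2) / I by rewrite sqr_sqrtr // divr_ge0 //; lra.
have t0 : 0 < t by rewrite sqrtr_gt0 divr_gt0 //; lra.
have t1 : t < 1.
  rewrite -(@ltr_sqr _ t 1) ?nnegrE ?(ltW t0) // t2 expr1n ltr_pdivrMr // mul1r; lra.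
by have := key t t0 t1; rewrite -EFinM lee_fin t2 divfK ?gt_eqF //; lra.
Qed.

Lemma normcC_lt1 z : ((normc z)%:C < 1) = (normc z < 1).
Proof. by rewrite -[X in _ < X]/((1 : R)%:C) ltcR. Qed.

Lemma unit_diskP (z : Cplx R) : unit_disk z <-> normc z < 1.
Proof. by rewrite /unit_disk /= normE normcC_lt1. Qed.

Lemma bergman_sqnormE f : bergman_sqnorm f = ((pi^-1)%:E * sqint f 1)%E.
Proof.
rewrite /bergman_sqnorm /sqint; congr (_ * integral _ _ _)%E.
by apply/seteqP; split => p; [move=> /unit_diskP/(diskP p ler01)|move=> /(diskP p ler01)/unit_diskP].
Qed.

Lemma bergman_norm_le (c : R) f g : 0 < c -> c < 3 / 7 -> bergman f -> bergman g ->
  (forall z : Cplx R, c%:C < `|z| < 1 -> `|f z| <= `|g z|) ->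
  bergman_norm f <= bergman_norm g.
Proof.
move=> c0 c37 [hf fi] [hg gi] fg.
have hd (h : Cplx R -> Cplx R) : holomorphic_on (@unit_disk R) h -> hol_disc h.
  by move=> hh z /unit_diskP z1; apply: Hol; exact: hh.
have fg' z : c < normc z < 1 -> normc (f z) <= normc (g z).
  by move=> hz; have := fg z; rewrite !normE ltcR normcC_lt1 lecR; apply.
have pi0 : (0 <= (pi^-1 : R)%:E)%E by rewrite lee_fin invr_ge0 pi_ge0.
have nn (h : Cplx R -> Cplx R) : (0 <= bergman_sqnorm h)%E by rewrite bergman_sqnormE mule_ge0 ?sqint_ge0.
(* [fine] sends +oo to 0, so its monotonicity needs both square norms to be finite, which membership
   in [bergman] provides. *)
rewrite /bergman_norm; apply: ler_wsqrtr; apply: fine_le.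
- by rewrite ge0_fin_numE.
- by rewrite ge0_fin_numE.
- rewrite !bergman_sqnormE; apply: lee_wpmul2l => //.
  exact: (sqint_mono (hd _ hf) (hd _ hg) c0 c37 fg').
Qed.

End BergmanComparison.

Theorem theorem1p1 (R : realType) :
  4263 / 10000 <= korenblum_constant R /\
  (forall f g : Cplx R -> Cplx R, bergman f -> bergman g ->
     (forall z : Cplx R, (4263 / 10000 : R)%:C < `|z| < 1 ->
        `|f z| <= `|g z|) ->
     bergman_norm f <= bergman_norm g).
Proof.
have c0 : 0 < 4263 / 10000 :> R by lra.
have c1 : 4263 / 10000 < 3 / 7 :> R by lra.
split; last by move=> f g; exact: bergman_norm_le.
(* An element lies below [sup] once the set is bounded; admissible constants are below 1 by
   definition. *)
apply: ub_le_sup; first by exists 1 => c [/andP[_ /ltW]].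
split; first by apply/andP; split; lra.
by move=> f g; exact: bergman_norm_le.
Qed.
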